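(* Let $k\ge 2$ and suppose that MAX-$k$DM-$k$ is hard to approximate within some factor $\alpha<1$. Then TAP restricted to $k$-occurrence, $k$-weight instances is hard to $\alpha$-approximate.
   Context: Target Approximation Problem (TAP): the input is a groundset $U$ of features, a target $T\subseteq U$, and a collection $S$ of exemplars, each a subset of $U$. Features in $U\cap T$ are blue, features in $U\setminus T$ are red. A feature appears in $S'\subseteq S$ if it lies in $\bigcup_{E\in S'}E$. The margin of $S'$ is (number of blue features appearing in $S'$) minus (number of red features appearing in $S'$); TAP asks for $S'$ of maximum margin. It is assumed that every feature appears in at least one exemplar and that $T$ and all exemplars are nonempty. An instance is $k$-occurrence if every feature belongs to at most $k$ exemplars, and $k$-weight if every exemplar contains at most $k$ features. $k$-dimensional matching: given sets $S_1,\dots,S_k$ and a collection $C\subseteq S_1\times\cdots\times S_k$ of $k$-tuples, find a largest subcollection of $C$ in which no element of any $S_i$ appears in more than one chosen tuple. MAX-$k$DM-$k$ is this problem restricted to instances in which each element occurs in at most $k$ tuples of $C$. A maximization problem is hard to $\alpha$-approximate (hard to approximate within $\alpha$) if it is NP-hard to compute, for every instance, a feasible solution whose value is at least $\alpha$ times the optimum. *)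

(* Defs.v *)
From Stdlib Require Import ZArith Reals.
From mathcomp Require Import all_boot.


Definition sym := option bool.              (* None = blank *)
Inductive move := MoveL | MoveR | Stay.

Record TM := MkTM {
  tm_n     : nat;
  tm_start : 'I_tm_n.+1;
  tm_halt  : 'I_tm_n.+1 -> bool;
  tm_query : 'I_tm_n.+1 -> bool;
  tm_delta : 'I_tm_n.+1 -> sym -> 'I_tm_n.+1 * sym * move
}.

Set Implicit Arguments.
Unset Strict Implicit.
Unset Printing Implicit Defensive.

(* configuration: state, left part of tape (reversed, nearest cell first),
   scanned symbol, right part of tape. Unlisted cells are blank. *)
Definition config (M : TM) : Type := ('I_(tm_n M).+1 * seq sym * sym * seq sym)%type.

Fixpoint read_word (s : seq sym) : seq bool :=
  match s with
  | Some b :: t => b :: read_word t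
  | _ => [::]
  end.

Definition step (M : TM) (g : seq bool -> seq bool) (c : config M) : config M :=
  let: (q, l, h, r) := c in
  if tm_halt M q then c
  else if tm_query M q then
    let w := read_word (h :: r) in
    let rest := drop (size w) (h :: r) in
    let tape := map Some (g w) ++ rest in
    ((tm_delta M q h).1.1, l, head None tape, behead tape)
  else
    let: (q', s, m) := tm_delta M q h in
    match m with
    | MoveL => match l with
               | [::] => (q', [::], None, s :: r)
               | a :: l' => (q', l', a, s :: r)
               end
    | MoveR => match r with
               | [::] => (q', s :: l, None, [::])
               | a :: r' => (q', s :: l, a, r')
               end
    | Stay => (q', l, s, r)
    end.

Definition init (M : TM) (x : seq bool) : config M :=
  (tm_start M, [::], head None (map Some x), behead (map Some x)).

Definition run (M : TM) (g : seq bool -> seq bool) (t : nat) (x : seq bool) : config M :=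
  iter t (@step M g) (@init M x).

Definition halted (M : TM) (c : config M) : bool :=
  let: (q, _, _, _) := c in tm_halt M q.

Definition output (M : TM) (c : config M) : seq bool :=
  let: (_, _, h, r) := c in read_word (h :: r).

Definition decides_in (M : TM) (g : seq bool -> seq bool) (c : nat)
    (L : seq bool -> Prop) : Prop :=
  forall x : seq bool,
    let cf := run M g (c * (size x).+1 ^ c) x in
    halted cf /\ exists b : bool, output cf = [:: b] /\ (b = true <-> L x).

(* P: decidable in polynomial time by a machine whose oracle answers are
   always empty (a trivially computable oracle, so this is ordinary P). *)
Definition inP (L : seq bool -> Prop) : Prop :=
  exists (M : TM) (c : nat), decides_in M (fun _ => [::]) c L.

Definition pair_enc (x y : seq bool) : seq bool :=
  flatten (map (fun b => [:: b; b]) x) ++ [:: false; true] ++ y.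

Definition inNP (L : seq bool -> Prop) : Prop :=
  exists (V : seq bool -> Prop) (d : nat),
    inP V /\
    forall x, L x <-> exists y, size y <= d * (size x).+1 ^ d /\ V (pair_enc x y).

(* A search (function) problem is given by the predicate [ok g] saying that
   g : seq bool -> seq bool is a correct answer function (on the instances of
   the problem; behaviour on other strings is unconstrained).  It is NP-hard
   if every NP language is decidable in polynomial time by one oracle machine
   using ANY correct answer function as oracle (Cook reduction). *)
Definition NPhard_search (ok : (seq bool -> seq bool) -> Prop) : Prop :=
  forall L, inNP L ->
    exists (M : TM) (c : nat), forall g, ok g -> decides_in M g c L.

Definition enc_nat (n : nat) : seq bool := nseq n true ++ [:: false].
Definition enc_seqn (s : seq nat) : seq bool :=
  enc_nat (size s) ++ flatten (map enc_nat s).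
Definition enc_seqseq (ss : seq (seq nat)) : seq bool :=
  enc_nat (size ss) ++ flatten (map enc_seqn ss).

(*    Features are 0..u-1, the target T and each exemplar are finite sets of *)
(*    features, represented canonically as strictly increasing lists;        *)
(*    the collection S of exemplars is a duplicate-free list.                *)

Record tap_inst := TapInst {
  tap_u : nat;
  tap_T : seq nat;
  tap_S : seq (seq nat)
}.

Definition tap_valid (I : tap_inst) : bool :=
  let u := tap_u I in
  [&& sorted ltn (tap_T I), all (fun x => x < u) (tap_T I), tap_T I != [::],
      uniq (tap_S I),
      all (fun E => [&& sorted ltn E, E != [::] & all (fun x => x < u) E]) (tap_S I)
    & all (fun f => has (fun E => f \in E) (tap_S I)) (iota 0 u)].

Definition tap_k_occurrence (k : nat) (I : tap_inst) : bool :=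
  all (fun f => count (fun E => f \in E) (tap_S I) <= k) (iota 0 (tap_u I)).

Definition tap_k_weight (k : nat) (I : tap_inst) : bool :=
  all (fun E => size E <= k) (tap_S I).

(* a sub-collection S' is given by the (distinct) indices of its exemplars *)
Definition tap_feasible (I : tap_inst) (sol : seq nat) : bool :=
  uniq sol && all (fun j => j < size (tap_S I)) sol.

Definition tap_appears (I : tap_inst) (sol : seq nat) (f : nat) : bool :=
  has (fun j => f \in nth [::] (tap_S I) j) sol.

Definition tap_margin (I : tap_inst) (sol : seq nat) : Z :=
  (Z.of_nat (count (fun f => tap_appears I sol f && (f \in tap_T I)) (iota 0 (tap_u I)))
   - Z.of_nat (count (fun f => tap_appears I sol f && (f \notin tap_T I)) (iota 0 (tap_u I))))%Z.

Definition tap_is_opt (I : tap_inst) (z : Z) : Prop :=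
  (exists sol, tap_feasible I sol /\ tap_margin I sol = z) /\
  (forall sol, tap_feasible I sol -> (tap_margin I sol <= z)%Z).

Definition enc_tap (I : tap_inst) : seq bool :=
  enc_nat (tap_u I) ++ enc_seqn (tap_T I) ++ enc_seqseq (tap_S I).

Definition tap_kk_approx_ok (k : nat) (alpha : R) (g : seq bool -> seq bool) : Prop :=
  forall I, tap_valid I -> tap_k_occurrence k I -> tap_k_weight k I ->
    exists sol, g (enc_tap I) = enc_seqn sol /\ tap_feasible I sol /\
      forall z, tap_is_opt I z -> Rle (Rmult alpha (IZR z)) (IZR (tap_margin I sol)).

(* 4. MAX-kDM-k.  S_i = {0,..,n_i - 1} (i < k), C a duplicate-free list of    *)
(*    k-tuples (lists of length k) with t_i < n_i.                            *)

Record dm_inst := DmInst {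
  dm_sizes : seq nat;
  dm_C : seq (seq nat)
}.

Definition dm_valid (k : nat) (I : dm_inst) : bool :=
  [&& size (dm_sizes I) == k, uniq (dm_C I) &
      all (fun t => (size t == k) &&
             all (fun i => nth 0 t i < nth 0 (dm_sizes I) i) (iota 0 k)) (dm_C I)].

Definition dm_k_occurrence (k : nat) (I : dm_inst) : bool :=
  all (fun i => all (fun a => count (fun t => nth 0 t i == a) (dm_C I) <= k)
                    (iota 0 (nth 0 (dm_sizes I) i)))
      (iota 0 (size (dm_sizes I))).

Definition dm_feasible (I : dm_inst) (sol : seq nat) : bool :=
  [&& uniq sol, all (fun j => j < size (dm_C I)) sol &
      all (fun j => all (fun j' => (j == j') ||
             all (fun i => nth 0 (nth [::] (dm_C I) j) i != nth 0 (nth [::] (dm_C I) j') i)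
                 (iota 0 (size (dm_sizes I)))) sol) sol].

Definition dm_is_opt (I : dm_inst) (n : nat) : Prop :=
  (exists sol, dm_feasible I sol /\ size sol = n) /\
  (forall sol, dm_feasible I sol -> size sol <= n).

Definition enc_dm (I : dm_inst) : seq bool :=
  enc_seqn (dm_sizes I) ++ enc_seqseq (dm_C I).

Definition dm_approx_ok (k : nat) (alpha : R) (g : seq bool -> seq bool) : Prop :=
  forall I, dm_valid k I -> dm_k_occurrence k I ->
    exists sol, g (enc_dm I) = enc_seqn sol /\ dm_feasible I sol /\
      forall n, dm_is_opt I n -> Rle (Rmult alpha (INR n)) (INR (size sol)).

Definition MaxkDMk_hard (k : nat) (alpha : R) : Prop := NPhard_search (dm_approx_ok k alpha).
Definition TAP_kk_hard (k : nat) (alpha : R) : Prop := NPhard_search (tap_kk_approx_ok k alpha).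

(* Main.v *)
(** A matching instance with tuples t < m and entries c(t,i) < N (i < k) becomes
    the following TAP instance.  There is a blue feature for every possible
    element (a,i), and each tuple t owns k - 1 red features.  The pair (t,i)
    yields the exemplar made of the element (c(t,i),i) and the red features of t.
    Touching a tuple therefore costs k - 1 and gains at most the number of new
    elements, so the marginal value of a tuple is at most 1, and it is positive
    only if the tuple avoids all elements seen before: the touched tuples that
    meet no earlier touched tuple form a matching at least as large as the
    margin, while a matching of size n has margin n.  Elements outside all tuples
    are paired with a private red feature, so that they never help.

    To turn this into a Cook reduction for the given machine model, an oracle
    machine is simulated on a tape holding a list of blank-separated binary
    registers; a query acts on one register and leaves the others alone.  The
    two translations (instance to instance, answer to answer) are written in a
    small comprehension language over lists of numbers, all of whose programs run
    in polynomial time.  Since each element occurs in at most k tuples, the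
    encoding of an instance is at least as long as that of any set of tuple
    indices, so the simulated tape grows by O(1) cells per step. *)

(* The k exemplars of a tuple share its k - 1 red features. So such a red feature occurs exactly k
   times, such an exemplar has exactly 1 + (k - 1) features, and selecting only some of the k
   exemplars saves nothing of the cost k - 1.

   The obstacle is the oracle model. A query takes one step however long the answer is, so answers
   longer than their questions by a constant factor could compound over successive queries to a tape
   of superpolynomial length; a polynomial bound on each answer would not do. Numbers are written in
   unary, so m tuple indices may take about m^2/2 bits. The question has room for them: in one
   coordinate no value occurs more than k times, so its m entries sum to roughly m^2/(2k) at least,
   and the k coordinates together reach m^2/2.

   The simulated machine may also query arbitrary words, while the TAP oracle is constrained on
   valid instances only. Hence every word is turned into a valid gadget, and the length bounds are
   proved for all words. *)
Require Import Defs.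
From Stdlib Require Import ZArith Reals FunctionalExtensionality.
From mathcomp Require Import all_boot zify.

Set Implicit Arguments.
Unset Strict Implicit.
Unset Printing Implicit Defensive.

(** * Structured tape programs *)

Notation oracle := (seq bool -> seq bool).

(** Lists of cells that differ by trailing blanks describe the same tape; viewing a list through
    [nth None] as an infinite stream makes them equal. *)
Definition stream := nat -> sym.
Definition scons (a : sym) (s : stream) : stream :=
  fun n => if n is m.+1 then s m else a.
Definition stl (s : stream) : stream := fun n => s n.+1.
Definition scat (w : seq sym) (s : stream) : stream := foldr scons s w.
Definition blanks : stream := fun _ => None.

Lemma stl_scons a s : stl (scons a s) = s.
Proof. by []. Qed.

Lemma scons_eta s : scons (s 0) (stl s) = s.
Proof. by apply: functional_extensionality => -[]. Qed.

Lemma scons_blanks : scons None blanks = blanks.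
Proof. exact: (scons_eta blanks). Qed.

Lemma scat_cat u v s : scat (u ++ v) s = scat u (scat v s).
Proof. exact: foldr_cat. Qed.

Lemma nth_scons a (s : seq sym) : nth None (a :: s) = scons a (nth None s).
Proof. by apply: functional_extensionality => -[]. Qed.

Lemma nth_scat w (s : seq sym) : nth None (w ++ s) = scat w (nth None s).
Proof. by elim: w => //= a w IH; rewrite nth_scons IH. Qed.

Lemma nth_nil_blanks : nth None ([::] : seq sym) = blanks.
Proof. by apply: functional_extensionality => n; rewrite nth_nil. Qed.

(* The scanned cell is the head of the right stream. *)
Definition tape := (stream * stream)%type.

Definition shift_tape (m : move) (l r : stream) : tape :=
  match m with
  | MoveL => (stl l, scons (l 0) r)
  | MoveR => (scons (r 0) l, stl r)
  | Stay => (l, r)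
  end.

Inductive prog :=
| Skip
| Act of (sym -> sym * move)
| Qry
| Seq of prog & prog
| If of (sym -> bool) & prog & prog
| While of (sym -> bool) & prog.

(** Costs are the exact step counts of the compiled code: one step for a test, one for the jump that
    closes a branch or a loop body. [exec_qry] demands a blank after the word, so that the word read
    is exactly [w]. *)
Inductive exec (g : oracle) : prog -> tape -> nat -> tape -> Prop :=
| exec_skip T : exec g Skip T 0 T
| exec_act f l r : exec g (Act f) (l, r) 1 (shift_tape (f (r 0)).2 l (scons (f (r 0)).1 (stl
  r)))
| exec_qry l w s : exec g Qry (l, scat (map Some w) (scons None s)) 1
                     (l, scat (map Some (g w)) (scons None s))
| exec_seq p q T n T1 m T2 : exec g p T n T1 -> exec g q T1 m T2 ->
    exec g (Seq p q) T (n + m) T2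
| exec_if_true (t : sym -> bool) p q l r n T : t (r 0) -> exec g p (l, r) n T ->
    exec g (If t p q) (l, r) n.+2 T
| exec_if_false (t : sym -> bool) p q l r n T : ~~ t (r 0) -> exec g q (l, r) n T ->
    exec g (If t p q) (l, r) n.+1 T
| exec_while_end (t : sym -> bool) p l r : ~~ t (r 0) -> exec g (While t p) (l, r) 1 (l, r)
| exec_while_step (t : sym -> bool) p l r n T1 m T2 : t (r 0) -> exec g p (l, r) n T1 ->
    exec g (While t p) T1 m T2 -> exec g (While t p) (l, r) (n.+2 + m) T2.

Inductive instr :=
| IAct of (sym -> sym * move)
| IQry
| IBr of (sym -> bool) & nat & nat.

Fixpoint code_size (p : prog) : nat :=
  match p with
  | Skip => 0
  | Act _ | Qry => 1
  | Seq p q => code_size p + code_size q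
  | If _ p q => (code_size p + code_size q).+2
  | While _ p => (code_size p).+2
  end.

(** Jump targets are absolute; [b] is the address of the fragment. A branch on [predT] with equal
    targets is an unconditional jump. *)
Fixpoint code (p : prog) (b : nat) : seq instr :=
  match p with
  | Skip => [::]
  | Act f => [:: IAct f]
  | Qry => [:: IQry]
  | Seq p q => code p b ++ code q (b + code_size p)
  | If t p q =>
      let e := b + (code_size p + code_size q).+2 in
      IBr t b.+1 (b + (code_size p).+2) :: code p b.+1
        ++ IBr predT e e :: code q (b + (code_size p).+2)
  | While t p => IBr t b.+1 (b + (code_size p).+2) :: code p b.+1 ++ [:: IBr predT b b]
  end.

Lemma size_code p b : size (code p b) = code_size p.
Proof.
elim: p b => //= [p IHp q IHq|t p IHp q IHq|t p IHp] b;
  rewrite size_cat /= IHp ?IHq //; lia.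
Qed.

Section Machine.
Variable C : seq instr.

Definition ifetch (q : nat) : instr := nth IQry C q.

(** States are addresses, and the address just past the code is the halting state. [step] tests for
    halting before it tests for a query, so the default [IQry] is never performed there. *)
Definition prog_TM : TM :=
  @MkTM (size C) ord0 (fun q => q == size C :> nat)
    (fun q => if ifetch q is IQry then true else false)
    (fun q s => match ifetch q with
                | IAct f => (inord q.+1, (f s).1, (f s).2)
                | IQry => (inord q.+1, s, Stay)
                | IBr t a b => (inord (if t s then a else b), s, Stay)
                end).

Definition denotes (c : config prog_TM) (pc : nat) (T : tape) : Prop :=
  let: (q, l, h, r) := c in
  [/\ q = pc :> nat, nth None l = T.1 & nth None (h :: r) = T.2].

Lemma nth_head_behead (s : seq sym) : nth None (head None s :: behead s) = nth None s.
Proof. by case: s => //; apply: functional_extensionality => -[|[]]. Qed.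

Lemma step_act g c pc l r f : pc < size C -> ifetch pc = IAct f ->
  denotes c pc (l, r) ->
  denotes (step g c) pc.+1 (shift_tape (f (r 0)).2 l (scons (f (r 0)).1 (stl r))).
Proof.
case: c => [[[q l'] h] r'] lt_pc fE [/= qE <- <-].
rewrite qE (ltn_eqF lt_pc) fE /=.
have q'E : (inord pc.+1 : 'I_(size C).+1) = pc.+1 :> nat by rewrite inordK.
case: (f h) => a [] /=.
- case: l' => [|b l'] /=; split=> //=; rewrite ?nth_scons ?nth_nil_blanks //.
- by case: r' => [|b r'] /=; split=> //=; rewrite ?nth_scons ?nth_nil_blanks ?scons_blanks.
- by split=> //=; rewrite nth_scons.
Qed.

Lemma step_br g c pc l r t a b : pc < size C -> ifetch pc = IBr t a b ->
  a <= size C -> b <= size C -> denotes c pc (l, r) ->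
  denotes (step g c) (if t (r 0) then a else b) (l, r).
Proof.
case: c => [[[q l'] h] r'] lt_pc fE lea leb [/= qE <- <-].
rewrite qE (ltn_eqF lt_pc) fE /=; split=> //=.
by rewrite inordK //; case: ifP.
Qed.

Lemma read_word_scat (s : seq sym) w t : nth None s = scat (map Some w) (scons None t) ->
  read_word s = w /\ nth None (drop (size w) s) = scons None t.
Proof.
elim: w s => [|b w IH] [|a s] sE; have h0 := congr1 (fun f => f 0) sE;
  rewrite /= in h0; first by [].
- by rewrite h0 in sE *.
- by [].
- move: sE; rewrite nth_scons h0 => /(congr1 stl) sE.
  by have [/= -> ->] := IH _ sE.
Qed.

Lemma step_qry g c pc l w s : pc < size C -> ifetch pc = IQry ->
  denotes c pc (l, scat (map Some w) (scons None s)) ->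
  denotes (step g c) pc.+1 (l, scat (map Some (g w)) (scons None s)).
Proof.
case: c => [[[q l'] h] r'] lt_pc fE [/= qE <- /read_word_scat[]].
rewrite qE (ltn_eqF lt_pc) fE /= => -> dE.
split=> //=; first by rewrite inordK.
by rewrite nth_head_behead nth_scat dE.
Qed.

Definition code_at (b : nat) (s : seq instr) :=
  b + size s <= size C /\ forall i, i < size s -> ifetch (b + i) = nth IQry s i.

Lemma code_at_cat b s t : code_at b (s ++ t) -> code_at b s /\ code_at (b + size s) t.
Proof.
case; rewrite size_cat => le_st H; split; split; try lia.
  by move=> i lti; rewrite H ?nth_cat ?lti //; lia.
move=> i lti; rewrite -addnA H; last by lia.
by rewrite nth_cat ifF ?addKn //; lia.
Qed.

Lemma code_at_cons b a s : code_at b (a :: s) ->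
  [/\ b < size C, ifetch b = a & code_at b.+1 s].
Proof.
rewrite -cat1s => /code_at_cat[[lt /(_ 0 isT)]]; rewrite addn0 /= => fE.
by rewrite /= addn1 => H; split=> //; rewrite /= in lt; lia.
Qed.

Lemma iter_steps g c pc T n m pc1 T1 pc2 T2 :
  (forall c, denotes c pc T -> denotes (iter n (@step prog_TM g) c) pc1 T1) ->
  (forall c, denotes c pc1 T1 -> denotes (iter m (@step prog_TM g) c) pc2 T2) ->
  denotes c pc T -> denotes (iter (n + m) (@step prog_TM g) c) pc2 T2.
Proof. by move=> H1 H2 /H1/H2; rewrite addnC iterD. Qed.

Lemma exec_iter g p T n T' b : exec g p T n T' -> code_at b (code p b) ->
  forall c, denotes c b T ->
  denotes (iter n (@step prog_TM g) c) (b + code_size p) T'.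
Proof.
move=> H; elim: H b => {p T n T'}.
- by move=> T b _ c; rewrite /= addn0.
- move=> f l r b /code_at_cons[ltb fE _] c cE; rewrite addn1.
  exact: step_act.
- move=> l w s b /code_at_cons[ltb fE _] c cE; rewrite addn1.
  exact: step_qry.
- move=> p q T n T1 m T2 _ IHp _ IHq b /code_at_cat[/IHp Hp].
  rewrite size_code => /IHq Hq c cE; rewrite addnA.
  by apply: iter_steps Hp Hq cE.
- move=> t p q l r n T tr _ IHp b /code_at_cons[ltb fE] /code_at_cat[/IHp Hp].
  rewrite size_code => /code_at_cons[ltj jE [leq _]] c cE.
  rewrite size_code in leq.
  rewrite (_ : n.+2 = 1 + (n + 1)); last by lia.
  apply: iter_steps cE => [c1 c1E|c1].
    by have := step_br g ltb fE _ _ c1E; rewrite tr; apply; lia.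
  apply: iter_steps (Hp) _ => c2 c2E /=.
  case: T c2E {IHp Hp} => l2 r2 c2E.
  by have /= := step_br g ltj jE _ _ c2E; apply; lia.
- move=> t p q l r n T tr _ IHq b /code_at_cons[ltb fE] /code_at_cat[_].
  rewrite size_code => /code_at_cons[ltj jE].
  have -> : (b.+1 + code_size p).+1 = b + (code_size p).+2 by lia.
  move=> Cq c cE.
  rewrite -[n.+1]add1n; apply: iter_steps cE => [c1 c1E|c1 c1E].
    by have := step_br g ltb fE _ _ c1E; rewrite (negbTE tr); apply; lia.
  rewrite (_ : _ + code_size _ = b + (code_size p).+2 + code_size q) /=; last by lia.
  exact: IHq.
- move=> t p l r tr b /code_at_cons[ltb fE] /code_at_cat[_].
  rewrite size_code => /code_at_cons[ltj jE _] c cE.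
  have := step_br g ltb fE _ _ cE; rewrite (negbTE tr); apply; lia.
- move=> t p l r n T1 m T2 tr _ IHp _ IHw b Cw; have := Cw.
  move=> /code_at_cons[ltb fE] /code_at_cat[/IHp Hp].
  rewrite size_code => /code_at_cons[ltj jE _] c cE.
  have -> : n.+2 + m = 1 + (n + (1 + m)) by lia.
  apply: iter_steps cE => [c1 c1E|c1].
    by have := step_br g ltb fE _ _ c1E; rewrite tr; apply; lia.
  apply: iter_steps (Hp) _ => c2; apply: iter_steps (IHw _ Cw) => c3 c3E /=.
  case: T1 c3E {IHp Hp IHw} => l2 r2 c3E.
  by have /= := step_br g ltj jE _ _ c3E; apply; lia.
Qed.

Lemma iter_step_halted (M : TM) g (c : config M) n : halted c -> iter n (@step M g) c = c.
Proof.
move=> hc; elim: n => //= n ->.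
by case: c hc => [[[q l] h] r] /= ->.
Qed.

End Machine.

(** [decides_in] inspects the configuration at one prescribed time; a halted configuration is a
    fixed point of [step], so any later time shows the same output. *)
Lemma exec_run (p : prog) g x n l w s N :
  exec g p (blanks, scat (map Some x) blanks) n (l, scat (map Some w) (scons None s)) ->
  n <= N ->
  let cf := run (prog_TM (code p 0)) g N x in halted cf /\ output cf = w.
Proof.
move=> H leN; set M := prog_TM _.
have C0 : code_at (code p 0) 0 (code p 0) by split.
have ini : denotes (@init M x) 0 (blanks, scat (map Some x) blanks).
  split=> //=; first by rewrite nth_nil_blanks.
  by rewrite nth_head_behead -[map Some x]cats0 nth_scat nth_nil_blanks cats0.
have := exec_iter H C0 ini; rewrite add0n -/M.
set c := iter n _ _ => cE.
have hc : halted c.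
  by case: c cE => [[[q l'] h] r] [qE _ _] /=; rewrite qE size_code.
rewrite /run -(subnK leN) iterD -/c iter_step_halted //; split=> //.
by case: c cE {hc} => [[[q l'] h] r] [qE _ /= /read_word_scat[]].
Qed.

(** * Walking over and shifting blank-terminated words *)

Definition goL := Act (fun s => (s, MoveL)).
Definition goR := Act (fun s => (s, MoveR)).
Definition put (a : sym) (m : move) := Act (fun _ => (a, m)).

Lemma exec_goL g a l r : exec g goL (scons a l, r) 1 (l, scons a r).
Proof.
have := exec_act g (fun s => (s, MoveL)) (scons a l) r.
by rewrite /= scons_eta.
Qed.

Lemma exec_goR g a l r : exec g goR (l, scons a r) 1 (scons a l, r).
Proof. exact: (exec_act g (fun s => (s, MoveR)) l (scons a r)). Qed.

Lemma exec_put g a m l b r :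
  exec g (put a m) (l, scons b r) 1 (shift_tape m l (scons a r)).
Proof. exact: (exec_act g (fun _ => (a, m)) l (scons b r)). Qed.

Definition within g p T n T' := exists2 m, m <= n & exec g p T m T'.

Lemma within_exec g p T n T' : exec g p T n T' -> within g p T n T'.
Proof. by exists n. Qed.

Lemma within_le g p T n m T' : within g p T n T' -> n <= m -> within g p T m T'.
Proof. by case=> k lek ek lenm; exists k => //; lia. Qed.

Lemma within_seq g p q T n T1 m T2 :
  within g p T n T1 -> within g q T1 m T2 -> within g (Seq p q) T (n + m) T2.
Proof.
case=> n' le1 e1 [m' le2 e2]; exists (n' + m'); first lia.
exact: exec_seq e1 e2.
Qed.

Lemma within_if g (t : sym -> bool) p q l r n T :
  within g (if t (r 0) then p else q) (l, r) n T -> within g (If t p q) (l, r) n.+2 T.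
Proof.
case=> m lem; case: ifP => tr e.
  by exists m.+2; [lia | exact: exec_if_true].
by exists m.+1; [lia | apply: exec_if_false => //; rewrite tr].
Qed.

Lemma within_while_end g (t : sym -> bool) p l r :
  ~~ t (r 0) -> within g (While t p) (l, r) 1 (l, r).
Proof. by exists 1 => //; exact: exec_while_end. Qed.

Lemma within_while_step g (t : sym -> bool) p l r n T1 m T2 :
  t (r 0) -> within g p (l, r) n T1 -> within g (While t p) T1 m T2 ->
  within g (While t p) (l, r) (n.+2 + m) T2.
Proof.
move=> tr [n' le1 e1] [m' le2 e2]; exists (n'.+2 + m'); first lia.
exact: exec_while_step e2.
Qed.

Definition section (w : seq bool) : seq sym := rcons (map Some w) None.
Definition sections (ws : seq (seq bool)) : seq sym := flatten (map section ws).

Lemma sections_cons w ws s :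
  scat (sections (w :: ws)) s = scat (map Some w) (scons None (scat (sections ws) s)).
Proof. by rewrite /sections /= scat_cat /section -cats1 scat_cat. Qed.

Lemma sections_rcons ws w : sections (rcons ws w) = sections ws ++ section w.
Proof. by rewrite /sections map_rcons flatten_rcons. Qed.

Lemma rev_section w s :
  scat (rev (section w)) s = scons None (scat (rev (map Some w)) s).
Proof. by rewrite /section rev_rcons. Qed.

(** The cell to the left of a register is always blank: it ends the previous register, or belongs to
    the blank tape left of register 0. *)
Lemma rev_sections_blanks ws :
  scons None (stl (scat (rev (sections ws)) blanks)) = scat (rev (sections ws)) blanks.
Proof.
case/lastP: ws => [|ws w]; first exact: scons_blanks.
by rewrite sections_rcons rev_cat scat_cat rev_section.
Qed.

Fixpoint repeat (n : nat) (p : prog) := if n is m.+1 then Seq p (repeat m p) else Skip.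

Definition rightS := Seq (While isSome goR) goR.

Lemma exec_rightS g w l s :
  within g rightS (l, scat (map Some w) (scons None s)) (3 * (size w).+1)
    (scat (rev (section w)) l, s).
Proof.
have H : within g (While isSome goR) (l, scat (map Some w) (scons None s))
    (3 * size w).+1 (scat (rev (map Some w)) l, scons None s).
  elim: w l => [|b w IH] l; first exact: within_while_end.
  apply: (@within_le _ _ _ (3 + (3 * size w).+1)); last by rewrite /=; lia.
  apply: within_while_step; first by [].
    exact/within_exec/exec_goR.
  by rewrite map_cons rev_cons -cats1 scat_cat; apply: IH.
have := within_seq H (within_exec (exec_goR _ _ _ _)) => {}H.
rewrite rev_section; apply: within_le H _; lia.
Qed.

Lemma exec_right g ws l s :
  within g (repeat (size ws) rightS) (l, scat (sections ws) s) (3 * size (sections ws))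
    (scat (rev (sections ws)) l, s).
Proof.
elim: ws l => [|w ws IH] l; first exact/within_exec/exec_skip.
rewrite sections_cons.
have := within_seq (exec_rightS g w l _) (IH _) => H.
rewrite {2}/sections /= rev_cat scat_cat; apply: within_le H _.
by rewrite /sections /= size_cat size_rcons size_map; lia.
Qed.

(** The two initial moves cross the blank that ends the register; the scan then stops on the blank
    before it, at once if the register is empty. *)
Definition leftS := Seq goL (Seq goL (Seq (While isSome goL) goR)).

Lemma exec_while_goL g u l r : l 0 = None ->
  let s := scat (map Some u) l in
  within g (While isSome goL) (stl s, scons (s 0) r) (3 * size u).+1
    (stl l, scons None (scat (rev (map Some u)) r)).
Proof.
move=> l0; elim: u r => [|b u IH] r /=.
  by rewrite l0; apply: within_while_end.
apply: (@within_le _ _ _ (3 + (3 * size u).+1)); last lia.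
apply: within_while_step => //.
  by rewrite stl_scons -{1}[scat _ l]scons_eta; apply/within_exec/exec_goL.
by rewrite rev_cons -cats1 scat_cat; apply: IH.
Qed.

Lemma exec_leftS g w l s : l 0 = None ->
  within g leftS (scat (rev (section w)) l, s) (4 * (size w).+1)
    (l, scat (section w) s).
Proof.
move=> l0; have lE : scons None (stl l) = l by rewrite -{1}l0 scons_eta.
rewrite rev_section /section -cats1 scat_cat /= -map_rev.
have := exec_while_goL g (rev w) (scons None s) l0.
rewrite map_rev revK size_rev /= -map_rev.
set t := scat _ l => H.
have := within_seq H (within_exec (exec_goR _ _ _ _)); rewrite lE => {}H.
have := within_seq (within_exec (exec_goL g _ _ _)) H; rewrite scons_eta => {}H.
have := within_seq (within_exec (exec_goL g _ _ _)) H => {}H.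
by apply: within_le H _; lia.
Qed.

Lemma sections_blanks_head ws : scat (rev (sections ws)) blanks 0 = None.
Proof. by rewrite -rev_sections_blanks. Qed.

Lemma exec_left g ws s :
  within g (repeat (size ws) leftS) (scat (rev (sections ws)) blanks, s)
    (4 * size (sections ws)) (blanks, scat (sections ws) s).
Proof.
elim/last_ind: ws s => [|ws w IH] s; first exact/within_exec/exec_skip.
rewrite size_rcons sections_rcons rev_cat scat_cat.
have := exec_leftS g w s (sections_blanks_head ws) => H.
have := within_seq H (IH _) => {}H.
rewrite scat_cat; apply: within_le H _.
by rewrite size_cat size_rcons size_map; lia.
Qed.

Definition copyL a := Seq goL (Seq (put a MoveR) goR).
Definition copyR a := Seq goR (Seq (put a MoveL) goL).

Lemma exec_copyL g a x l s :
  within g (copyL a) (scons x l, scons a s) 3 (scons a (scons a l), s).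
Proof.
exact: (within_seq (within_exec (exec_goL _ _ _ _)) (within_seq
  (within_exec (exec_put _ _ MoveR _ _ _)) (within_exec (exec_goR _ _ _ _)))).
Qed.

Lemma exec_copyR g a b x l s :
  within g (copyR a) (scons b l, scons a (scons x s)) 3 (l, scons b (scons a (scons a s))).
Proof.
exact: (within_seq (within_exec (exec_goR _ _ _ _)) (within_seq
  (within_exec (exec_put _ _ MoveL _ _ _)) (within_exec (exec_goL _ _ _ _)))).
Qed.

Definition copybit (copy : sym -> prog) :=
  If (fun a => a == Some true) (copy (Some true)) (copy (Some false)).

(* Pushing and popping move the registers to the left of the one concerned, so the
   number of registers in use never matters. *)
Definition shlS := Seq (While isSome (copybit copyL)) (copyL None).
Definition shrS := Seq (copyR None) (While isSome (copybit copyR)).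

(** Each symbol is copied one cell to the left, so the block overwrites the free cell [x] and leaves
    a free cell behind it, ready for the next block. *)
Lemma exec_shlS g x w l s :
  within g shlS (scons x l, scat (map Some w) (scons None s)) (7 * (size w).+1)
    (scons None (scat (rev (section w)) l), s).
Proof.
have [y H] : exists y, within g (While isSome (copybit copyL))
    (scons x l, scat (map Some w) (scons None s))
    (7 * size w).+1 (scons y (scat (rev (map Some w)) l), scons None s).
  elim: w x l => [|b w IH] x l; first by exists x; exact: within_while_end.
  have [y {}IH] := IH (Some b) (scons (Some b) l).
  exists y; rewrite map_cons rev_cons -cats1 scat_cat.
  apply: (@within_le _ _ _ (5.+2 + (7 * size w).+1)); last by rewrite /=; lia.
  apply: within_while_step IH => //; apply: within_if.
  by case: b; apply: exec_copyL.
have := within_seq H (exec_copyL _ _ _ _ _) => {}H.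
by rewrite rev_section; apply: within_le H _; lia.
Qed.

Lemma exec_shl g ws x l s :
  exists y, within g (repeat (size ws) shlS) (scons x l, scat (sections ws) s)
    (7 * size (sections ws)) (scons y (scat (rev (sections ws)) l), s).
Proof.
elim: ws x l => [|w ws IH] x l; first by exists x; exact/within_exec/exec_skip.
rewrite sections_cons.
have [y {}IH] := IH None (scat (rev (section w)) l).
have := within_seq (exec_shlS g x w l _) IH => H; exists y.
rewrite {2}/sections /= rev_cat scat_cat; apply: within_le H _.
by rewrite /sections /= size_cat size_rcons size_map; lia.
Qed.

Lemma exec_shrS g w l x s : l 0 = None ->
  exists y, within g shrS
    (stl (scat (rev (section w)) l), scons None (scons x s)) (7 * (size w).+1)
    (stl l, scons None (scons y (scat (section w) s))).
Proof.
move=> l0; have [y H] : exists y, within g (While isSome (copybit copyR))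
    (stl (scat (map Some (rev w)) l),
     scons (scat (map Some (rev w)) l 0) (scons None (scons None s))) (7 * size w).+1
    (stl l, scons None (scons y (scat (section w) s))).
  rewrite /section -cats1 scat_cat /=; set u := rev w.
  have -> : w = rev u by rewrite revK.
  rewrite size_rev map_rev {}/u; move: (rev w) => u {w}.
  (* The cell left behind takes the value of the last copied bit, so the induction must allow an
     arbitrary symbol there. *)
  have: exists z, scons None (scons None s) = scons z (scons None s) by exists None.
  case=> z ->; move: (scons None s) => {}s.
  elim: u z s => [|b u IH] z s /=.
    by rewrite l0; exists z; exact: within_while_end.
  have [y {}IH] := IH (Some b) (scons (Some b) s).
  exists y; rewrite rev_cons -cats1 scat_cat.
  apply: (@within_le _ _ _ (5.+2 + (7 * size u).+1)); last by lia.
  apply: within_while_step IH => //; apply: within_if.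
  rewrite stl_scons -{1}[scat _ l]scons_eta.
  by case: b; apply: exec_copyR.
exists y; rewrite rev_section stl_scons -map_rev -{1}[scat _ l]scons_eta.
by apply: within_le (within_seq (exec_copyR _ _ _ _ _ _) H) _; lia.
Qed.

Lemma exec_shr g ws x s :
  exists y, within g (repeat (size ws) shrS)
    (stl (scat (rev (sections ws)) blanks), scons None (scons x s))
    (7 * size (sections ws))
    (blanks, scons None (scons y (scat (sections ws) s))).
Proof.
elim/last_ind: ws x s => [|ws w IH] x s.
  by exists x; exact/within_exec/exec_skip.
rewrite size_rcons sections_rcons rev_cat !scat_cat.
have [y H] := exec_shrS g w x s (sections_blanks_head ws).
have [z {}IH] := IH y (scat (section w) s).
exists z; have := within_seq H IH => {}H; apply: within_le H _.
by rewrite size_cat size_rcons size_map; lia.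
Qed.

(** * Registers on one tape *)

Definition regs := nat -> seq bool.

Definition upd (T : Type) (s : nat -> T) i v : nat -> T := fun j => if j == i then v else s j.

Definition sects (s : regs) n := sections (mkseq s n).

(* Register 0 starts at the head, consecutive registers are separated by one blank,
   and the left stream is blank. *)
Definition holds (s : regs) (r : stream) : Prop :=
  exists n, (forall j, n <= j -> s j = [::]) /\ r = scat (sects s n) blanks.

Definition sizes_le (s : regs) (Z : nat) := forall i, size (s i) <= Z.

Lemma sizes_le_trans s Y Z : sizes_le s Y -> Y <= Z -> sizes_le s Z.
Proof. by move=> H leYZ i; apply: leq_trans (H i) leYZ. Qed.

Lemma size_sects s n Z : sizes_le s Z -> size (sects s n) <= n * Z.+1.
Proof.
move=> H; elim: n => // n IH.
rewrite /sects /mkseq in IH *; rewrite -addn1 iotaD map_cat /= cats1 sections_rcons.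
by rewrite size_cat size_rcons size_map add0n; have := H n; lia.
Qed.

Lemma eq_sects s t n : (forall j, j < n -> s j = t j) -> sects s n = sects t n.
Proof.
move=> H; congr sections; apply/eq_in_map => j; rewrite mem_iota; exact: H.
Qed.

Lemma sectsD s n k : sects s (n + k) = sects s n ++ sections (map s (iota n k)).
Proof. by rewrite /sects /mkseq iotaD map_cat /sections map_cat flatten_cat. Qed.

(** An empty register is a single blank cell, so the blank tape already contains infinitely many of
    them and their number can be raised at will. *)
Lemma holds_ge s r n0 : holds s r ->
  exists n, [/\ n0 <= n, (forall j, n <= j -> s j = [::]) & r = scat (sects s n) blanks].
Proof.
case=> n [H ->]; exists (n + n0); split; [lia | by move=> j lej; apply: H; lia|].
rewrite sectsD scat_cat; congr scat.
have : forall m, n <= m -> blanks = scat (sections [seq s i | i <- iota m n0]) blanks.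
  elim: n0 => //= k IH m lem; rewrite sections_cons H //= -IH ?scons_blanks //; lia.
by apply.
Qed.

(** The rest [post] of the tape is fixed before the new value [v]: changing one register leaves the
    others literally in place on the stream. *)
Lemma holds_at s r i : holds s r ->
  exists post, r = scat (sects s i) (scat (map Some (s i)) (scons None post))
    /\ forall v, holds (upd s i v) (scat (sects s i) (scat (map Some v) (scons None post))).
Proof.
move=> /(holds_ge i.+1)[n [lti H rE]].
have [k nE] : exists k, n = i + k.+1 by exists (n - i).-1; lia.
exists (scat (sections (map s (iota i.+1 k))) blanks); split.
  by rewrite rE nE sectsD scat_cat /= sections_cons.
move=> v; exists n; split=> [j lej|].
  by rewrite /upd ifF ?H //; lia.
rewrite nE sectsD scat_cat /= sections_cons [upd s i v i]/upd eqxx.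
rewrite (@eq_sects _ s) => [|j ltj]; last by rewrite /upd ifF //; lia.
congr scat; congr scat; congr scons; congr (scat (sections _) _).
by apply/eq_in_map => j; rewrite mem_iota /upd => /andP[ltj _]; rewrite ifF //; lia.
Qed.

Definition reach g p s n s' := forall r, holds s r ->
  exists2 r', within g p (blanks, r) n (blanks, r') & holds s' r'.

Lemma reach_le g p s n m s' : reach g p s n s' -> n <= m -> reach g p s m s'.
Proof. by move=> H le r /H[r' w h]; exists r' => //; apply: within_le w le. Qed.

Lemma reach_seq g p q s n s1 m s2 :
  reach g p s n s1 -> reach g q s1 m s2 -> reach g (Seq p q) s (n + m) s2.
Proof.
move=> H1 H2 r /H1[r1 w1 /H2[r2 w2 h]]; exists r2 => //.
exact: within_seq w1 w2.
Qed.

Lemma reach_skip g s : reach g Skip s 0 s.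
Proof. by move=> r h; exists r => //; exact/within_exec/exec_skip. Qed.

Definition top (s : regs) i : sym := ohead (s i).

Lemma scat_top (w : seq bool) r : scat (map Some w) (scons None r) 0 = ohead w.
Proof. by case: w. Qed.

Definition reg_if i t p q :=
  Seq (repeat i rightS) (If t (Seq (repeat i leftS) p) (Seq (repeat i leftS) q)).
Definition reg_while i t p :=
  Seq (Seq (repeat i rightS) (While t (Seq (repeat i leftS) (Seq p (repeat i rightS)))))
    (repeat i leftS).
Definition reg_qry i := Seq (repeat i rightS) (Seq Qry (repeat i leftS)).
Definition push i b :=
  Seq (repeat i shlS) (Seq goL (Seq (put (Some b) Stay) (repeat i leftS))).
(** After the shift to the right a stale symbol remains just before the new start of register 0.
    [copyR None] erases it and leaves the head three cells short of that start. *)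
Definition pop i :=
  Seq (repeat i rightS) (Seq goL (Seq (repeat i shrS) (Seq (copyR None) (Seq goR (Seq goR
    goR))))).

Definition walk i Z := i * Z.+1.

Lemma exec_sects_right g s i l r Z : sizes_le s Z ->
  within g (repeat i rightS) (l, scat (sects s i) r) (3 * walk i Z)
    (scat (rev (sects s i)) l, r).
Proof.
move=> /(@size_sects _ i) le; have := exec_right g (mkseq s i) l r.
by rewrite size_mkseq => H; apply: within_le H _; rewrite leq_mul2l.
Qed.

Lemma exec_sects_left g s i r Z : sizes_le s Z ->
  within g (repeat i leftS) (scat (rev (sects s i)) blanks, r) (4 * walk i Z)
    (blanks, scat (sects s i) r).
Proof.
move=> /(@size_sects _ i) le; have := exec_left g (mkseq s i) r.
by rewrite size_mkseq => H; apply: within_le H _; rewrite leq_mul2l.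
Qed.

Lemma upd_id (T : Type) (s : nat -> T) i : upd s i (s i) = s.
Proof. by apply: functional_extensionality => j; rewrite /upd; case: eqP => // ->. Qed.

Lemma reach_push g s i b Z : sizes_le s Z ->
  reach g (push i b) s (11 * walk i Z + 2) (upd s i (b :: s i)).
Proof.
move=> bs r /(holds_at i)[post [-> hE]].
set r0 := scat _ (scons None post); exists (scat (sects s i) (scons (Some b) r0)).
  have [y H1] := exec_shl g (mkseq s i) None blanks r0.
  rewrite size_mkseq -/(sects s i) scons_blanks in H1.
  have H4 := exec_sects_left g i (scons (Some b) r0) bs.
  have H3 := within_seq (within_exec (exec_put g (Some b) Stay _ y r0)) H4.
  have H := within_seq H1 (within_seq (within_exec (exec_goL _ _ _ _)) H3).
  by apply: within_le H _; have := size_sects i bs; rewrite /walk; lia.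
exact: (hE (b :: s i)).
Qed.

Lemma reach_pop g s i b w Z : sizes_le s Z -> s i = b :: w ->
  reach g (pop i) s (10 * walk i Z + 7) (upd s i w).
Proof.
move=> bs sE r /(holds_at i)[post [-> hE]]; rewrite sE /=.
set r0 := scat _ (scons None post); exists (scat (sects s i) r0); last exact: hE.
have H1 := exec_sects_right g i blanks (scons (Some b) r0) bs.
rewrite -rev_sections_blanks in H1.
have [y H3] := exec_shr g (mkseq s i) (Some b) r0.
rewrite size_mkseq -/(sects s i) in H3.
set T := scat _ r0 in H3 *.
have := exec_copyR g None None y blanks T; rewrite {1}scons_blanks => H4.
have H5 := within_seq (within_exec (exec_goR g None blanks (scons None (scons None T))))
  (within_seq (within_exec (exec_goR _ _ _ _)) (within_exec (exec_goR _ _ _ _))).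
have := within_seq H1 (within_seq (within_exec (exec_goL _ _ _ _))
  (within_seq H3 (within_seq H4 H5))).
rewrite !scons_blanks => H; apply: within_le H _.
by have := size_sects i bs; rewrite /walk; lia.
Qed.

Lemma reach_qry g s i Z : sizes_le s Z ->
  reach g (reg_qry i) s (7 * walk i Z + 1) (upd s i (g (s i))).
Proof.
move=> bs r /(holds_at i)[post [-> hE]].
exists (scat (sects s i) (scat (map Some (g (s i))) (scons None post))) => //.
have H := within_seq (within_exec (exec_qry g _ (s i) post))
  (exec_sects_left g i (scat (map Some (g (s i))) (scons None post)) bs).
apply: within_le (within_seq (exec_sects_right g i blanks _ bs) H) _; lia.
Qed.

Lemma reach_if g s i (t : sym -> bool) p q n s' Z : sizes_le s Z ->
  reach g (if t (top s i) then p else q) s n s' ->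
  reach g (reg_if i t p q) s (7 * walk i Z + n + 2) s'.
Proof.
move=> bs H r hr; have [r' w h] := H r hr; exists r' => //.
have [post [rE _]] := holds_at i hr.
set r0 := scat (map _ _) _ in rE.
have H1 : within g (if t (r0 0) then Seq (repeat i leftS) p else Seq (repeat i leftS) q)
    (scat (rev (sects s i)) blanks, r0) (4 * walk i Z + n) (blanks, r').
  have := within_seq (exec_sects_left g i r0 bs); rewrite -rE => H1.
  by rewrite [r0 0]scat_top; case: ifP w => _ w; apply: H1 w.
rewrite rE; apply: within_le (within_seq (exec_sects_right g i blanks r0 bs)
  (within_if H1)) _; lia.
Qed.

Lemma scat_inj w : injective (scat w).
Proof. by elim: w => [|a w IH] r r' //= /(congr1 stl)/IH. Qed.

(** The test needs the head on register [i], whereas the body starts and ends at register 0; hence a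
    walk in each direction per round, 3 steps per cell to the right and 4 to the left. *)
Lemma reach_while g i (t : sym -> bool) p n m Z (F : nat -> regs) :
  (forall j, j <= n -> sizes_le (F j) Z) ->
  (forall j, j < n -> t (top (F j) i)) -> ~~ t (top (F n) i) ->
  (forall j, j < n -> reach g p (F j) m (F j.+1)) ->
  reach g (reg_while i t p) (F 0) (n * (7 * walk i Z + m + 2) + 7 * walk i Z + 1) (F n).
Proof.
move=> bF tF tFn step.
pose body := Seq (repeat i leftS) (Seq p (repeat i rightS)).
suff loop d j r : j + d = n -> holds (F j) (scat (sects (F j) i) r) -> exists2 r',
    within g (While t body) (scat (rev (sects (F j) i)) blanks, r)
      (d * (7 * walk i Z + m + 2) + 1) (scat (rev (sects (F n) i)) blanks, r')
    & holds (F n) (scat (sects (F n) i) r').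
  move=> r hr; have [post [rE _]] := holds_at i hr.
  set r0 := scat (map _ _) _ in rE; rewrite rE in hr *.
  have [r' w h] := loop n 0 r0 (add0n n) hr.
  exists (scat (sects (F n) i) r') => //.
  have := within_seq (exec_sects_right g i blanks r0 (bF 0 (leq0n n))) w => {}w.
  have := within_seq w (exec_sects_left g i r' (bF n (leqnn n))) => {}w.
  by apply: within_le w _; lia.
elim: d j r => [|d IH] j r.
  rewrite addn0 => -> hr; exists r => //; apply: within_while_end.
  by have [post [/scat_inj -> _]] := holds_at i hr; rewrite scat_top.
move=> jE hr; have ltj : j < n by lia.
have tj : t (r 0) by have [post [/scat_inj -> _]] := holds_at i hr; rewrite scat_top tF.
have [r1 w1 h1] := step j ltj _ hr; have [post [r1E _]] := holds_at i h1.
rewrite r1E in w1 h1; have [|r' w h] := IH j.+1 _ _ h1; first lia.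
exists r' => //.
have w2 := within_seq (exec_sects_left g i r (bF j (ltnW ltj)))
  (within_seq w1 (exec_sects_right g i blanks _ (bF _ ltj))).
by apply: within_le (within_while_step tj w2 w) _; lia.
Qed.

(** * Polynomial time *)

(** The shape of the time bound in [decides_in], where one constant is both factor and exponent. *)
Definition pbound e x := e * x.+1 ^ e.

Definition poly_bounded (f : nat -> nat) := exists e, forall x, f x <= pbound e x.

Lemma leq_pbound a b x y : a <= b -> x <= y -> pbound a x <= pbound b y.
Proof.
move=> leab lexy; apply: leq_mul => //.
apply: (@leq_trans (y.+1 ^ a)); first by case: a {leab} => // a; rewrite leq_exp2r.
exact: leq_pexp2l.
Qed.

Lemma poly_bounded_le f h : poly_bounded h -> (forall x, f x <= h x) -> poly_bounded f.
Proof. by case=> e H le; exists e => x; apply: leq_trans (le x) (H x). Qed.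

Lemma poly_bounded_const n : poly_bounded (fun=> n).
Proof. by exists n => x; rewrite leq_pmulr // expn_gt0. Qed.

Lemma poly_bounded_id : poly_bounded id.
Proof. by exists 1 => x; rewrite /pbound mul1n expn1. Qed.

Lemma poly_bounded_add f h : poly_bounded f -> poly_bounded h -> poly_bounded (fun x => f x +
  h x).
Proof.
move=> [a Ha] [b Hb]; exists (a + b) => x; rewrite /pbound mulnDl.
apply: leq_add; [apply: leq_trans (Ha x) _|apply: leq_trans (Hb x) _];
  rewrite leq_mul2l leq_pexp2l ?orbT //; lia.
Qed.

Lemma poly_bounded_mul f h : poly_bounded f -> poly_bounded h -> poly_bounded (fun x => f x *
  h x).
Proof.
move=> [a Ha] [b Hb]; exists (a * b + a + b) => x.
apply: leq_trans (leq_mul (Ha x) (Hb x)) _; rewrite /pbound mulnACA -expnD.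
by apply: leq_mul; [lia | apply: leq_pexp2l; lia].
Qed.

Lemma poly_bounded_exp f n : poly_bounded f -> poly_bounded (fun x => f x ^ n).
Proof.
move=> Hf; elim: n => [|n IH]; first exact: poly_bounded_const.
by apply: poly_bounded_le (poly_bounded_mul Hf IH) _ => x; rewrite expnS.
Qed.

Lemma poly_bounded_pbound b f : poly_bounded f -> poly_bounded (fun x => pbound b (f x)).
Proof.
move=> Hf; apply: poly_bounded_mul (poly_bounded_const b) (poly_bounded_exp b _).
by apply: poly_bounded_le (poly_bounded_add (poly_bounded_const 1) Hf) _ => x; rewrite add1n.
Qed.

Ltac poly_bounded_tac := lazymatch goal with
  | |- poly_bounded (fun _ => ?n) => exact: (poly_bounded_const n)
  | |- poly_bounded (fun x => @?f x + @?h x) => apply: (@poly_bounded_add f h); poly_bounded_tac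
  | |- poly_bounded (fun x => @?f x * @?h x) => apply: (@poly_bounded_mul f h); poly_bounded_tac
  | |- poly_bounded (fun x => (@?f x).+1) => apply: (@poly_bounded_add (fun=> 1) f);
    poly_bounded_tac
  | |- poly_bounded (fun x => pbound ?b (@?f x)) => apply: (@poly_bounded_pbound b f);
    poly_bounded_tac
  | |- poly_bounded (fun x => x) => exact: poly_bounded_id
  | |- poly_bounded id => exact: poly_bounded_id
  | |- _ => assumption
  end.

Lemma updE (T : Type) (s : nat -> T) i v : upd s i v i = v.
Proof. by rewrite /upd eqxx. Qed.

Lemma updK (T : Type) (s : nat -> T) i v w : upd (upd s i v) i w = upd s i w.
Proof. by apply: functional_extensionality => j; rewrite /upd; case: (j == i). Qed.

Lemma updN (T : Type) (s : nat -> T) i v j : j != i -> upd s i v j = s j.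
Proof. by rewrite /upd => /negbTE ->. Qed.

Ltac rsimp := rewrite ?updE; repeat (rewrite updN; [rewrite ?updE | by lia]).

Ltac regs_eq := let j := fresh "j" in apply: functional_extensionality => j;
  rewrite /upd; repeat (case: (@eqP _ j) => //= ?); subst;
  rewrite ?eqxx //; try (exfalso; lia).

Section Does.
Variable ok : oracle -> Prop.

(* The exponent [c] must not depend on the oracle. *)
Definition does (P : regs -> Prop) p (F : oracle -> regs -> regs) := exists c,
  forall g s Z, ok g -> sizes_le s Z -> P s ->
    reach g p s (pbound c Z) (F g s) /\ sizes_le (F g s) (pbound c Z).

Lemma does_intro P p F (f : nat -> nat) : poly_bounded f ->
  (forall g s Z, ok g -> sizes_le s Z -> P s ->
    reach g p s (f Z) (F g s) /\ sizes_le (F g s) (f Z)) -> does P p F.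
Proof.
move=> [c Hc] H; exists c => g s Z og bs Ps; have [r b] := H g s Z og bs Ps.
by split; [apply: reach_le r _ | apply: sizes_le_trans b _].
Qed.

Lemma does_ext (P : regs -> Prop) F P' p F' : does P p F -> (forall s, P' s -> P s) ->
  (forall g s, ok g -> P' s -> F g s = F' g s) -> does P' p F'.
Proof.
move=> [c H] HP HF; exists c => g s Z og bs Ps; rewrite -HF //.
by apply: H => //; apply: HP.
Qed.

Lemma does_sub (P Q : regs -> Prop) p F :
  does P p F -> (forall s, Q s -> P s) -> does Q p F.
Proof. by move=> H QP; apply: does_ext H QP _. Qed.

Lemma does_weak (P : regs -> Prop) p F : does (fun=> True) p F -> does P p F.
Proof. by move=> H; apply: does_sub H _. Qed.

Lemma does_seq (P Q : regs -> Prop) p q F G : does P p F -> does Q q G ->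
  (forall g s, ok g -> P s -> Q (F g s)) -> does P (Seq p q) (fun g s => G g (F g s)).
Proof.
move=> [a Ha] [b Hb] PQ.
apply: (@does_intro _ _ _ (fun x => pbound a x + pbound b (pbound a x))); first by
  poly_bounded_tac.
move=> g s Z og bs Ps; have [r1 b1] := Ha g s Z og bs Ps.
have [r2 b2] := Hb g _ _ og b1 (PQ g s og Ps).
by split; [apply: reach_seq r1 r2 | apply: sizes_le_trans b2 _; lia].
Qed.

Lemma does_skip : does (fun=> True) Skip (fun _ s => s).
Proof.
apply: (@does_intro _ _ _ id) => [|g s Z _ bs _]; first by poly_bounded_tac.
by split=> //; exact: reach_le (@reach_skip g s) (leq0n Z).
Qed.

Lemma sizes_le_upd s i w Z : sizes_le s Z -> size w <= Z -> sizes_le (upd s i w) Z.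
Proof. by move=> bs le j; rewrite /upd; case: ifP => // _; apply: bs. Qed.

Lemma does_push i b : does (fun=> True) (push i b) (fun _ s => upd s i (b :: s i)).
Proof.
apply: (@does_intro _ _ _ (fun Z => 11 * (i * (Z + 1)) + 2 + Z)) => [|g s Z _ bs _].
  by poly_bounded_tac.
split; first by apply: reach_le (@reach_push g s i b Z bs) _; rewrite /walk; lia.
by apply: sizes_le_upd; [apply: sizes_le_trans bs _; lia | have := bs i; rewrite /=; lia].
Qed.

Lemma does_pop i : does (fun s => s i <> [::]) (pop i) (fun _ s => upd s i (behead (s i))).
Proof.
apply: (@does_intro _ _ _ (fun Z => 10 * (i * (Z + 1)) + 7 + Z)) => [|g s Z _ bs si].
  by poly_bounded_tac.
case E : (s i) si => [|b w] // _; split.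
  by apply: reach_le (@reach_pop g s i b w Z bs E) _; rewrite /walk; lia.
by apply: sizes_le_upd; [apply: sizes_le_trans bs _; lia | have := bs i; rewrite E /=; lia].
Qed.

Lemma does_if P i (t : sym -> bool) p q F :
  does (fun s => P s /\ t (top s i)) p F -> does (fun s => P s /\ ~~ t (top s i)) q F ->
  does P (reg_if i t p q) F.
Proof.
move=> [a Ha] [b Hb].
apply: (@does_intro _ _ _ (fun Z => 7 * (i * (Z + 1)) + (pbound a Z + pbound b Z) + 2)).
  by poly_bounded_tac.
move=> g s Z og bs Ps.
have [r b1] : reach g (if t (top s i) then p else q) s (pbound a Z + pbound b Z) (F g s) /\
    sizes_le (F g s) (pbound a Z + pbound b Z).
  case: ifP => tr; [have [] := Ha g s Z og bs (conj Ps tr) |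
    have [] := Hb g s Z og bs (conj Ps (negbT tr))] => r b1;
    by split; [apply: reach_le r _ | apply: sizes_le_trans b1 _]; lia.
split; last by apply: sizes_le_trans b1 _; lia.
by apply: reach_le (@reach_if g s i t p q _ _ Z bs r) _; rewrite /walk; lia.
Qed.

(** Specifications indexed by an abstract state [a], such as a configuration or an input word,
    instead of by the registers; intermediate states of a sequence can then be described as
    functions of [a]. *)
Definition maps (A : Type) (Pre : A -> Prop) (from : oracle -> A -> regs) p
    (to : oracle -> A -> regs) := exists c,
  forall g a Z, ok g -> Pre a -> sizes_le (from g a) Z ->
    reach g p (from g a) (pbound c Z) (to g a) /\ sizes_le (to g a) (pbound c Z).

Lemma maps_does A (Pre : A -> Prop) from p to P F : does P p F ->
  (forall g a, ok g -> Pre a -> P (from g a)) ->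
  (forall g a, ok g -> Pre a -> F g (from g a) = to g a) -> maps Pre from p to.
Proof.
move=> [c H] HP HF; exists c => g a Z og Pa bZ; rewrite -HF //.
by apply: H => //; apply: HP.
Qed.

Lemma does_maps P p F : maps P (fun _ s => s) p F -> does P p F.
Proof. by move=> [c H]; exists c => g s Z og bs Ps; apply: H. Qed.

Lemma maps_seq A (Pre : A -> Prop) from p mid q to :
  maps Pre from p mid -> maps Pre mid q to -> maps Pre from (Seq p q) to.
Proof.
move=> [a Ha] [b Hb].
have [c Hc] : poly_bounded (fun x => pbound a x + pbound b (pbound a x)) by poly_bounded_tac.
exists c => g x Z og Px bs; have [r1 b1] := Ha g x Z og Px bs.
have [r2 b2] := Hb g x _ og Px b1; split.
  exact: reach_le (@reach_seq _ _ _ _ _ _ _ _ r1 r2) (Hc Z).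
by apply: sizes_le_trans b2 _; apply: leq_trans (Hc Z); exact: leq_addl.
Qed.

Lemma maps_ext A (Pre Pre' : A -> Prop) from from' p to to' : maps Pre from p to ->
  (forall a, Pre' a -> Pre a) ->
  (forall g a, ok g -> Pre' a -> from' g a = from g a) ->
  (forall g a, ok g -> Pre' a -> to g a = to' g a) -> maps Pre' from' p to'.
Proof.
move=> [c H] HP Hf Ht; exists c => g a Z og Pa; rewrite Hf // -Ht // => bZ.
by apply: H => //; apply: HP.
Qed.

Lemma maps_if A (Pre : A -> Prop) from i (t : sym -> bool) (tr : A -> bool) p q to :
  (forall g a, ok g -> Pre a -> t (top (from g a) i) = tr a) ->
  maps (fun a => Pre a /\ tr a) from p to ->
  maps (fun a => Pre a /\ ~~ tr a) from q to ->
  maps Pre from (reg_if i t p q) to.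
Proof.
move=> trE [a Ha] [b Hb].
have [c Hc] : poly_bounded (fun Z => 7 * (i * (Z + 1)) + (pbound a Z + pbound b Z) + 2) by
  poly_bounded_tac.
exists c => g x Z og Px bs.
have [r b1] : reach g (if t (top (from g x) i) then p else q) (from g x) (pbound a Z + pbound
  b Z)
    (to g x) /\ sizes_le (to g x) (pbound a Z + pbound b Z).
  rewrite trE //; case: ifP => tx.
    have [r b1] := Ha g x Z og (conj Px tx) bs.
    by split; [apply: reach_le r _ | apply: sizes_le_trans b1 _]; lia.
  have [r b1] := Hb g x Z og (conj Px (negbT tx)) bs.
  by split; [apply: reach_le r _ | apply: sizes_le_trans b1 _]; lia.
split; last by apply: sizes_le_trans b1 _; apply: leq_trans (Hc Z); lia.
apply: reach_le (@reach_if g (from g x) i t p q _ _ Z bs r) _.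
by apply: leq_trans (Hc Z); rewrite /walk; lia.
Qed.

(* [S j] is the state after [j] iterations. *)
Lemma maps_while A B (Pre : A -> Prop) (PreB : B -> Prop) from fromB to toB i
    (t : sym -> bool) p (f : nat -> nat) :
  maps PreB fromB p toB -> poly_bounded f ->
  (forall g a Z, ok g -> Pre a -> sizes_le (from g a) Z -> exists n (S : nat -> regs),
     [/\ n <= f Z, S 0 = from g a /\ S n = to g a, ~~ t (top (S n) i),
         (forall j, j <= n -> sizes_le (S j) (f Z))
       & forall j, j < n -> t (top (S j) i) /\
           exists b, [/\ PreB b, fromB g b = S j & toB g b = S j.+1]]) ->
  maps Pre from (reg_while i t p) to.
Proof.
move=> [a Ha] pf H.
have [c Hc] : poly_bounded (fun Z => f Z * (7 * (i * (f Z + 1)) + pbound a (f Z) + 2) +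
  7 * (i * (f Z + 1)) + 1 + f Z) by poly_bounded_tac.
exists c => g x Z og Px bs; have [n [S [len [S0 Sn] tn bS step]]] := H g x Z og Px bs.
split; last by rewrite -Sn; apply: sizes_le_trans (bS n (leqnn n)) _; apply: leq_trans (Hc
  Z); lia.
have := @reach_while g i t p n (pbound a (f Z)) (f Z) S bS _ tn _; rewrite S0 Sn => r.
apply: reach_le (r _ _) _ => [j /step[]//|j ltj|].
  have [_ [b [Pb Eb <-]]] := step j ltj; rewrite -Eb.
  by have [] := Ha g b (f Z) og Pb; rewrite // Eb; apply: bS; apply: ltnW.
apply: leq_trans (Hc Z); rewrite /walk addn1; set X := 7 * _ + _ + _.
have : n * X <= f Z * X by rewrite leq_mul2r len orbT.
lia.
Qed.

Lemma does_while (P Inv : regs -> Prop) i (t : sym -> bool) p F1 F (f : nat -> nat) :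
  does (fun s => Inv s /\ t (top s i)) p F1 -> poly_bounded f ->
  (forall g s Z, ok g -> sizes_le s Z -> P s -> exists n (S : nat -> regs),
     [/\ n <= f Z, S 0 = s /\ S n = F g s, ~~ t (top (S n) i),
         (forall j, j <= n -> sizes_le (S j) (f Z))
       & forall j, j < n -> [/\ Inv (S j), t (top (S j) i) & F1 g (S j) = S j.+1]]) ->
  does P (reg_while i t p) F.
Proof.
move=> H pf chain; apply: does_maps.
apply: (@maps_while _ _ P (fun s => Inv s /\ t (top s i)) _ (fun _ s => s) _ F1 _ _ _ f) => //.
  exact: maps_does H _ _.
move=> g s Z og Ps bs; have [n [S [len S0n tn bS step]]] := chain g s Z og bs Ps.
exists n, S; split=> // j /step[I tj E]; split=> //.
by exists (S j).
Qed.

End Does.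

(** * Elementary operations on registers *)

Definition pushes (l : seq (nat * bool)) : prog :=
  foldr (fun x p => Seq (push x.1 x.2) p) Skip l.
Definition sent (l : seq (nat * bool)) (i : nat) : seq bool :=
  [seq x.2 | x <- l & x.1 == i].
Definition if_top r p q := reg_if r (pred1 (Some true)) p q.
(** The common pattern of clearing, moving, copying and counting: [r] is emptied bit by bit, and
    each bit decides what is pushed elsewhere. *)
Definition drain r (f : bool -> seq (nat * bool)) := reg_while r isSome
  (if_top r (Seq (pop r) (pushes (f true))) (Seq (pop r) (pushes (f false)))).
Definition clear r := drain r (fun=> [::]).
Definition move_rev r t := drain r (fun b => [:: (t, b)]).
(** Registers are stacks, so one transfer reverses the word and a second one restores its order. *)
Definition move_via r u t := Seq (move_rev r u) (move_rev u t).
Definition copy_via r u t := Seq (move_rev r u) (drain u (fun b => [:: (r, b); (t, b)])).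
Definition pop_true r := reg_while r (pred1 (Some true)) (pop r).
Definition pop_token r := Seq (pop_true r) (reg_if r isSome (pop r) Skip).
Definition drop_true (w : seq bool) := drop (find negb w) w.
Definition drop_token (w : seq bool) := behead (drop_true w).
Definition drop_tokens r t :=
  reg_while r isSome (if_top r (pop r) (Seq (pop r) (pop_token t))).
Definition untok r t := reg_while r (pred1 (Some true)) (Seq (pop r) (push t false)).

Lemma size_sent l i : size (sent l i) <= size l.
Proof. by rewrite size_map size_filter count_size. Qed.

Section Ops.
Variable ok : oracle -> Prop.

Lemma does_pushes l : does ok (fun=> True) (pushes l) (fun _ s i => rev (sent l i) ++ s i).
Proof.
elim: l => [|[i b] l IH] /=; first exact: does_skip.
apply: does_ext (does_seq (does_push ok i b) IH _) _ _ => // g s _ _.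
apply: functional_extensionality => j; rewrite /sent /= eq_sym /upd.
by case: eqP => [->|//]; rewrite /= rev_cons cat_rcons.
Qed.

Lemma does_pop_some r (P : regs -> Prop) : (forall s, P s -> s r <> [::]) ->
  does ok P (pop r) (fun _ s => upd s r (behead (s r))).
Proof. by move=> H; apply: does_ext (does_pop ok r) H _. Qed.

Lemma top_true s r : pred1 (Some true) (top s r) -> exists w, s r = true :: w.
Proof. by rewrite /top; case: (s r) => [|[] w] //= _; exists w. Qed.

Lemma top_false s r : isSome (top s r) -> ~~ pred1 (Some true) (top s r) ->
  exists w, s r = false :: w.
Proof. by rewrite /top; case: (s r) => [|[] w] //= _; exists w. Qed.

Lemma does_if_top (P : regs -> Prop) r p q F :
  does ok (fun s => P s /\ exists w, s r = true :: w) p F ->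
  does ok (fun s => P s /\ exists w, s r = false :: w) q F ->
  does ok (fun s => P s /\ isSome (top s r)) (if_top r p q) F.
Proof.
move=> H1 H2; apply: does_if; [apply: does_ext H1 _ _|apply: does_ext H2 _ _] => //.
  by move=> s [[Ps _] /top_true].
by move=> s [[Ps h] /(top_false h)].
Qed.

Lemma does_drain r f : (forall b, r \notin map fst (f b)) ->
  does ok (fun=> True) (drain r f) (fun _ s i => if i == r then [::]
    else rev (flatten [seq sent (f b) i | b <- s r]) ++ s i).
Proof.
move=> rf.
pose F1 (_ : oracle) (s : regs) : regs :=
  let s' := upd s r (behead (s r)) in
  if s r is b :: w then fun i => rev (sent (f b) i) ++ s' i else s.
pose S (s : regs) j : regs := fun i => if i == r then drop j (s r)
  else rev (flatten [seq sent (f b) i | b <- take j (s r)]) ++ s i.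
pose m := size (f true) + size (f false).
apply: (@does_while ok _ (fun=> True) r isSome _ F1 _ (fun Z => Z + Z * m)).
- apply: does_if_top.
    apply: does_ext (does_seq (does_pop ok r) (does_pushes _) _) _ _ => //.
      by move=> s [_ [w ->]].
    by move=> g s _ [_ [w E]]; rewrite /F1 E.
  apply: does_ext (does_seq (does_pop ok r) (does_pushes _) _) _ _ => //.
    by move=> s [_ [w ->]].
  by move=> g s _ [_ [w E]]; rewrite /F1 E.
- by poly_bounded_tac.
move=> g s Z _ bs _; exists (size (s r)), (S s); split.
- by have := bs r; lia.
- by split; apply: functional_extensionality => i; rewrite /S ?drop0 ?take0 ?drop_size
    ?take_size //=; case: eqP => // ->.
- by rewrite /top /S eqxx drop_size.
- move=> j _ i; rewrite /S; case: ifP => _.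
    by rewrite size_drop; have := bs r; lia.
  rewrite size_cat size_rev size_flatten /shape -map_comp.
  have szm b : size (sent (f b) i) <= m.
    by apply: leq_trans (size_sent _ _) _; rewrite /m; case: b; rewrite ?leq_addr ?leq_addl.
  have : size (take j (s r)) <= Z by apply: leq_trans (bs r); rewrite size_take_min geq_minr.
  have H w : sumn [seq (size \o (fun b => sent (f b) i)) b | b <- w] <= size w * m.
    by elim: w => //= b w IH; rewrite mulSn leq_add.
  have := H (take j (s r)); have := bs i.
  move: (sumn _) => X h1 h2 h3.
  have : size (take j (s r)) * m <= Z * m by rewrite leq_mul2r h3 orbT.
  lia.
move=> j ltj; have [b E] : exists b, drop j (s r) = b :: drop j.+1 (s r).
  by exists (nth true (s r) j); rewrite -drop_nth.
have Sjr : S s j r = b :: drop j.+1 (s r) by rewrite /S eqxx.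
split; rewrite /top ?Sjr //.
apply: functional_extensionality => i; rewrite /F1 Sjr /= /upd /S.
case: eqP => [->|_].
  rewrite /sent (_ : filter _ _ = [::]) //; apply/eqP; rewrite -[_ == _]negbK -has_filter.
  by apply: contra (rf b) => /hasP[x xf /eqP <-]; apply: map_f.
have -> : take j.+1 (s r) = rcons (take j (s r)) b.
  have := take_nth b ltj; have := congr1 (head b) E; rewrite -nth0 nth_drop addn0 /=.
  by move=> ->.
by rewrite map_rcons flatten_rcons rev_cat catA.
Qed.

Lemma does_clear r : does ok (fun=> True) (clear r) (fun _ s => upd s r [::]).
Proof.
apply: does_ext (does_drain _) _ _ => // g s _ _.
apply: functional_extensionality => i; rewrite /upd; case: eqP => // _.
by rewrite (_ : flatten _ = [::]) //; elim: (s r).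
Qed.

Lemma does_move_rev (r t : nat) : r != t -> does ok (fun=> True) (move_rev r t)
  (fun _ s => upd (upd s r [::]) t (rev (s r) ++ s t)).
Proof.
move=> nrt; apply: does_ext (does_drain _) _ _ => // [b|g s _ _].
  by rewrite /= inE.
apply: functional_extensionality => i; rewrite /upd /sent /=.
case: (eqVneq i t) nrt => [-> nrt|_ _] /=.
  by rewrite eq_sym (negbTE nrt) flatten_seq1.
by case: eqP => // _; elim: (s r).
Qed.

(** Every token ends in exactly one [false], so on an encoded list this produces its length in
    unary. *)
Lemma does_count (r t : nat) : r != t -> does ok (fun=> True)
  (drain r (fun b => if b then [::] else [:: (t, true)]))
  (fun _ s => upd (upd s r [::]) t (nseq (count negb (s r)) true ++ s t)).
Proof.
move=> nrt; apply: does_ext (does_drain _) _ _ => // [[] //|g s _ _].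
  by rewrite /= inE.
apply: functional_extensionality => i; rewrite /upd /sent.
case: (eqVneq i r) nrt => [->|_ _]; first by move=> /negbTE ->.
case: (eqVneq i t) => [->|nit]; last first.
  by rewrite (_ : flatten _ = [::]) //; elim: (s r) => // [[]] w //= ->; rewrite eq_sym
    (negbTE nit).
congr (_ ++ _); elim: (s r) => // -[] w IH; rewrite /= ?eqxx //.
by rewrite rev_cons IH -cats1 -[[:: true]]/(nseq 1 true) -nseqD addnC.
Qed.

Lemma does_move_via r u t : uniq [:: r; u; t] -> does ok (fun s => s u = [::])
  (move_via r u t) (fun _ s => upd (upd s r [::]) t (s r ++ s t)).
Proof.
rewrite /= !inE => H.
apply: does_ext (does_seq (does_move_rev (r := r) (t := u) _)
  (does_move_rev (r := u) (t := t) _) _) _ _ => //; try lia.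
by move=> g s _ su; rsimp; rewrite su cats0 revK; regs_eq; rewrite ?su.
Qed.
Lemma does_copy_via r u t : uniq [:: r; u; t] ->
  does ok (fun s => s u = [::] /\ s t = [::]) (copy_via r u t) (fun _ s => upd s t (s r)).
Proof.
rewrite /= !inE => H.
apply: does_ext (does_seq (does_move_rev (r := r) (t := u) _)
  (does_drain (r := u) (f := fun b => [:: (r, b); (t, b)]) _) _) _ _ => //; try lia.
  by move=> b; rewrite /= !inE; lia.
move=> g s _ [su config_regs]; apply: functional_extensionality => i; rsimp.
rewrite su cats0 /sent /=; case: (eqVneq i u) => [->|iu]; first by rsimp.
case: (eqVneq i r) => [->|ir].
  by rsimp; rewrite (_ : t == r = false) ?flatten_seq1 ?revK ?cats0 //; lia.
case: (eqVneq i t) => [->|it]; first by rsimp; rewrite flatten_seq1 revK config_regs cats0.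
by rewrite (_ : flatten _ = [::]) ?updN //; elim: (rev _).
Qed.

Lemma does_pop_true r : does ok (fun=> True) (pop_true r)
  (fun _ s => upd s r (drop_true (s r))).
Proof.
apply: (@does_while ok _ (fun=> True) r _ _ (fun _ s => upd s r (behead (s r))) _ id).
- by apply: does_pop_some => s [_ /top_true[w ->]].
- exact: poly_bounded_id.
move=> g s Z _ bs _; exists (find negb (s r)), (fun j => upd s r (drop j (s r))); split.
- by apply: leq_trans (find_size _ _) (bs r).
- by rewrite drop0 upd_id.
- rewrite /top updE; have := has_find negb (s r).
  case: ltnP => [lt h|le _]; last by rewrite drop_oversize.
  by rewrite (drop_nth true lt) /=; have := nth_find true h; case: nth.
- by move=> j _; apply: sizes_le_upd => //; rewrite size_drop; have := bs r; lia.
move=> j ltj; have lt := leq_trans ltj (find_size negb (s r)).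
have := before_find true ltj; case E: nth => // _; split=> //.
  by rewrite /top updE (drop_nth true lt) E.
by rewrite updE -drop1 drop_drop add1n; regs_eq.
Qed.

Lemma does_pop_if r : does ok (fun=> True) (reg_if r isSome (pop r) Skip)
  (fun _ s => upd s r (behead (s r))).
Proof.
apply: does_if; first by apply: does_pop_some => s [_]; rewrite /top; case: (s r).
apply: does_ext (does_skip ok) _ _ => // g s _ [_].
by rewrite /top; case E: (s r) => //= _; rewrite -E upd_id.
Qed.

Lemma does_pop_token r : does ok (fun=> True) (pop_token r)
  (fun _ s => upd s r (drop_token (s r))).
Proof.
apply: does_ext (does_seq (does_pop_true r) (does_pop_if r) _) _ _ => // g s _ _.
by rsimp; regs_eq.
Qed.

Lemma does_drop_tokens (r t : nat) : r != t -> does ok (fun=> True) (drop_tokens r t)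
  (fun _ s => upd (upd s r [::]) t (iter (count negb (s r)) drop_token (s t))).
Proof.
move=> nrt; pose F1 (_ : oracle) (s : regs) := upd (upd s r (behead (s r))) t
  (iter (count negb (take 1 (s r))) drop_token (s t)).
have size_tok n w : size (iter n drop_token w) <= size w.
  by elim: n => //= n; rewrite size_behead size_drop; lia.
apply: (@does_while ok _ (fun=> True) r _ _ F1 _ id).
- apply: does_if_top.
    apply: does_ext (does_pop ok r) _ _ => [s [_ [w ->]] //|g s _ [_ [w E]]].
    by rewrite /F1 E /= take0 /=; regs_eq.
  apply: does_ext (does_seq (does_pop ok r) (does_pop_token t) _) _ _ => //.
    by move=> s [_ [w ->]].
  by move=> g s _ [_ [w E]]; rewrite /F1 E /= take0; rsimp.
- exact: poly_bounded_id.
move=> g s Z _ bs _; exists (size (s r)), (fun j => upd (upd s r (drop j (s r))) t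
  (iter (count negb (take j (s r))) drop_token (s t))); split.
- exact: bs.
- by rewrite drop0 take0 drop_size take_size /=; split=> //; regs_eq.
- by rewrite /top; rsimp; rewrite drop_size.
- move=> j _; apply: sizes_le_upd; last by apply: leq_trans (size_tok _ _) (bs t).
  by apply: sizes_le_upd => //; rewrite size_drop; have := bs r; lia.
move=> j ltj; split=> //; rewrite /top /F1; rsimp; first by rewrite (drop_nth true ltj).
have -> : take j.+1 (s r) = take j (s r) ++ take 1 (drop j (s r)).
  by rewrite -takeD addn1.
rewrite -drop1 drop_drop add1n -iterD addnC count_cat.
by regs_eq.
Qed.

Lemma does_untok (r t : nat) : r != t -> does ok (fun=> True) (untok r t)
  (fun _ s => upd (upd s r (drop_true (s r))) t (nseq (find negb (s r)) false ++ s t)).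
Proof.
move=> nrt; apply: (@does_while ok _ (fun=> True) r _ _
  (fun _ s => upd (upd s r (behead (s r))) t (false :: s t)) _ (fun Z => Z + Z)).
- apply: does_ext (does_seq (does_pop ok r) (does_push ok t false) _) _ _ => //.
    by move=> s [_ /top_true[w ->]].
  by move=> g s _ _; rsimp.
- by poly_bounded_tac.
move=> g s Z _ bs _; have lef : find negb (s r) <= Z by apply: leq_trans (find_size _ _) (bs r).
exists (find negb (s r)), (fun j => upd (upd s r (drop j (s r))) t (nseq j false ++ s t)).
split; first by lia.
- by rewrite drop0; split=> //; regs_eq.
- rewrite /top; rsimp; have := has_find negb (s r).
  case: ltnP => [lt h|le _]; last by rewrite drop_oversize.
  by rewrite (drop_nth true lt) /=; have := nth_find true h; case: nth.
- move=> j lej; apply: sizes_le_upd; last by rewrite size_cat size_nseq; have := bs t; lia.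
  by apply: sizes_le_upd; [apply: sizes_le_trans bs _; lia | rewrite size_drop; have := bs r;
    lia].
move=> j ltj; have lt := leq_trans ltj (find_size negb (s r)).
have := before_find true ltj; case E: nth => // _; split=> //.
  by rewrite /top; rsimp; rewrite (drop_nth true lt) E.
by rsimp; rewrite -drop1 drop_drop add1n; regs_eq.
Qed.

End Ops.

(** * A comprehension language *)

Definition enc_toks (v : seq nat) : seq bool := flatten (map enc_nat v).

Fixpoint toks_from (n : nat) (w : seq bool) : seq nat :=
  match w with
  | [::] => [::]
  | true :: w' => toks_from n.+1 w'
  | false :: w' => n :: toks_from 0 w'
  end.
(* A trailing block of ones without final zero is dropped. *)
Definition toks := toks_from 0.

Lemma enc_toks_cat u v : enc_toks (u ++ v) = enc_toks u ++ enc_toks v.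
Proof. by rewrite /enc_toks map_cat flatten_cat. Qed.

Lemma enc_toks_cons n v : enc_toks (n :: v) = nseq n true ++ false :: enc_toks v.
Proof. by rewrite /enc_toks /= -catA. Qed.

Lemma toks_nseq n m w : toks_from m (nseq n true ++ w) = toks_from (n + m) w.
Proof. by elim: n m => //= n IH m; rewrite IH addnS. Qed.

Lemma enc_toksK v : toks (enc_toks v) = v.
Proof.
by elim: v => // n v IH; rewrite enc_toks_cons /toks toks_nseq /= addn0 -/toks IH.
Qed.

Lemma size_enc_toks v : size (enc_toks v) = sumn v + size v.
Proof. by elim: v => // n v IH; rewrite enc_toks_cons size_cat size_nseq /= IH; lia. Qed.

Lemma drop_true_nseq n w : drop_true (nseq n true ++ false :: w) = false :: w.
Proof. by rewrite /drop_true find_cat has_nseq andbF size_nseq /= addn0 drop_size_cat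
  ?size_nseq. Qed.

Lemma find_nseq n w : find negb (nseq n true ++ false :: w) = n.
Proof. by rewrite find_cat has_nseq andbF size_nseq /= addn0. Qed.

Lemma drop_token_enc v : drop_token (enc_toks v) = enc_toks (behead v).
Proof. by case: v => // n v; rewrite enc_toks_cons /drop_token drop_true_nseq. Qed.

Lemma iter_drop_token n v : iter n drop_token (enc_toks v) = enc_toks (drop n v).
Proof.
by elim: n => [|n IH]; rewrite ?drop0 //= IH drop_token_enc -drop1 drop_drop add1n.
Qed.

Lemma count_enc_toks v : count negb (enc_toks v) = size v.
Proof. by elim: v => // n v IH; rewrite enc_toks_cons count_cat count_nseq /= IH; lia. Qed.

(* A number n is represented by any list of length n.  [For v a b] concatenates the
   values of [b], for [v] running through the proper tails of [a], shortest first: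
   on numbers, [v] takes the values 0, ..., n - 1 in this order. *)
Inductive term :=
| Var of nat
| Nul
| One
| Cat of term & term
| Tok of term
| Untok of term
| Drop of term & term
| Ifn of term & term & term
| For of nat & term & term.

Fixpoint over_tails (f : seq nat -> seq nat) (l : seq nat) : seq nat :=
  if l is _ :: l' then over_tails f l' ++ f l' else [::].

Fixpoint eval (e : term) (rho : nat -> seq nat) : seq nat :=
  match e with
  | Var v => rho v
  | Nul => [::]
  | One => [:: 0]
  | Cat a b => eval a rho ++ eval b rho
  | Tok a => [:: size (eval a rho)]
  | Untok a => nseq (head 0 (eval a rho)) 0
  | Drop a b => drop (size (eval a rho)) (eval b rho)
  | Ifn a b c => if nilp (eval a rho) then eval c rho else eval b rho
  | For v a b => over_tails (fun x => eval b (upd rho v x)) (eval a rho)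
  end.

Definition work d := d.*2.
Definition var v := v.*2.+1.

(* The value of [e] is left in register [work d]; variables are held in odd registers,
   and [work j] is free for all j >= d. *)
Fixpoint compile (e : term) (d : nat) : prog :=
  match e with
  | Var v => copy_via (var v) (work d.+1) (work d)
  | Nul => Skip
  | One => push (work d) false
  | Cat a b => Seq (compile b d) (Seq (compile a d.+1) (move_via (work d.+1) (work d.+2)
    (work d)))
  | Tok a => Seq (compile a d.+1) (Seq (push (work d) false)
      (drain (work d.+1) (fun b => if b then [::] else [:: (work d, true)])))
  | Untok a => Seq (compile a d.+1) (Seq (untok (work d.+1) (work d)) (clear (work d.+1)))
  | Drop a b => Seq (compile b d) (Seq (compile a d.+1) (drop_tokens (work d.+1) (work d)))
  | Ifn a b c => Seq (compile a d)
      (reg_if (work d) isSome (Seq (clear (work d)) (compile b d)) (compile c d))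
  | For v a b => Seq (compile a d.+1) (Seq (move_rev (var v) (work d.+2))
      (Seq (move_via (work d.+1) (work d.+3) (var v))
      (Seq (reg_while (var v) isSome (Seq (pop_token (var v))
             (Seq (compile b d.+3) (move_via (work d.+3) (work d.+4) (work d)))))
           (move_rev (work d.+2) (var v)))))
  end.

Lemma size_over_tails f l Z :
  (forall j, size (enc_toks (f (drop j l))) <= Z) ->
  size (enc_toks (over_tails f l)) <= size l * Z.
Proof.
elim: l => //= a l IH H; rewrite enc_toks_cat size_cat mulSn addnC leq_add //.
  by have := H 1; rewrite drop1.
by apply: IH => j; have := H j.+1.
Qed.

Lemma size_enc_drop n v : size (enc_toks (drop n v)) <= size (enc_toks v).
Proof. by rewrite -{2}(cat_take_drop n v) enc_toks_cat size_cat leq_addl. Qed.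

Lemma size_le_enc v : size v <= size (enc_toks v).
Proof. by rewrite size_enc_toks leq_addl. Qed.

(** A [For] never feeds the result of one round into the next: its body sees only the environment
    and a tail of the list. A loop therefore multiplies polynomial bounds instead of iterating
    them. *)
Lemma eval_bound e : exists c, forall rho Z,
  (forall v, size (enc_toks (rho v)) <= Z) -> size (enc_toks (eval e rho)) <= pbound c Z.
Proof.
suff [f [c Hc] H] : exists2 f, poly_bounded f & forall rho Z,
    (forall v, size (enc_toks (rho v)) <= Z) -> size (enc_toks (eval e rho)) <= f Z.
  by exists c => rho Z /H le; apply: leq_trans le (Hc Z).
elim: e => [v|||a [f pf Ha] b [h ph Hb]|a [f pf Ha]|a [f pf Ha]|a [f pf Ha] b [h ph Hb]
  |a [f pf Ha] b [h ph Hb] c [k pk Hc]|v a [f pf Ha] b [h ph Hb]] /=.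
- by exists id; [exact: poly_bounded_id | move=> rho Z; apply].
- by exists (fun=> 0) => //; exact: poly_bounded_const.
- by exists (fun=> 1) => //; exact: poly_bounded_const.
- exists (fun x => f x + h x); first exact: poly_bounded_add.
  by move=> rho Z le; rewrite enc_toks_cat size_cat leq_add ?Ha ?Hb.
- exists (fun x => f x + 1); first by poly_bounded_tac.
  move=> rho Z /Ha le; rewrite size_enc_toks /=.
  by have := size_le_enc (eval a rho); lia.
- exists f => // rho Z /Ha le; apply: leq_trans le.
  by rewrite !size_enc_toks sumn_nseq size_nseq mul0n; case: (eval a rho) => //=; lia.
- by exists h => // rho Z /Hb le; apply: leq_trans (size_enc_drop _ _) le.
- exists (fun x => h x + k x); first exact: poly_bounded_add.
  move=> rho Z le; case: ifP => _; first by apply: leq_trans (Hc _ _ le) (leq_addl _ _).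
  by apply: leq_trans (Hb _ _ le) (leq_addr _ _).
case: (ph) => c Hc.
(* At most [f x] rounds; the body runs in an environment of size at most [x], except for the loop
   variable, of size at most [f x]. *)
exists (fun x => f x * pbound c (f x + x)); first by poly_bounded_tac.
move=> rho Z le; have le' := Ha _ _ le.
apply: leq_trans (size_over_tails (Z := pbound c (f Z + Z)) _) _ => [j|].
  apply: leq_trans (Hc _); apply: Hb => w; rewrite /upd; case: ifP => _.
    by apply: leq_trans (size_enc_drop _ _) _; apply: leq_trans le' (leq_addr _ _).
  by apply: leq_trans (le w) (leq_addl _ _).
by rewrite leq_mul2r (leq_trans (size_le_enc _) le') orbT.
Qed.

Definition env_of (s : regs) v := toks (s (var v)).
Definition ready d (s : regs) :=
  (forall v, s (var v) = enc_toks (env_of s v)) /\ forall j, d <= j -> s (work j) = [::].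

Section Comp.
Variable ok : oracle -> Prop.

Definition computes e d := does ok (ready d) (compile e d)
  (fun _ s => upd s (work d) (enc_toks (eval e (env_of s)))).

Lemma env_of_work s d w : env_of (upd s (work d) w) = env_of s.
Proof.
by apply: functional_extensionality => v; rewrite /env_of updN // /var /work; lia.
Qed.

Lemma env_of_var s v x : env_of (upd s (var v) (enc_toks x)) = upd (env_of s) v x.
Proof.
apply: functional_extensionality => u; rewrite /env_of /upd.
by case: (eqVneq u v) => [->|ne]; rewrite ?eqxx ?enc_toksK // ifF // /var; lia.
Qed.

Lemma ready_le d e s : ready d s -> d <= e -> ready e s.
Proof. by case=> Hv Hw le; split=> // j lej; apply: Hw; apply: leq_trans lej. Qed.

Lemma ready_work d s w e : ready d s -> e < d -> ready d (upd s (work e) w).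
Proof.
move=> [Hv Hw] lt; split=> [v|j le]; rewrite ?env_of_work updN ?Hw //; rewrite /work /var; lia.
Qed.

Lemma ready_var d s v x : ready d s -> ready d (upd s (var v) (enc_toks x)).
Proof.
move=> [Hv Hw]; split=> [u|j le]; last by rewrite updN ?Hw //; rewrite /work /var; lia.
rewrite env_of_var /upd; case: (eqVneq u v) => [->|ne]; first by rewrite eqxx.
by rewrite ifF ?Hv // /var; lia.
Qed.

Lemma ready_clear d s : ready d.+1 s -> ready d (upd s (work d) [::]).
Proof.
move=> [Hv Hw]; split=> [v|j le]; first by rewrite ?env_of_work updN ?Hv // /work /var; lia.
by rewrite /upd; case: ifP => // ne; apply: Hw; move: ne; rewrite /work; lia.
Qed.

(** The accumulator after [j] rounds. Tails are met longest first, but each result is put in front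
    of the earlier ones, which yields the order of [over_tails]. *)
Definition heads (f : seq nat -> seq nat) l j :=
  flatten (rev [seq f (drop i.+1 l) | i <- iota 0 j]).

Lemma headsS f l j : heads f l j.+1 = f (drop j.+1 l) ++ heads f l j.
Proof. by rewrite /heads -addn1 iotaD map_cat rev_cat flatten_cat /= cats0 addn1. Qed.

Lemma over_tailsE f l : over_tails f l = heads f l (size l).
Proof.
elim: l => // a l IH; rewrite /= IH /heads /= rev_cons flatten_rcons drop0.
by rewrite (iotaDl 1) -map_comp.
Qed.

(** The register of the loop variable is the loop counter itself: removing its first token leaves
    exactly the tail that the body is to see. *)
Lemma does_for v b d : (forall d, computes b d) ->
  does ok (fun s => ready d.+3 s /\ s (work d) = [::])
    (reg_while (var v) isSome (Seq (pop_token (var v))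
             (Seq (compile b d.+3) (move_via (work d.+3) (work d.+4) (work d)))))
    (fun _ s => upd (upd s (var v) [::]) (work d)
      (enc_toks (over_tails (fun x => eval b (upd (env_of s) v x)) (env_of s v)))).
Proof.
move=> IHb; have [c Hc] := eval_bound b.
pose F1 (_ : oracle) s := let s1 := upd s (var v) (enc_toks (behead (env_of s v))) in
  upd s1 (work d) (enc_toks (eval b (env_of s1)) ++ s (work d)).
apply: (@does_while ok _ (ready d.+3) _ _ _ F1 _ (fun Z => Z + Z * pbound c Z)).
- apply: does_ext (does_seq (does_weak (fun s => ready d.+3 s /\ isSome (top s (var v)))
      (does_pop_token ok _)) (does_seq (IHb d.+3) (does_move_via ok _) _) _) _ _ => //.
  + by rewrite /= !inE /work; lia.
  + by move=> g s _ [_ H]; rewrite updN ?H // /work; lia.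
  + by move=> g s _ [[Hv Hw] _]; rewrite Hv drop_token_enc; apply: ready_var.
  + move=> g s _ [[Hv Hw] _]; rewrite Hv drop_token_enc /F1.
    set s1 := upd s _ _; have E : s (work d.+3) = [::] by apply: Hw.
    have := E; rewrite /s1 /work /var => E'; rsimp; regs_eq.
- by poly_bounded_tac.
move=> g s Z og bs [rs s0]; set l := env_of s v.
set f := fun x => eval b (upd (env_of s) v x).
have sl : size (enc_toks l) <= Z by case: rs => <-.
have sf j : size (enc_toks (f (drop j l))) <= pbound c Z.
  apply: Hc => u; rewrite /upd; case: ifP => _; last by case: rs => <-.
  exact: leq_trans (size_enc_drop _ _) sl.
have nl : size l <= Z := leq_trans (size_le_enc l) sl.
exists (size l), (fun j => upd (upd s (var v) (enc_toks (drop j l))) (work d)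
  (enc_toks (heads f l j))); split.
- by lia.
- rewrite drop0 drop_size over_tailsE; split=> //.
  by rewrite -[enc_toks (heads _ _ 0)]/[::] -s0; case: rs => Hv _; rewrite -Hv !upd_id.
- by rewrite /top updN ?updE ?drop_size // /work /var; lia.
- move=> j lej; apply: sizes_le_upd; first apply: sizes_le_upd.
  + by apply: sizes_le_trans bs _; lia.
  + by apply: leq_trans (size_enc_drop _ _) _; lia.
  suff : size (enc_toks (heads f l j)) <= j * pbound c Z.
    move=> h; have : j * pbound c Z <= Z * pbound c Z by rewrite leq_mul2r (leq_trans lej nl)
      orbT.
    lia.
  elim: j {lej} => // j IH; rewrite headsS enc_toks_cat size_cat mulSn leq_add //.
move=> j ltj; split.
- by apply: ready_work; [apply: ready_var | lia].
- rewrite /top updN ?updE; last by rewrite /work /var; lia.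
  by rewrite (drop_nth 0 ltj) enc_toks_cons; case: nth.
rewrite /F1 env_of_work env_of_var updE headsS enc_toks_cat.
rewrite env_of_var env_of_work env_of_var updK updE -drop1 drop_drop add1n -/(f _).
by rewrite /work /var; regs_eq.
Qed.

Lemma comp_sound e d : computes e d.
Proof.
rewrite /computes.
elim: e d => [v|||a IHa b IHb|a IHa|a IHa|a IHa b IHb|a IHa b IHb c IHc|v a IHa b IHb] d /=.
- apply: does_ext (does_copy_via ok _) _ _; first by rewrite /= !inE /var /work; lia.
    by move=> s [_ H]; split; apply: H; lia.
  by move=> g s _ [Hv _]; rewrite Hv /env_of.
- apply: does_ext (does_skip ok) _ _ => // g s _ [_ /(_ d (leqnn d)) E].
  by rewrite -[enc_toks _]/[::] -E upd_id.
- apply: does_ext (does_push ok _ _) _ _ => // g s _ [_ /(_ d (leqnn d)) E].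
  by rewrite E.
- apply: does_ext (does_seq (IHb d) (does_seq (IHa d.+1) (does_move_via ok _) _) _) _ _ => //.
  + by rewrite /= !inE /work; lia.
  + by move=> g s _ [_ H]; rewrite /work; rsimp; apply: (H d.+2); lia.
  + by move=> g s _ r; apply: ready_work (ready_le r _) _.
  + move=> g s _ [_ H]; rewrite !env_of_work enc_toks_cat.
    have E := H d.+1 (leqnSn d); rewrite /work in E *; rsimp; regs_eq.
- apply: does_ext (does_seq (IHa d.+1) (does_seq (does_push ok _ _) (does_count ok _) _) _) _
  _ => //.
  + by rewrite /work; lia.
  + by move=> s r; apply: ready_le r _.
  + move=> g s _ [_ H]; have := H d.+1 (leqnSn d); have := H d (leqnn d).
    rewrite /work => E0 E; rsimp; rewrite count_enc_toks E0 -[[:: false]]cat0s.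
    by rewrite enc_toks_cons; regs_eq.
- apply: does_ext (does_seq (IHa d.+1) (does_seq (does_untok ok _) (does_clear ok _) _) _) _
  _ => //.
  + by rewrite /work; lia.
  + by move=> s r; apply: ready_le r _.
  + move=> g s _ [_ H]; have := H d.+1 (leqnSn d); have := H d (leqnn d).
    rewrite /work => E0 E; rsimp; rewrite E0 cats0.
    suff -> : nseq (find negb (enc_toks (eval a (env_of s)))) false =
      enc_toks (nseq (head 0 (eval a (env_of s))) 0) by regs_eq.
    case: (eval a _) => //= n l; rewrite enc_toks_cons find_nseq.
    by elim: n => //= n ->.
- apply: does_ext (does_seq (IHb d) (does_seq (IHa d.+1) (does_drop_tokens ok _) _) _) _ _ =>
  //.
  + by rewrite /work; lia.
  + by move=> g s _ r; apply: ready_work (ready_le r _) _.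
  + move=> g s _ [_ H]; have := H d.+1 (leqnSn d).
    rewrite !env_of_work /work => E; rsimp.
    by rewrite count_enc_toks iter_drop_token; regs_eq.
- pose P s := ready d.+1 s.
  have nil_top s : ~~ isSome (top s (work d)) -> s (work d) = [::].
    by rewrite /top; case: (s _).
  apply: does_ext (does_seq (IHa d) (@does_if ok P _ _ _ _ (fun _ s =>
      upd s (work d) (enc_toks (eval (if nilp (s (work d)) then c else b) (env_of s))))
      _ _) _) _ _ => //.
  + apply: does_ext (does_seq (does_weak P (does_clear ok _)) (IHb d) _) _ _ => //.
    - by move=> g s _; apply: ready_clear.
    - by move=> s [].
    move=> g s _ [_ tr]; rewrite env_of_work.
    have -> : nilp (s (work d)) = false by move: tr; rewrite /top; case: (s _).
    by regs_eq.
  + apply: does_ext (IHc d) _ _ => [s [Ps /nil_top E]|g s _ [Ps /nil_top E]].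
      by rewrite -[s](upd_id _ (work d)) E; apply: ready_clear.
    by rewrite E.
  + by move=> g s _ r; apply: ready_work (ready_le r _) _.
  + move=> g s _ [_ H]; rewrite !env_of_work updE.
    rewrite (_ : nilp (enc_toks _) = nilp (eval a (env_of s))).
      by case: ifP => _; regs_eq.
    by case: (eval a _) => // n l; rewrite enc_toks_cons; case: n.
(* In a [For], the outer value of the variable is parked, reversed, in [work d.+2] while its
   register holds the loop list, and is moved back at the end. [A1] and [A2] describe the states
   before and after the parking. *)
pose A1 s := exists s0 l, ready d s0 /\ s = upd s0 (work d.+1) (enc_toks l).
pose A2 s := exists s0 l, ready d s0 /\ s = upd (upd (upd s0 (work d.+1) (enc_toks l))
  (var v) [::]) (work d.+2) (rev (enc_toks (env_of s0 v))).
have m1 : var v != work d.+2 by rewrite /var /work; lia.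
have m2 : uniq [:: work d.+1; work d.+3; var v] by rewrite /= !inE /var /work; lia.
have m3 : work d.+2 != var v by rewrite /var /work; lia.
have step1 s0 l : ready d s0 -> let s := upd s0 (work d.+1) (enc_toks l) in
    upd (upd s (var v) [::]) (work d.+2) (rev (s (var v)) ++ s (work d.+2)) =
    upd (upd s (var v) [::]) (work d.+2) (rev (enc_toks (env_of s0 v))).
  move=> [Hv Hw] s; rewrite /s -Hv; have := Hw d.+2; rewrite /work /var => Hw2.
  by rsimp; rewrite Hw2 ?cats0 //; lia.
have step2 s0 l x : ready d s0 ->
    let s := upd (upd (upd s0 (work d.+1) (enc_toks l)) (var v) [::]) (work d.+2) x in
    upd (upd s (work d.+1) [::]) (var v) (s (work d.+1) ++ s (var v)) =
    upd (upd s0 (var v) (enc_toks l)) (work d.+2) x.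
  move=> [Hv Hw] s; rewrite /s; have := Hw d.+1 (leqnSn d); rewrite /work /var => Hw1.
  by rsimp; rewrite cats0; regs_eq.
have IHd : does ok (ready d) _ _ := does_sub (IHa d.+1) (fun s r => ready_le r (leqnSn d)).
apply: does_ext (does_seq IHd (does_seq (does_weak A1 (does_move_rev ok m1))
  (does_seq (does_sub (Q := A2) (does_move_via ok m2) _)
  (does_seq (does_for v d IHb) (does_move_rev ok m3) _) _) _) _) _ _ => //.
- move=> s [s0 [l [[_ Hw] ->]]]; have := Hw d.+3; rewrite /work /var => H.
  by rsimp; apply: H; lia.
- move=> g s _ [s0 [l [r ->]]]; rewrite step2 //; split.
    by apply: ready_work => //; apply: ready_var; apply: ready_le r _; lia.
  by case: r => _ /(_ d (leqnn d)); rewrite /work /var => H; rsimp.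
- by move=> g s _ [s0 [l [r ->]]]; rewrite step1 //; exists s0, l.
- by move=> g s _ r; exists s, (eval a (env_of s)).
move=> g s _ r; rewrite step1 // step2 // !env_of_work env_of_var updE.
rewrite (_ : (fun x => _) = fun x => eval b (upd (env_of s) v x)); last first.
  by apply: functional_extensionality => x; rewrite updK.
case: r => Hv Hw; have := Hw d.+2; have := Hv v; rewrite /work /var => Ev H2.
by rsimp; rewrite revK -Ev cats0; regs_eq; rewrite ?H2 //; lia.
Qed.

End Comp.

(** * One oracle call with translated question and answer *)

Lemma toks_split w : exists n, w = enc_toks (toks w) ++ nseq n true.
Proof.
suff [v [n ->]] : exists v n, w = enc_toks v ++ nseq n true.
  exists n; congr (enc_toks _ ++ _); elim: v => [|a v IH]; last first.
    by rewrite enc_toks_cons -catA /toks toks_nseq /= addn0 -/toks -IH.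
  by rewrite /toks /= -[nseq n true]cats0 toks_nseq.
elim: w => [|[] w [v [n ->]]]; first by exists [::], 0.
  case: v => [|a v]; first by exists [::], n.+1.
  by exists (a.+1 :: v), n; rewrite !enc_toks_cons.
by exists (0 :: v), n; rewrite enc_toks_cons.
Qed.

Lemma rev_drop_true w : rev (drop_true (rev w)) = enc_toks (toks w).
Proof.
have [n {1}->] := toks_split w; rewrite rev_cat rev_nseq.
have: exists u, rev (enc_toks (toks w)) = if toks w is [::] then [::] else false :: u.
  case/lastP: (toks w) => [|v a]; first by exists [::].
  rewrite -cats1 enc_toks_cat enc_toks_cons rev_cat rev_cat /=.
  by eexists; case: v.
case=> u uE; rewrite -[RHS]revK uE; case: (toks w) => [|_ _].
  by rewrite cats0 /drop_true drop_oversize //; elim: n.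
by rewrite drop_true_nseq.
Qed.

Lemma size_enc_toks_le w : size (enc_toks (toks w)) <= size w.
Proof. by have [n {2}->] := toks_split w; rewrite size_cat leq_addr. Qed.

(** An arbitrary word may end in an unfinished token. On the reversed copy these ones are on top,
    where [pop_true] removes them before the order is restored. *)
Definition normalize v := Seq (move_rev 0 2) (Seq (pop_true 2) (move_rev 2 (var v))).

Definition env0 (w : seq bool) := upd (fun=> [::]) 0 (toks w).
Definition env1 w ans := upd (env0 w) 1 (toks ans).

(** The work registers used start at [work 7] = 14, above the even registers 0 to 12 of the
    simulation. Variables 0 and 1, the question asked and the reply, live in registers 1 and 3,
    which are emptied at the end. *)
Definition consult pre post :=
  Seq (normalize 0) (Seq (compile pre 7) (Seq (move_via 14 16 0) (Seq (reg_qry 0)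
  (Seq (normalize 1) (Seq (compile post 7) (Seq (move_via 14 16 0)
  (Seq (clear 1) (clear 3)))))))).

Section Consult.
Variable ok : oracle -> Prop.

Lemma does_normalize v : does ok (fun s => s 2 = [::] /\ s (var v) = [::]) (normalize v)
  (fun _ s => upd (upd s 0 [::]) (var v) (enc_toks (toks (s 0)))).
Proof.
have m1 : 0 != 2 by []. have m2 : 2 != var v by rewrite /var; lia.
apply: does_ext (does_seq (does_move_rev ok m1)
  (does_seq (does_pop_true ok 2) (does_move_rev ok m2) _) _) _ _ => //.
move=> g s _ [s2 sv]; rewrite -rev_drop_true.
by move: sv; rewrite /var => sv; rsimp; rewrite s2 sv !cats0; regs_eq.
Qed.

Variables pre post : term.

Definition question w := enc_toks (eval pre (env0 w)).
Definition answer (g : oracle) w := enc_toks (eval post (env1 w (g (question w)))).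

Hypothesis short_reply : exists c, forall g w, ok g -> size (g (question w)) <= pbound c
  (size w).

Lemma question_toks w : question (enc_toks (toks w)) = question w.
Proof. by rewrite /question /env0 enc_toksK. Qed.

Definition idle (s : regs) := [/\ s 2 = [::], forall v, s (var v) = [::] & forall j, 7 <= j
  -> s (work j) = [::]].

(** The reply is bounded in terms of the original word, not of its translation in register 0.
    Register 1 still holds the normal form of that word, which has the same translation, and so
    supplies the bound. *)
Lemma does_query : does ok (fun s => exists w, s 0 = question w /\ s 1 = enc_toks (toks w))
  (reg_qry 0) (fun g s => upd s 0 (g (s 0))).
Proof.
have [c Hc] := short_reply.
apply: (@does_intro _ _ _ _ (fun Z => 1 + Z + pbound c Z)) => [|g s Z og bs [w [E0 E1]]].
  by poly_bounded_tac.
split; first by apply: reach_le (@reach_qry g s 0 Z bs) _; rewrite /walk; lia.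
apply: sizes_le_upd; first by apply: sizes_le_trans bs _; lia.
rewrite E0 -question_toks; apply: leq_trans (Hc _ _ og) _.
by rewrite -E1; apply: leq_trans (leq_pbound (leqnn c) (bs 1)) _; rewrite leq_addl.
Qed.

Lemma idle_ready s : idle s -> ready 7 s /\ env_of s = fun=> [::].
Proof.
case=> _ Hv Hw; have E : env_of s = fun=> [::].
  by apply: functional_extensionality => v; rewrite /env_of Hv.
by split=> //; split=> // v; rewrite E Hv.
Qed.

Lemma does_consult : does ok idle (consult pre post) (fun g s => upd s 0 (answer g (s 0))).
Proof.
have m : uniq [:: 14; 16; 0] by [].
pose m1 (_ : oracle) (s : regs) := upd (upd s 0 [::]) 1 (enc_toks (toks (s 0))).
pose m2 g (s : regs) := upd (m1 g s) 14 (question (s 0)).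
pose m3 g (s : regs) := upd (m1 g s) 0 (question (s 0)).
pose m4 g (s : regs) := upd (m1 g s) 0 (g (question (s 0))).
pose m5 g (s : regs) := upd (m1 g s) 3 (enc_toks (toks (g (question (s 0))))).
pose m6 g (s : regs) := upd (m5 g s) 14 (answer g (s 0)).
pose m7 g (s : regs) := upd (m5 g s) 0 (answer g (s 0)).
pose m8 g (s : regs) := upd (m7 g s) 1 [::].
have m1r g s : idle s -> ready 7 (m1 g s) /\ env_of (m1 g s) = env0 (s 0).
  move=> I; have [r E] := idle_ready I.
  split; first by apply: (@ready_var 7 _ 0); apply: (@ready_work 7 s [::] 0).
  by rewrite /m1 (@env_of_var _ 0) (@env_of_work s 0) E.
have m5r g s : idle s -> ready 7 (m5 g s) /\ env_of (m5 g s) = env1 (s 0) (g (question (s 0))).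
  move=> I; have [r E] := m1r g s I; split; first exact: (@ready_var 7 _ 1).
  by rewrite /m5 (@env_of_var _ 1) E.
apply: does_maps.
apply: (maps_seq (mid := m1)).
  apply: maps_does (does_normalize 0) _ _ => // g s _ [s2 Hv _]; split=> //; exact: (Hv 0).
apply: (maps_seq (mid := m2)).
  apply: maps_does (comp_sound ok pre 7) _ _ => g s _ /(m1r g)[r E] //.
  by rewrite E.
apply: (maps_seq (mid := m3)).
  apply: maps_does (does_move_via ok m) _ _ => g s _ [s2 _ Hw]; rewrite /m2 /m3 /m1; rsimp.
    exact: (Hw 8).
  by rewrite cats0; have := Hw 7 isT; rewrite -[work 7]/14 => E; regs_eq.
apply: (maps_seq (mid := m4)).
  apply: maps_does does_query _ _ => g s _ _; last by rewrite /m3 /m4; rsimp; rewrite updK.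
  by exists (s 0); rewrite /m3 /m1; rsimp.
apply: (maps_seq (mid := m5)).
  apply: maps_does (does_normalize 1) _ _ => g s _ [s2 Hv Hw]; rewrite /m4 /m5 /m1; rsimp.
    by split=> //; rewrite -[var 1]/3; rsimp; exact: (Hv 1).
  by rewrite -[var 1]/3; regs_eq.
apply: (maps_seq (mid := m6)).
  apply: maps_does (comp_sound ok post 7) _ _ => g s _ /(m5r g)[r E] //.
  by rewrite E.
apply: (maps_seq (mid := m7)).
  apply: maps_does (does_move_via ok m) _ _ => g s _ [s2 _ Hw]; rewrite /m6 /m7 /m5 /m1; rsimp.
    exact: (Hw 8).
  by rewrite cats0; have := Hw 7 isT; rewrite -[work 7]/14 => E; regs_eq.
apply: (maps_seq (mid := m8)).
  exact: maps_does (does_clear ok 1) _ _.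
apply: maps_does (does_clear ok 3) _ _ => // g s _ [s2 Hv Hw].
have := Hv 0; have := Hv 1; rewrite /m8 /m7 /m5 /m1 -[var 0]/1 -[var 1]/3 => E3 E1.
by regs_eq.
Qed.

End Consult.

(** * Simulation of an oracle machine *)

(** A register contains no blanks, so the simulated tape needs a prefix code for its three
    symbols. *)
Definition cell (a : sym) : seq bool := if a is Some b then [:: true; b] else [:: false].
Definition cells (s : seq sym) : seq bool := flatten (map cell s).

Lemma cells_cat s t : cells (s ++ t) = cells s ++ cells t.
Proof. by rewrite /cells map_cat flatten_cat. Qed.

Lemma size_cells s : size (cells s) <= (size s).*2.
Proof. by elim: s => // -[b|] s IH; rewrite /= -/(cells s); lia. Qed.

Lemma size_le_cells s : size s <= size (cells s).
Proof. by elim: s => // -[b|] s IH; rewrite /= -/(cells s); lia. Qed.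

(** Register 0 exchanges words with [consult], 2 is scratch, 6 holds the tape left of the head, 8
    the tape from the scanned cell on, 10 the state in unary, 12 a flag that is nonempty while the
    machine runs. Odd registers are left to variables. *)
Definition sim_regs (io tmp lb rb qb f : seq bool) : regs :=
  nth [::] [:: io; [::]; tmp; [::]; [::]; [::]; lb; [::]; rb; [::]; qb; [::]; f].

Ltac sim_regs_eq := apply: functional_extensionality; do 13 (case=> [//|]).

Lemma upd_sim_regs io tmp lb rb qb f x :
  (upd (sim_regs io tmp lb rb qb f) 0 x = sim_regs x tmp lb rb qb f) *
  (upd (sim_regs io tmp lb rb qb f) 2 x = sim_regs io x lb rb qb f) *
  (upd (sim_regs io tmp lb rb qb f) 6 x = sim_regs io tmp x rb qb f) *
  (upd (sim_regs io tmp lb rb qb f) 8 x = sim_regs io tmp lb x qb f) *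
  (upd (sim_regs io tmp lb rb qb f) 10 x = sim_regs io tmp lb rb x f) *
  (upd (sim_regs io tmp lb rb qb f) 12 x = sim_regs io tmp lb rb qb x).
Proof. by do 5?split; sim_regs_eq. Qed.

Lemma idle_sim_regs io lb rb qb f : idle (sim_regs io [::] lb rb qb f).
Proof.
split=> // [v|j lej]; last by rewrite /sim_regs nth_default //= /work; lia.
by rewrite /var; do 7 (case: v => [//|v]); rewrite /sim_regs nth_default.
Qed.

Lemma sizes_le_sim_regs io tmp lb rb qb f Z : size io <= Z -> size tmp <= Z -> size lb <= Z ->
  size rb <= Z -> size qb <= Z -> size f <= Z -> sizes_le (sim_regs io tmp lb rb qb f) Z.
Proof. by move=> *; do 13 (case=> [//|]); move=> i; rewrite /sim_regs nth_default. Qed.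

Definition push_cell r (a : sym) :=
  pushes (if a is Some b then [:: (r, b); (r, true)] else [:: (r, false)]).
Definition set_state q := pushes (nseq q (10, true)).
(** The scanned cell must be present explicitly, as [case_cell] expects a code on top; when the list
    has run out, a blank is supplied. *)
Definition fill := reg_if 8 isSome Skip (push 8 false).
Definition case_cell r (k : sym -> prog) := reg_if r (pred1 (Some true))
  (Seq (pop r) (reg_if r (pred1 (Some true)) (Seq (pop r) (k (Some true)))
                                             (Seq (pop r) (k (Some false)))))
  (Seq (pop r) (k None)).
Definition decode := Seq (reg_while 8 (pred1 (Some true)) (Seq (pop 8)
    (if_top 8 (Seq (pop 8) (push 2 true)) (Seq (pop 8) (push 2 false)))))
  (move_rev 2 0).
(** The bit is pushed before its tag [true], so that the tag comes out first, as in [cell]. *)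
Definition insert :=
  Seq (move_rev 0 2) (Seq (drain 2 (fun b => [:: (8, b); (8, true)])) fill).

(** A jump table indexed in unary: the selected program starts with register 10 empty and can write
    the next state there. *)
Fixpoint dispatch (ps : seq prog) :=
  if ps is p :: ps' then reg_if 10 isSome (Seq (pop 10) (dispatch ps')) p else Skip.

Definition filled (s : seq sym) := head None s :: behead s.

Section Sim.
Variable ok : oracle -> Prop.

Lemma maps_case_cell A (Pre : A -> Prop) from r k to (h : A -> sym) rest :
  (forall g a, ok g -> Pre a -> from g a r = cell (h a) ++ rest g a) ->
  (forall x, maps ok (fun a => Pre a /\ h a = x) (fun g a => upd (from g a) r (rest g a))
     (k x) to) ->
  maps ok Pre from (case_cell r k) to.
Proof.
move=> fE H.
have popE g a : ok g -> Pre a -> forall n, n <= size (cell (h a)) ->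
    upd (from g a) r (drop n (cell (h a)) ++ rest g a) =
    upd (from g a) r (drop n (from g a r)).
  by move=> og Pa n len; rewrite fE // drop_cat; case: ltngtP len => // -> _;
     rewrite subnn drop0 drop_size.
apply: (@maps_if ok A Pre from r _ (fun a => h a != None)).
- by move=> g a og Pa; rewrite /top fE //; case: (h a).
- apply: (maps_seq (mid := fun g a =>
    upd (from g a) r (drop 1 (cell (h a)) ++ rest g a))).
    apply: maps_does (does_pop ok r) _ _ => g a og [Pa ha]; first by rewrite fE; case: (h a) ha.
    by rewrite popE ?drop1 //; case: (h a).
  apply: (@maps_if ok A _ _ r _ (fun a => h a == Some true)).
  + by move=> g a og [Pa ha]; rewrite /top updE; case: (h a) ha => [[]|].
  + apply: (maps_seq (mid := fun g a => upd (from g a) r (rest g a))).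
      apply: maps_does (does_pop ok r) _ _ => g a og [[Pa ha] _]; rewrite updE ?updK.
        by case: (h a) ha.
      by case: (h a) ha.
    apply: maps_ext (H (Some true)) _ _ _ => // a [[Pa _] /eqP] //.
  + apply: (maps_seq (mid := fun g a => upd (from g a) r (rest g a))).
      apply: maps_does (does_pop ok r) _ _ => g a og [[Pa ha] _]; rewrite updE ?updK.
        by case: (h a) ha.
      by case: (h a) ha.
    by apply: maps_ext (H (Some false)) _ _ _ => // a [[Pa]]; case: (h a) => [[]|].
apply: (maps_seq (mid := fun g a => upd (from g a) r (rest g a))).
  apply: maps_does (does_pop ok r) _ _ => g a og [Pa]; rewrite fE //; case: (h a) => //.
by apply: maps_ext (H None) _ _ _ => // a [Pa]; case: (h a).
Qed.

Lemma maps_dispatch A (Pre : A -> Prop) (n : A -> nat) base to ps :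
  (forall g a, ok g -> Pre a -> base g a 10 = [::]) ->
  (forall a, Pre a -> n a < size ps) ->
  (forall i, i < size ps -> maps ok (fun a => Pre a /\ n a = i) base (nth Skip ps i) to) ->
  maps ok Pre (fun g a => upd (base g a) 10 (nseq (n a) true)) (dispatch ps) to.
Proof.
elim: ps Pre n => [|p ps IH] Pre n b0 ltn H.
  by exists 0 => g a Z _ /ltn.
apply: (@maps_if ok _ _ _ _ _ (fun a => n a != 0)).
- by move=> g a _ _; rewrite /top updE; case: (n a).
- apply: (maps_seq (mid := fun g a => upd (base g a) 10 (nseq (n a).-1 true))).
    apply: maps_does (does_pop ok _) _ _ => g a og [Pa na]; rewrite updE ?updK.
      by case: (n a) na.
    by case: (n a) na.
  apply: (IH _ (fun a => (n a).-1)) => [g a og [Pa _]|a [/ltn]|i lti]; first exact: b0.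
    by rewrite /=; lia.
  by apply: maps_ext (H i.+1 _) _ _ _ => // a [[Pa na] <-]; split=> //; rewrite prednK // lt0n.
apply: maps_ext (H 0 isT) _ _ _ => // [a [Pa /negPn/eqP]|g a og [Pa /negPn/eqP ->]] //.
by rewrite -[nseq 0 true]/[::] -(b0 g a og Pa) upd_id.
Qed.

Lemma does_push_cell r a : does ok (fun=> True) (push_cell r a)
  (fun _ s => upd s r (cell a ++ s r)).
Proof.
apply: does_ext (does_pushes ok _) _ _ => // g s _ _.
apply: functional_extensionality => i; rewrite /upd /sent eq_sym.
by case: a => [b|] /=; rewrite eq_sym; case: eqP => [->|].
Qed.

Lemma does_set_state q : does ok (fun=> True) (set_state q)
  (fun _ s => upd s 10 (nseq q true ++ s 10)).
Proof.
apply: does_ext (does_pushes ok _) _ _ => // g s _ _.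
apply: functional_extensionality => i; rewrite /upd /sent filter_nseq map_nseq rev_nseq /=.
by case: (eqVneq i 10) => [->|]; rewrite ?mul1n // eq_sym => /negbTE ->.
Qed.

Lemma does_fill : does ok (fun=> True) fill
  (fun _ s => upd s 8 (if nilp (s 8) then [:: false] else s 8)).
Proof.
apply: does_if.
  apply: does_ext (does_skip ok) _ _ => // g s _ [_]; rewrite /top.
  by case E: (s 8) => [//|b w] _; rewrite /= -E upd_id.
apply: does_ext (does_push ok 8 false) _ _ => // g s _ [_]; rewrite /top.
by case: (s 8).
Qed.

Lemma cells_filled s : (if nilp (cells s) then [:: false] else cells s) = cells (filled s).
Proof. by case: s => [|[b|] s]. Qed.

Lemma read_wordE (s : seq sym) :
  s = map Some (read_word s) ++ drop (size (read_word s)) s.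
Proof. by elim: s => [|[b|] s IH] //=; rewrite -IH. Qed.

Lemma cells_read_word s :
  ~~ pred1 (Some true) (ohead (cells (drop (size (read_word s)) s))).
Proof. by elim: s => [|[b|] s IH]. Qed.

Lemma maps_decode A (Pre : A -> Prop) lb (rr : oracle -> A -> seq sym) qb f :
  maps ok Pre (fun g a => sim_regs [::] [::] (lb g a) (cells (rr g a)) (qb g a) (f g a)) decode
    (fun g a => let w := read_word (rr g a) in
       sim_regs w [::] (lb g a) (cells (drop (size w) (rr g a))) (qb g a) (f g a)).
Proof.
pose mid g a := let w := read_word (rr g a) in
  sim_regs [::] (rev w) (lb g a) (cells (drop (size w) (rr g a))) (qb g a) (f g a).
apply: (maps_seq (mid := mid)); last first.
  apply: maps_does (does_move_rev ok (r := 2) (t := 0) isT) _ _ => // g a _ _.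
  by rewrite /mid !upd_sim_regs /= revK cats0.
pose B := (seq bool * seq bool * bool * seq sym * seq bool * seq bool)%type.
pose fromB (_ : oracle) (x : B) := let: (t, l, b, r, q, h) := x in
  sim_regs [::] t l (cells (Some b :: r)) q h.
pose toB (_ : oracle) (x : B) := let: (t, l, b, r, q, h) := x in
  sim_regs [::] (b :: t) l (cells r) q h.
apply: (@maps_while ok A B Pre (fun=> True) _ fromB _ toB _ _ _ id) => [||g a Z og _ bZ].
- apply: (maps_seq (mid := fun _ (x : B) => let: (t, l, b, r, q, h) := x in
    sim_regs [::] t l (b :: cells r) q h)).
    by apply: maps_does (does_pop ok 8) _ _ => g [[[[[t l] b] r] q] h] _ _; rewrite
      ?upd_sim_regs.
  apply: (@maps_if ok B _ _ _ _ (fun x : B => x.1.1.1.2)).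
  + by move=> g [[[[[t l] []] r] q] h].
  + apply: (maps_seq (mid := fun _ (x : B) => let: (t, l, b, r, q, h) := x in
      sim_regs [::] t l (cells r) q h)).
      by apply: maps_does (does_pop ok 8) _ _ => g [[[[[t l] b] r] q] h] _ _; rewrite
        ?upd_sim_regs.
    apply: maps_does (does_push ok 2 true) _ _ => // g [[[[[t l] b] r] q] h] _ /= [_ ->].
    by rewrite upd_sim_regs.
  + apply: (maps_seq (mid := fun _ (x : B) => let: (t, l, b, r, q, h) := x in
      sim_regs [::] t l (cells r) q h)).
      by apply: maps_does (does_pop ok 8) _ _ => g [[[[[t l] b] r] q] h] _ _; rewrite
        ?upd_sim_regs.
    apply: maps_does (does_push ok 2 false) _ _ => // g [[[[[t l] b] r] q] h] _ /= [_].
    by case: b => // _; rewrite upd_sim_regs.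
- exact: poly_bounded_id.
set w := read_word (rr g a).
have rE := read_wordE (rr g a); have tE := cells_read_word (rr g a); rewrite -/w in rE tE.
have szr : size (cells (rr g a)) <= Z := bZ 8.
have szw : size w <= Z.
  apply: leq_trans szr; apply: leq_trans (size_le_cells _).
  by rewrite rE size_cat size_map leq_addr.
exists (size w), (fun j => sim_regs [::] (rev (take j w)) (lb g a) (cells (drop j (rr g a)))
  (qb g a) (f g a)).
split=> //.
- by rewrite take0 drop0 take_size.
- move=> j _; apply: sizes_le_sim_regs => //; try exact: (bZ 6); try exact: (bZ 10); try
  exact: (bZ 12).
    by rewrite size_rev size_take_min; lia.
  apply: leq_trans szr; rewrite -{2}(cat_take_drop j (rr g a)) cells_cat size_cat.
  exact: leq_addl.
move=> j ltj.
have dE : drop j (rr g a) = Some (nth true w j) :: drop j.+1 (rr g a).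
  have szE : size (rr g a) = size w + size (drop (size w) (rr g a)).
    by rewrite {1}rE size_cat size_map.
  rewrite (@drop_nth _ None); last by rewrite szE ltn_addr.
  by congr cons; rewrite {1}rE nth_cat size_map ltj (nth_map true).
split; first by rewrite dE.
exists (rev (take j w), lb g a, nth true w j, drop j.+1 (rr g a), qb g a, f g a).
by split=> //=; rewrite ?dE // (take_nth true) // rev_rcons.
Qed.

Lemma maps_insert A (Pre : A -> Prop) w lb (rr : oracle -> A -> seq sym) qb f :
  maps ok Pre (fun g a => sim_regs (w g a) [::] (lb g a) (cells (rr g a)) (qb g a) (f g a))
    insert
    (fun g a => sim_regs [::] [::] (lb g a) (cells (filled (map Some (w g a) ++ rr g a)))
       (qb g a) (f g a)).
Proof.
apply: (maps_seq (mid := fun g a =>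
    sim_regs [::] (rev (w g a)) (lb g a) (cells (rr g a)) (qb g a) (f g a))).
  apply: maps_does (does_move_rev ok (r := 0) (t := 2) isT) _ _ => // g a _ _.
  by rewrite !upd_sim_regs /= cats0.
apply: (maps_seq (mid := fun g a =>
    sim_regs [::] [::] (lb g a) (cells (map Some (w g a) ++ rr g a)) (qb g a) (f g a))).
  have H b : 2 \notin map fst [:: (8, b); (8, true)] by [].
  apply: maps_does (does_drain ok H) _ _ => // g a _ _.
  have sE i : i != 8 -> flatten [seq sent [:: (8, b); (8, true)] i | b <- rev (w g a)] = [::].
    by rewrite /sent /= eq_sym => /negbTE ->; elim: (rev _).
  apply: functional_extensionality => i; case: (eqVneq i 8) => [->|ne].
    rewrite /= cells_cat; congr (_ ++ _).
    elim: (w g a) => // b v IH; rewrite rev_cons map_rcons flatten_rcons rev_cat IH //.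
  rewrite sE //; move: i ne; do 13 (case=> [//|]); move=> i _.
  by rewrite /sim_regs !nth_default.
apply: maps_does does_fill _ _ => // g a _ _.
by rewrite upd_sim_regs /= cells_filled.
Qed.

End Sim.

Definition move_prog (s : sym) (m : move) : prog :=
  match m with
  | MoveL => Seq (push_cell 8 s)
      (reg_if 6 isSome (case_cell 6 (push_cell 8)) (push_cell 8 None))
  | MoveR => Seq (push_cell 6 s) fill
  | Stay => push_cell 8 s
  end.

Definition ask pre post := Seq decode (Seq (consult pre post) insert).

Section Simulation.
Variables (M : TM) (pre post : term) (ok : oracle -> Prop).
Hypothesis short_reply :
  exists c, forall g w, ok g -> size (g (question pre w)) <= pbound c (size w).
Hypothesis short_answer : forall g w, ok g -> size (answer pre post g w) <= (size w).+1.

Local Notation answer := (answer pre post).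

(** The state after a query depends on the symbol scanned before it. The symbol is therefore read,
    put back and its successor state recorded before the word is replaced. *)
Definition state_prog (q : 'I_(tm_n M).+1) : prog :=
  if tm_halt M q then pop 12 else
  if tm_query M q then
    Seq (case_cell 8 (fun x => Seq (push_cell 8 x) (set_state (tm_delta M q x).1.1)))
        (ask pre post)
  else case_cell 8 (fun x => let: (q', s, m) := tm_delta M q x in
    Seq (move_prog s m) (set_state q')).

Definition step_prog :=
  dispatch (mkseq (fun i => state_prog (inord i)) (tm_n M).+1).

Definition state_of (c : config M) := c.1.1.1.
Definition left_of (c : config M) := c.1.1.2.
Definition head_of (c : config M) := c.1.2.
Definition right_of (c : config M) := c.2.

Definition config_regs (c : config M) (q : nat) (f : bool) :=
  sim_regs [::] [::] (cells (left_of c)) (cells (head_of c :: right_of c)) (nseq q true)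
    (nseq f true).

(** A halting state takes one further round, which empties the flag; the state number is then 0
    because [dispatch] has consumed register 10. *)
Definition next (g : oracle) (c : config M) : regs :=
  if halted c then config_regs c 0 false
  else let c' := step (answer g) c in config_regs c' (state_of c') true.

Lemma haltedE (c : config M) : halted c = tm_halt M (state_of c).
Proof. by case: c => [[[]]]. Qed.

Lemma maps_push_cell A (Pre : A -> Prop) from r a to :
  (forall g x, ok g -> Pre x -> upd (from g x) r (cell a ++ from g x r) = to g x) ->
  maps ok Pre from (push_cell r a) to.
Proof. by move=> H; apply: maps_does (does_push_cell ok r a) _ _. Qed.

Lemma maps_set_state A (Pre : A -> Prop) from q to :
  (forall g x, ok g -> Pre x -> upd (from g x) 10 (nseq q true ++ from g x 10) = to g x) ->
  maps ok Pre from (set_state q) to.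
Proof. by move=> H; apply: maps_does (does_set_state ok q) _ _. Qed.

Lemma maps_move q s m x : ~~ tm_halt M q -> ~~ tm_query M q ->
  forall q', tm_delta M q x = (q', s, m) ->
  maps ok (fun c => state_of c = q /\ head_of c = x)
    (fun _ c => sim_regs [::] [::] (cells (left_of c)) (cells (right_of c)) [::] [:: true])
      (move_prog s m)
    (fun g c => config_regs (step (answer g) c) 0 true).
Proof.
move=> nh nq q' dE; case: m dE => dE.
- apply: (maps_seq (mid := fun _ c =>
    sim_regs [::] [::] (cells (left_of c)) (cells (s :: right_of c)) [::] [:: true])).
    by apply: maps_push_cell => g c _ _; rewrite upd_sim_regs.
  apply: (@maps_if ok _ _ _ _ _ (fun c => left_of c != [::])).
  + by move=> g [[[? l] ?] ?] _ _ /=; case: l => [|[]].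
  + apply: (maps_case_cell (h := fun c => head None (left_of c)) (rest := fun _ c => cells
    (behead (left_of c)))).
      by move=> g [[[? l] ?] ?] _ /= [_]; case: l.
    move=> y; apply: maps_push_cell => g c _; rewrite !upd_sim_regs /config_regs.
    case: c => [[[q1 l] h] r] /= [[[E1 E2] /= nl] hy]; rewrite /= /state_of /head_of /left_of
      /= in E1 E2 nl hy.
    rewrite E1 (negbTE nh) (negbTE nq) E2 dE.
    by case: l nl hy => //= a l _ ->.
  + apply: maps_push_cell => g c _; rewrite !upd_sim_regs /config_regs.
    case: c => [[[q1 l] h] r] /= [[E1 E2] nl]; rewrite /state_of /head_of /left_of /= in E1
      E2 nl.
    rewrite /= E1 (negbTE nh) (negbTE nq) E2 dE.
    by case: l nl.
- apply: (maps_seq (mid := fun _ c =>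
    sim_regs [::] [::] (cells (s :: left_of c)) (cells (right_of c)) [::] [:: true])).
    by apply: maps_push_cell => g c _ _; rewrite upd_sim_regs.
  apply: maps_does (does_fill _) _ _ => // g [[[q1 l] h] r] _ [E1 E2].
  rewrite /state_of /head_of /= in E1 E2; rewrite upd_sim_regs /= cells_filled E1 (negbTE nh)
    (negbTE nq) E2 dE.
  by case: r.
apply: maps_push_cell => g [[[q1 l] h] r] _ [E1 E2].
rewrite /state_of /head_of /= in E1 E2; rewrite upd_sim_regs /= E1 (negbTE nh) (negbTE nq) E2
  dE.
by [].
Qed.

Lemma maps_ask q : ~~ tm_halt M q -> tm_query M q ->
  maps ok (fun c => state_of c = q)
    (fun _ c => config_regs c (tm_delta M q (head_of c)).1.1 true) (ask pre post)
    (fun g c => let c' := step (answer g) c in config_regs c' (state_of c') true).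
Proof.
move=> nh yq.
apply: (maps_seq (mid := fun g c => let w := read_word (head_of c :: right_of c) in
  sim_regs w [::] (cells (left_of c)) (cells (drop (size w) (head_of c :: right_of c)))
     (nseq (tm_delta M q (head_of c)).1.1 true) [:: true])).
  exact: (maps_decode ok _ (fun _ c => cells (left_of c)) (fun _ c => head_of c :: right_of c)
    (fun _ c => nseq (tm_delta M q (head_of c)).1.1 true) (fun _ _ => [:: true])).
apply: (maps_seq (mid := fun g c => let w := read_word (head_of c :: right_of c) in
  sim_regs (answer g w) [::] (cells (left_of c)) (cells (drop (size w) (head_of c :: right_of
    c)))
     (nseq (tm_delta M q (head_of c)).1.1 true) [:: true])).
  apply: maps_does (does_consult post short_reply) _ _ => g c _ _; first exact: idle_sim_regs.
  by rewrite upd_sim_regs.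
apply: maps_ext (maps_insert ok (fun c => state_of c = q) (fun g c => answer g (read_word
  (head_of c :: right_of c)))
  (fun _ c => cells (left_of c))
  (fun _ c => drop (size (read_word (head_of c :: right_of c))) (head_of c :: right_of c))
  (fun _ c => nseq (tm_delta M q (head_of c)).1.1 true) (fun _ _ => [:: true])) _ _ _ => //.
move=> g [[[q1 l] h] r] _; rewrite /state_of /= => ->.
by rewrite (negbTE nh) yq.
Qed.

Lemma maps_state q : maps ok (fun c => state_of c = q) (fun _ c => config_regs c 0 true)
  (state_prog q) next.
Proof.
rewrite /state_prog; case: ifPn => [hq|nh].
  apply: maps_does (does_pop ok 12) _ _ => // g c _ E.
  by rewrite /next haltedE E hq upd_sim_regs.
have nextE g c : state_of c = q -> next g c = let c' := step (answer g) c in config_regs c'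
  (state_of c') true.
  by rewrite /next haltedE => ->; rewrite (negbTE nh).
case: ifPn => [yq|nq].
  apply: maps_seq (maps_ext (maps_ask nh yq) _ _ _); last first.
  - by move=> g c _ /nextE ->.
  - by move=> g c _ _; reflexivity.
  - by move=> c; apply.
  apply: (maps_case_cell (h := head_of) (rest := fun _ c => cells (right_of c))) => // x.
  apply: (maps_seq (mid := fun _ c => config_regs c 0 true)).
    by apply: maps_push_cell => g c _ [_ <-]; rewrite !upd_sim_regs.
  by apply: maps_set_state => g c _ [_ <-]; rewrite upd_sim_regs cats0.
apply: (maps_case_cell (h := head_of) (rest := fun _ c => cells (right_of c))) => // x.
case dE: (tm_delta M q x) => [[q' s] m].
apply: (maps_seq (mid := fun g c => config_regs (step (answer g) c) 0 true)).
  by apply: maps_ext (maps_move nh nq dE) _ _ _ => // g c _ _; rewrite upd_sim_regs.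
apply: maps_set_state => g c _ [E1 E2]; rewrite nextE // upd_sim_regs cats0 /config_regs.
suff -> : state_of (step (answer g) c) = q' by [].
move: E1 E2; case: c => [[[q1 l] h] r]; rewrite /state_of /head_of /= => -> ->.
by rewrite (negbTE nh) (negbTE nq) dE; case: m {dE} => //=; [case: l|case: r].
Qed.

Lemma maps_step : maps ok (fun=> True) (fun _ c => config_regs c (state_of c) true) step_prog
  next.
Proof.
apply: maps_ext (@maps_dispatch ok _ (fun=> True) (fun c => state_of c)
  (fun _ c => config_regs c 0 true) next _ _ _ _) _ _ _ => //.
- by move=> c _; rewrite size_mkseq.
- move=> i; rewrite size_mkseq => lti; rewrite nth_mkseq //.
  apply: maps_ext (maps_state (inord i)) _ _ _ => // c [_ E].
  by apply: val_inj; rewrite /= inordK.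
by move=> g c _ _; rewrite upd_sim_regs.
Qed.

Definition cells_used (c : config M) := size (left_of c) + size (head_of c :: right_of c).

(** A query trades the word read for one at most one bit longer, so no single step, query or move,
    adds more than one cell, and the tape stays linear in the number of steps. *)
Lemma cells_used_step g c : ok g -> cells_used (step (answer g) c) <= (cells_used c).+1.
Proof.
move=> og; case: c => [[[q l] h] r]; rewrite /cells_used /=; case: ifP => //= _.
case: ifP => _; last first.
  by case: (tm_delta M q h) => [[q' s] []] /=; [case: l|case: r|] => *; rewrite /left_of
    /head_of /right_of /=; lia.
rewrite /left_of /head_of /right_of /= size_behead size_cat size_map.
have E := congr1 size (read_wordE (h :: r)); rewrite size_cat size_map /= in E.
have := short_answer (read_word (h :: r)) og; rewrite /= in E *; lia.
Qed.

Lemma size_iter_step g j x : ok g ->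
  cells_used (iter j (@step M (answer g)) (init M x)) <= size x + 1 + j.
Proof.
move=> og; elim: j => [|j IH]; last first.
  by apply: leq_trans (cells_used_step _ og) _; rewrite addnS ltnS.
by rewrite /cells_used /left_of /head_of /right_of /= size_behead size_map; case: x => //= a
  x; lia.
Qed.

Lemma maps_main c : maps ok
  (fun x => forall g, ok g -> halted (run M (answer g) (pbound c (size x)) x))
  (fun _ x => config_regs (init M x) (tm_start M) true) (reg_while 12 isSome step_prog)
  (fun g x => config_regs (run M (answer g) (pbound c (size x)) x) 0 false).
Proof.
pose f Z := 2 * (Z + 1 + ((pbound c Z) + 1)) + (tm_n M + 2).
apply: (@maps_while ok _ _ _ _ _ _ _ _ _ _ _ f maps_step).
  by rewrite /f; poly_bounded_tac.
move=> g x Z og hx bZ; have {}hx := hx g og.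
have szx : size x <= Z.
  have := bZ 8; apply: leq_trans; apply: leq_trans (size_le_cells _).
  by rewrite /= size_behead size_map; case: (size x).
pose rn j := iter j (@step M (answer g)) (init M x).
(* The loop ends at the first halting time, possibly before the time allowed; both give the same
   configuration. *)
have [t0 ht0 min] := ex_minnP (ex_intro (fun j => halted (rn j)) _ hx).
have let0 : t0 <= pbound c (size x) by apply: min.
have runE : run M (answer g) (pbound c (size x)) x = rn t0.
  by rewrite /run -(subnK let0) iterD iter_step_halted.
have lef : t0 <= pbound c Z by apply: leq_trans let0 (leq_pbound _ _).
(* The last of the [t0.+1] rounds clears the flag and does not move the simulated machine. *)
pose S j := if j <= t0 then config_regs (rn j) (state_of (rn j)) true else config_regs (rn
  t0) 0 false.
exists t0.+1, S; split.
- by rewrite /f; lia.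
- by rewrite /S ltnn runE.
- by rewrite /S ltnn.
- move=> j _; rewrite /S.
  have szst i q b : i <= t0 -> q <= tm_n M -> sizes_le (config_regs (rn i) q b) (f Z).
    move=> lei leq; have := size_iter_step i x og; rewrite /cells_used -/(rn i) => szi.
    have h1 := size_cells (left_of (rn i)); have h2 := size_cells (head_of (rn i) :: right_of
      (rn i)).
    rewrite /f; apply: sizes_le_sim_regs; rewrite ?size_nseq //; lia.
  by case: ifP => lej; apply: szst => //; rewrite -ltnS.
move=> j; rewrite ltnS => lej; split; first by rewrite /S lej.
exists (rn j); split=> //; rewrite /S ?lej // /next.
case: (ltngtP j t0) lej => // [ltj _|-> _]; last by rewrite ht0.
by case: ifP => // /min; rewrite leqNgt ltj.
Qed.

Definition sim_prog := Seq insert (Seq (set_state (tm_start M)) (Seq (push 12 true)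
  (Seq (reg_while 12 isSome step_prog) decode))).

Lemma maps_sim c : maps ok
  (fun x => forall g, ok g -> halted (run M (answer g) (pbound c (size x)) x))
  (fun _ x => sim_regs x [::] [::] [::] [::] [::]) sim_prog
  (fun g x => let c' := run M (answer g) (pbound c (size x)) x in
     let w := read_word (head_of c' :: right_of c') in
     sim_regs w [::] (cells (left_of c')) (cells (drop (size w) (head_of c' :: right_of c')))
       [::] [::]).
Proof.
apply: (maps_seq (mid := fun _ x =>
  sim_regs [::] [::] [::] (cells (filled (map Some x))) [::] [::])).
  apply: maps_ext (maps_insert ok (fun x => forall g, ok g ->
    halted (run M (answer g) (pbound c (size x)) x)) (fun _ x => x) (fun _ _ => [::]) (fun _
      _ => [::])
    (fun _ _ => [::]) (fun _ _ => [::])) _ _ _ => // g x _ _.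
  by rewrite cats0.
apply: (maps_seq (mid := fun _ x => config_regs (init M x) (tm_start M) false)).
  by apply: maps_set_state => g x _ _; rewrite upd_sim_regs cats0.
apply: (maps_seq (mid := fun _ x => config_regs (init M x) (tm_start M) true)).
  by apply: maps_does (does_push ok 12 true) _ _ => // g x _ _; rewrite upd_sim_regs.
apply: maps_seq (maps_main c) _.
exact: (maps_decode ok _ (fun g x => cells (left_of (run M (answer g) (pbound c (size x)) x)))
  (fun g x => let c' := run M (answer g) (pbound c (size x)) x in head_of c' :: right_of c')
  (fun _ _ => [::]) (fun _ _ => [::])).
Qed.

End Simulation.

(** The machine for the source problem is simulated with the composed oracle [answer pre post g]. By
    the third premise this is a correct oracle for the source, so the machine halts within its own
    bound and decides the language. All constants are chosen before [g]. *)
Theorem NPhard_transfer (okS okT : oracle -> Prop) pre post :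
  (exists c, forall g w, okT g -> size (g (question pre w)) <= pbound c (size w)) ->
  (forall g w, okT g -> size (answer pre post g w) <= (size w).+1) ->
  (forall g, okT g -> okS (answer pre post g)) ->
  NPhard_search okS -> NPhard_search okT.
Proof.
move=> short_reply short_answer transfer hardS L /hardS[M [c H]].
have [e He] := maps_sim M short_reply short_answer c.
exists (prog_TM (code (sim_prog M pre post) 0)), e => g og x.
have halts x' g' : okT g' -> halted (run M (answer pre post g') (pbound c (size x')) x').
  by move=> og'; have [] := H _ (transfer _ og') x'.
have bx : sizes_le (sim_regs x [::] [::] [::] [::] [::]) (size x) by apply: sizes_le_sim_regs.
have [r _] := He g x (size x) og (halts x) bx.
have hx : holds (sim_regs x [::] [::] [::] [::] [::]) (scat (map Some x) blanks).
  exists 1; split; first by case=> // j _; do 12 (case: j => [//|j]); rewrite /sim_regs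
    nth_default.
  by rewrite /sects /mkseq /= sections_cons scons_blanks.
have [r' [m lem ex] h'] := r _ hx.
have [post' [rE _]] := holds_at 0 h'.
rewrite rE in ex; have [hl oE] := exec_run ex lem.
have [_ [b [bE bL]]] := H _ (transfer _ og) x.
split; first exact: hl.
exists b; split; last exact: bL.
apply: etrans oE _; rewrite -bE -/(pbound c (size x)).
by case: (run _ _ _ _) => [[[q l] h] t].
Qed.

(** * The TAP instance of a list of numbers *)

Lemma over_tails_iota f l :
  over_tails f l = flatten [seq f (drop (size l - t) l) | t <- iota 0 (size l)].
Proof.
elim: l => // a l IH; rewrite [LHS]/= IH.
have -> : iota 0 (size (a :: l)) = iota 0 (size l) ++ [:: size l] by rewrite -[size (_ ::
  _)]addn1 iotaD.
rewrite map_cat flatten_cat /= cats0 subSnn drop1; congr (flatten _ ++ _).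
by apply/eq_in_map => t; rewrite mem_iota => /andP[_ lt]; rewrite subSn //= ltnW.
Qed.

Lemma eval_for v a b rho F :
  (forall x, size x < size (eval a rho) -> eval b (upd rho v x) = F (size x)) ->
  eval (For v a b) rho = flatten [seq F t | t <- iota 0 (size (eval a rho))].
Proof.
move=> H; rewrite /= over_tails_iota; congr flatten; apply/eq_in_map => t.
rewrite mem_iota => /andP[_ lt]; rewrite H size_drop ?subKn //; lia.
Qed.

Lemma flatten_nseq (I : Type) (p : I -> nat) s :
  flatten [seq nseq (p i) 0 | i <- s] = nseq (sumn [seq p i | i <- s]) 0.
Proof. by elim: s => //= i s ->; rewrite nseqD. Qed.

Lemma sumn_map_bool (I : Type) (p : pred I) s : sumn [seq (p i : nat) | i <- s] = count p s.
Proof. by elim: s => //= i s ->. Qed.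

Lemma sumn_map_const (I : Type) n (s : seq I) : sumn [seq n | _ <- s] = size s * n.
Proof. by elim: s => //= i s ->; rewrite mulSn. Qed.

Definition unary n := iter n (Cat One) Nul.
Definition cats n (f : nat -> term) := foldr (fun i => Cat (f i)) Nul (iota 0 n).
Definition mulT e n := For 9 e (unary n).
Definition nthT n e := Untok (Drop n e).
Definition eqT a b := Ifn (Cat (Drop a b) (Drop b a)) Nul One.

Lemma eval_unary n rho : eval (unary n) rho = nseq n 0.
Proof. by elim: n => //= n ->. Qed.

Lemma eval_cats n f rho : eval (cats n f) rho = flatten [seq eval (f i) rho | i <- iota 0 n].
Proof. by rewrite /cats; elim: (iota 0 n) => //= i s ->. Qed.

Lemma eval_mulT e n rho : eval (mulT e n) rho = nseq (size (eval e rho) * n) 0.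
Proof.
rewrite (@eval_for _ _ _ _ (fun=> nseq n 0)) => [|x _]; last by rewrite eval_unary.
by rewrite flatten_nseq sumn_map_const size_iota.
Qed.

Lemma eval_nthT n e rho : eval (nthT n e) rho = nseq (nth 0 (eval e rho) (size (eval n rho))) 0.
Proof. by rewrite /= -nth0 nth_drop addn0. Qed.

Lemma eval_eqT a b rho :
  eval (eqT a b) rho = nseq (size (eval a rho) == size (eval b rho)) 0.
Proof.
rewrite /= (_ : nilp _ = (size (eval a rho) == size (eval b rho))).
  by case: eqP.
by rewrite /nilp size_cat !size_drop addn_eq0 !subn_eq0 eqn_leq andbC.
Qed.

Lemma evalE :
  (forall v rho, eval (Var v) rho = rho v) *
  (forall a b rho, eval (Cat a b) rho = eval a rho ++ eval b rho) *
  (forall a rho, eval (Tok a) rho = [:: size (eval a rho)]) *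
  (forall a b rho, eval (Drop a b) rho = drop (size (eval a rho)) (eval b rho)) *
  (forall a b c rho,
     eval (Ifn a b c) rho = if nilp (eval a rho) then eval c rho else eval b rho).
Proof. by []. Qed.

Section Terms.
Variable k : nat.

(** The tokens of an encoded instance are k, the k set sizes, the number of tuples, and then for
    each tuple its length k followed by its entries: a header of k + 2 tokens and blocks of k + 1
    tokens, the first of which is skipped. *)
Definition entry (v : seq nat) t i := nth 0 v (t * k.+1 + (k + 3 + i)).
Definition ntuples (v : seq nat) := nth 0 v k.+1.
(* A query failing this test is treated as an instance without tuples: the TAP oracle,
   whose answers are unconstrained elsewhere, must only see valid instances. *)
Definition malformed (v : seq nat) :=
  (size v < k.+2 + ntuples v * k.+1) ||
  has (fun i => has (fun t => k < count (fun t' => entry v t i == entry v t' i)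
    (iota 0 (ntuples v))) (iota 0 (ntuples v))) (iota 0 k).
Definition rows v := if malformed v then 0 else ntuples v.
(* Exceeds every entry, which saves computing with the sizes of the S_i; the larger
   range only adds uncovered elements. *)
Definition width (v : seq nat) :=
  (sumn [seq (nth 0 v (size v - t)).+1 | t <- iota 0 (size v)]).+1.

Definition entryT t i := nthT (Cat (mulT t k.+1) (unary (k + 3 + i))) (Var 0).
Definition ntuplesT := nthT (unary k.+1) (Var 0).
(** Lists serve as truth values, nonempty meaning true: [Drop] tests a strict inequality of lengths,
    [Cat] is disjunction and [For] an existential quantifier. *)
Definition malformedT :=
  Cat (Drop (Var 0) (Cat (unary k.+2) (mulT ntuplesT k.+1)))
    (cats k (fun i => For 2 ntuplesT (Drop (unary k) (For 3 ntuplesT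
       (eqT (entryT (Var 2) i) (entryT (Var 3) i)))))).
Definition rowsT := Ifn malformedT Nul ntuplesT.
Definition widthT := Cat One (For 2 (Var 0) (Cat One (Untok (Var 2)))).

Lemma eval_entryT t i rho :
  eval (entryT t i) rho = nseq (entry (rho 0) (size (eval t rho)) i) 0.
Proof. by rewrite eval_nthT !evalE size_cat eval_mulT eval_unary !size_nseq. Qed.

Lemma eval_ntuplesT rho : eval ntuplesT rho = nseq (ntuples (rho 0)) 0.
Proof. by rewrite eval_nthT eval_unary size_nseq. Qed.

Lemma nilp_flatten (T : Type) (f : T -> seq nat) (p : pred T) s :
  (forall x, nilp (f x) = ~~ p x) -> nilp (flatten (map f s)) = ~~ has p s.
Proof. by move=> H; elim: s => //= x s IH; rewrite /nilp size_cat addn_eq0 negb_or -IH -H. Qed.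

Lemma nilp_malformedT rho : nilp (eval malformedT rho) = ~~ malformed (rho 0).
Proof.
rewrite evalE /nilp size_cat addn_eq0 negb_or; congr (_ && _).
  rewrite evalE size_drop evalE size_cat eval_unary eval_mulT eval_ntuplesT !size_nseq.
  by rewrite subn_eq0 leqNgt.
rewrite eval_cats; apply: nilp_flatten => i.
rewrite (@eval_for _ _ _ _ (fun t => nseq (count (fun t' => entry (rho 0) t i ==
  entry (rho 0) t' i) (iota 0 (ntuples (rho 0))) - k) 0)) => [|x _].
  rewrite eval_ntuplesT size_nseq; apply: nilp_flatten => t.
  by rewrite /nilp size_nseq subn_eq0 leqNgt.
rewrite evalE eval_unary size_nseq (@eval_for _ _ _ _ (fun t' =>
  nseq (entry (rho 0) (size x) i == entry (rho 0) t' i) 0)) => [|y _].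
  by rewrite eval_ntuplesT flatten_nseq sumn_map_bool size_nseq drop_nseq.
by rewrite eval_eqT !eval_entryT !evalE !size_nseq.
Qed.

Lemma eval_rowsT rho : eval rowsT rho = nseq (rows (rho 0)) 0.
Proof.
by rewrite evalE nilp_malformedT eval_ntuplesT /rows; case: (malformed _).
Qed.

Lemma size_widthT rho : size (eval widthT rho) = width (rho 0).
Proof.
rewrite evalE size_cat add1n; congr _.+1; rewrite /= over_tails_iota size_flatten.
rewrite /shape -map_comp; congr sumn; apply: eq_map => t /=.
by rewrite size_nseq -nth0 nth_drop addn0.
Qed.

Definition span v := width v * k.
Definition spanT := mulT widthT k.

Lemma eval_spanT rho : eval spanT rho = nseq (span (rho 0)) 0.
Proof. by rewrite eval_mulT size_widthT. Qed.

Definition covered v a i := has (fun t => entry v t i == a) (iota 0 (rows v)).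
(* The element (a,i) has number [a * k + i]; its private red feature is
   [span v + (a * k + i)], which is a singleton exemplar when the element is covered. *)
Definition pad v a i :=
  if covered v a i then [:: span v + (a * k + i)] else [:: a * k + i; span v + (a * k + i)].
(** Feature numbers come in three ranges: blue below [span], the private red features in the next
    [span] numbers, and from twice [span] on a run of k - 1 red features for each tuple. *)
Definition member v t i :=
  entry v t i * k + i :: [seq span v + (span v + (t * k.-1 + j)) | j <- iota 0 k.-1].
Definition exemplars v :=
  [seq pad v a i | a <- iota 0 (width v), i <- iota 0 k] ++
  [seq member v t i | t <- iota 0 (rows v), i <- iota 0 k].
Definition gadget v :=
  TapInst (span v + (span v + rows v * k.-1)) (iota 0 (span v)) (exemplars v).

Definition blueT a i := Cat (mulT a k) (unary i).
Definition coveredT a i := For 3 rowsT (eqT (entryT (Var 3) i) a).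
Definition padT a i := Ifn (coveredT a i)
  (Cat (Tok (unary 1)) (Tok (Cat spanT (blueT a i))))
  (Cat (Tok (unary 2)) (Cat (Tok (blueT a i)) (Tok (Cat spanT (blueT a i))))).
Definition memberT t i := Cat (Tok (unary k)) (Cat (Tok (blueT (entryT t i) i))
  (cats k.-1 (fun j => Tok (Cat spanT (Cat spanT (Cat (mulT t k.-1) (unary j))))))).
Definition gadgetT :=
  Cat (Tok (Cat spanT (Cat spanT (mulT rowsT k.-1))))
  (Cat (Tok spanT) (Cat (For 2 spanT (Tok (Var 2)))
  (Cat (Tok (Cat spanT (mulT rowsT k)))
  (Cat (For 2 widthT (cats k (padT (Var 2)))) (For 2 rowsT (cats k (memberT (Var 2)))))))).

Arguments eval : simpl never.

Lemma eval_blueT a i rho : eval (blueT a i) rho = nseq (size (eval a rho) * k + i) 0.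
Proof. by rewrite evalE eval_mulT eval_unary nseqD. Qed.

Lemma nilp_coveredT x i rho : rho 2 = x ->
  nilp (eval (coveredT (Var 2) i) rho) = ~~ covered (rho 0) (size x) i.
Proof.
move=> E; rewrite (@eval_for _ _ _ _ (fun t => nseq (entry (rho 0) t i == size x) 0)) => [|y _].
  rewrite eval_rowsT size_nseq; apply: nilp_flatten => t.
  by rewrite /nilp size_nseq eqb0.
by rewrite eval_eqT !eval_entryT size_nseq -E.
Qed.

Lemma eval_padT x i rho : rho 2 = x ->
  eval (padT (Var 2) i) rho = size (pad (rho 0) (size x) i) :: pad (rho 0) (size x) i.
Proof.
move=> E; have : eval (blueT (Var 2) i) rho = nseq (size x * k + i) 0.
  by rewrite eval_blueT -E.
rewrite /padT; have := nilp_coveredT i E; have := eval_spanT rho.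
move: (blueT _ _) (coveredT _ _) spanT => B C S SE CE BE.
by rewrite evalE CE /pad; case: (covered _ _ _); rewrite /= !evalE ?size_cat SE BE ?size_nseq.
Qed.

Lemma eval_memberT x i rho : 0 < k -> rho 2 = x ->
  eval (memberT (Var 2) i) rho =
  size (member (rho 0) (size x) i) :: member (rho 0) (size x) i.
Proof.
move=> k0 E; have : eval (blueT (entryT (Var 2) i) i) rho =
    nseq (entry (rho 0) (size x) i * k + i) 0.
  by rewrite eval_blueT eval_entryT size_nseq -E.
rewrite /memberT; move: (blueT _ _) => B BE.
have := eval_unary k rho; move: (unary k) => K KE.
rewrite !evalE BE KE eval_cats !size_nseq.
rewrite /member /= size_map size_iota prednK //; congr [:: _, _ & _].
elim: (iota _ _) => //= j s ->; congr cons.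
by rewrite !evalE eval_spanT eval_mulT eval_unary !size_cat !size_nseq -E.
Qed.

Lemma size_exemplars v : size (exemplars v) = span v + rows v * k.
Proof. by rewrite size_cat !size_allpairs !size_iota. Qed.

Lemma eval_gadgetT rho : 0 < k -> enc_toks (eval gadgetT rho) = enc_tap (gadget (rho 0)).
Proof.
move=> k0; set v := rho 0.
have encT s : enc_toks (flatten [seq size E :: E | E <- s]) = flatten (map enc_seqn s).
  by elim: s => //= E s IH; rewrite -cat_cons enc_toks_cat IH.
suff -> : eval gadgetT rho = (span v + (span v + rows v * k.-1)) :: span v ::
    iota 0 (span v) ++ size (exemplars v) ::
    flatten [seq size E :: E | E <- exemplars v].
  rewrite /enc_tap /gadget /= /enc_seqseq /enc_seqn size_iota.
  rewrite -cat1s -[span v :: _]cat1s -[size _ :: _]cat1s !enc_toks_cat encT.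
  by rewrite /enc_toks /= !cats0 -!catA.
have hT : eval (For 2 spanT (Tok (Var 2))) rho = iota 0 (span v).
  rewrite (@eval_for _ _ _ _ (fun t => [:: t])) => [|x _]; last by rewrite !evalE updE.
  by rewrite eval_spanT size_nseq flatten_seq1.
have hcats (f : nat -> nat -> seq nat) (e : nat -> term) n a :
    size (eval a rho) = n -> (forall x i, eval (e i) (upd rho 2 x) = size (f (size x) i) :: f
      (size x) i) ->
    eval (For 2 a (cats k e)) rho =
    flatten [seq size E :: E | E <- [seq f t i | t <- iota 0 n, i <- iota 0 k]].
  move=> <- He; rewrite (@eval_for _ _ _ _ (fun t => flatten [seq size (f t i) :: f t i | i
    <- iota 0 k])).
    elim: (iota 0 (size _)) => //= t s ->; rewrite map_cat flatten_cat -map_comp.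
    by [].
  by move=> y _; rewrite eval_cats; congr flatten; apply: eq_map => i; rewrite He.
have hP := hcats (pad v) (padT (Var 2)) (width v) widthT (size_widthT rho) _.
have hM := hcats (member v) (memberT (Var 2)) (rows v) rowsT _ _.
rewrite /gadgetT.
rewrite 11!evalE hT hP; last by move=> x i; rewrite (@eval_padT x) ?updE.
rewrite hM; last 2 first.
- by rewrite eval_rowsT size_nseq.
- by move=> x i; rewrite (@eval_memberT x) ?updE.
rewrite eval_spanT !eval_mulT eval_rowsT size_exemplars !size_cat !size_nseq.
by rewrite /exemplars map_cat flatten_cat.
Qed.

(** The first token of a reply is the length of the solution; only the tokens after it are exemplar
    indices. *)
Definition touched v (ans : seq nat) t :=
  has (fun j => has (fun i => j == span v + (t * k + i)) (iota 0 k)) (behead ans).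
Definition clash v t t' := has (fun i => entry v t i == entry v t' i) (iota 0 k).
(** A tuple is compared with all earlier touched tuples, kept or not. Unlike a greedy choice this
    refers to no earlier decision, so a comprehension expresses it, and the counting of new elements
    needs nothing finer. *)
Definition kept v ans := [seq t <- iota 0 (rows v) |
  touched v ans t && ~~ has (fun t' => touched v ans t' && clash v t t') (iota 0 t)].

Definition touchedT t := For 4 (Var 1) (cats k (fun i =>
  eqT (Untok (Var 4)) (Cat spanT (blueT t i)))).
Definition clashT t t' := cats k (fun i => eqT (entryT t i) (entryT t' i)).
Definition keptT := For 2 rowsT (Ifn (touchedT (Var 2))
  (Ifn (For 3 (Var 2) (Ifn (touchedT (Var 3)) (clashT (Var 2) (Var 3)) Nul)) Nul
     (Tok (Var 2))) Nul).
Definition replyT := Cat (Tok keptT) keptT.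

Lemma span_gt0 v : 0 < k -> 0 < span v.
Proof. by rewrite /span muln_gt0 => ->. Qed.

Lemma nilp_touchedT u x rho : 0 < k -> u \in [:: 2; 3] -> rho u = x ->
  nilp (eval (touchedT (Var u)) rho) = ~~ touched (rho 0) (rho 1) (size x).
Proof.
move=> k0 u23 E.
rewrite -[eval _ _]/(over_tails (fun y => eval (cats k _) (upd rho 4 y)) (rho 1)).
rewrite /touched; set p := fun j => has _ _.
(* The proper tails of the reply include the empty one, on which [Untok] falls back to 0. This is an
   index below [span], so it touches no tuple. *)
have p0 : p 0 = false by apply/hasPn => i _; have := span_gt0 (rho 0) k0; lia.
have -> : has p (behead (rho 1)) = has (fun t => p (nth 0 (rho 1) (size (rho 1) - t)))
    (iota 0 (size (rho 1))).
  case: (rho 1) => // a s; apply/(has_nthP 0)/hasP => [[i lti pi]|[t]].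
    exists (size s - i); first by rewrite mem_iota /=; lia.
    by rewrite /= subSn ?leq_subr //= subKn // ltnW.
  rewrite mem_iota => /andP[_ /= ltt]; rewrite subSn //= => pt.
  exists (size s - t) => //; rewrite ltnNge; apply/negP => le.
  by rewrite nth_default // p0 in pt.
rewrite over_tails_iota; apply: nilp_flatten => t.
rewrite eval_cats; apply: nilp_flatten => i.
rewrite eval_eqT; have -> : eval (Untok (Var 4)) (upd rho 4 (drop (size (rho 1) - t) (rho 1))) =
    nseq (nth 0 (rho 1) (size (rho 1) - t)) 0.
  by rewrite -[LHS]/(nseq (head 0 (drop _ _)) 0) -nth0 nth_drop addn0.
rewrite [eval (Cat _ _) _]evalE size_cat eval_spanT eval_blueT.
rewrite /nilp !size_nseq eqb0 (_ : eval (Var u) _ = x) // -E evalE updN //.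
by move: u23; rewrite !inE => /orP[]/eqP->.
Qed.

Lemma eval_clashT rho x y : rho 2 = x -> rho 3 = y ->
  eval (clashT (Var 2) (Var 3)) rho = flatten [seq nseq (entry (rho 0) (size x) i ==
    entry (rho 0) (size y) i) 0 | i <- iota 0 k].
Proof.
move=> E2 E3; rewrite eval_cats; congr flatten; apply: eq_map => i.
by rewrite eval_eqT !eval_entryT !size_nseq !evalE E2 E3.
Qed.

Lemma eval_keptT rho : 0 < k -> eval keptT rho = kept (rho 0) (rho 1).
Proof.
move=> k0; rewrite (@eval_for _ _ _ _ (fun t =>
  if touched (rho 0) (rho 1) t && ~~ has (fun t' => touched (rho 0) (rho 1) t' &&
    clash (rho 0) t t') (iota 0 t) then [:: t] else [::])) => [|x _].
  by rewrite eval_rowsT size_nseq /kept; elim: (iota 0 (rows _)) => //= t s ->; case: ifP.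
rewrite evalE (@nilp_touchedT 2 x) // ?updE //.
rewrite -[upd _ _ _ 0]/(rho 0) -[upd _ _ _ 1]/(rho 1).
case: (touched _ _ _) => //=; rewrite evalE.
rewrite (_ : nilp (eval (For _ _ _) _) = ~~ has (fun t' => touched (rho 0) (rho 1) t' &&
    clash (rho 0) (size x) t') (iota 0 (size x))).
  by case: (has _ _) => //=; rewrite !evalE updE.
rewrite (@eval_for _ _ _ _ (fun t' => if touched (rho 0) (rho 1) t' then
    flatten [seq nseq (entry (rho 0) (size x) i == entry (rho 0) t' i) 0 | i <- iota 0 k]
  else [::])).
  rewrite evalE updE; apply: nilp_flatten => t'; case: ifP => //= _.
  by apply: nilp_flatten => i; rewrite /nilp size_nseq eqb0.
move=> y _; rewrite evalE (@nilp_touchedT 3 y) // ?updE //.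
rewrite -[upd _ _ _ 0]/(rho 0) -[upd _ _ _ 1]/(rho 1).
by case: (touched _ _ _) => //=; rewrite (@eval_clashT _ x y) // updE.
Qed.

Lemma eval_replyT rho : 0 < k ->
  enc_toks (eval replyT rho) = enc_seqn (kept (rho 0) (rho 1)).
Proof. by move=> k0; rewrite !evalE eval_keptT. Qed.

End Terms.

(** * Validity and margins of the gadget *)

Lemma allpairs_iota (T : Type) (f : nat -> nat -> T) n k : 0 < k ->
  [seq f a i | a <- iota 0 n, i <- iota 0 k] = [seq f (j %/ k) (j %% k) | j <- iota 0 (n * k)].
Proof.
move=> k0; elim: n => // n IH.
rewrite -addn1 iotaD map_cat flatten_cat IH mulnDl mul1n iotaD map_cat /= cats0.
congr (_ ++ _); rewrite !add0n.
have -> : iota (n * k) k = map (addn (n * k)) (iota 0 k) by rewrite -iotaDl addn0.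
rewrite -map_comp.
apply/eq_in_map => i; rewrite mem_iota => /andP[_ lti] /=.
by rewrite divnMDl // modnMDl divn_small // modn_small // addn0.
Qed.

Lemma digits_inj k a b i j : i < k -> j < k -> a * k + i = b * k + j -> a = b /\ i = j.
Proof.
move=> lti ltj E; have k0 : 0 < k by lia.
have := congr1 (fun n => n %/ k) E; have := congr1 (fun n => n %% k) E.
by rewrite /= !modnMDl !divnMDl // !modn_small // !divn_small // !addn0.
Qed.

Lemma digits_lt k a n i : i < k -> a < n -> a * k + i < n * k.
Proof. by move=> lti lta; have : a.+1 * k <= n * k by [rewrite leq_mul2r lta orbT]; lia. Qed.

Lemma count_le1 (T : eqType) (p : pred T) (x : T) s : uniq s ->
  (forall y, y \in s -> p y -> y = x) -> count p s <= 1.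
Proof.
move=> us H; rewrite -size_filter (@uniq_leq_size _ _ [:: x]) ?filter_uniq // => y.
by rewrite mem_filter inE => /andP[py ys]; rewrite (H y).
Qed.

Section Gadget.
Variables (k : nat) (v : seq nat).
Hypothesis k2 : 1 < k.

Local Notation m := (rows k v).
Local Notation sp := (span k v).
Local Notation c := (entry k v).

Let k0 : 0 < k. Proof. exact: ltnW. Qed.
Let k1E : k.-1.+1 = k. Proof. exact: prednK. Qed.

Lemma leq_sumn (s : seq nat) n : n \in s -> n <= sumn s.
Proof.
elim: s => //= a s IH; rewrite inE => /orP[/eqP->|/IH]; first exact: leq_addr.
by move=> le; apply: leq_trans le (leq_addl _ _).
Qed.

(** [width] adds up the heads of proper tails, which omit entry 0 of [v]; hence the restriction to
    positive positions. *)
Lemma nth_lt_width n : 0 < n -> nth 0 v n < width v.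
Proof.
move=> n0; rewrite /width ltnS; case: (ltnP n (size v)) => [lt|le]; last by rewrite nth_default.
apply: ltnW; apply: leq_sumn; apply/mapP; exists (size v - n); first by rewrite mem_iota; lia.
by rewrite subKn // ltnW.
Qed.

Lemma entry_lt t i : c t i < width v.
Proof. by apply: nth_lt_width; rewrite !(addnS, addSn). Qed.

Lemma occurrence t i : t < m -> i < k ->
  count (fun t' => c t i == c t' i) (iota 0 m) <= k.
Proof.
rewrite /rows; case: ifPn => // /norP[_ /hasPn ok] ltt lti.
have /ok/hasPn/(_ t) : i \in iota 0 k by rewrite mem_iota.
by rewrite mem_iota -leqNgt; apply.
Qed.

Definition blue t i := c t i * k + i.

Lemma blue_lt t i : i < k -> blue t i < sp.
Proof. by move=> lti; apply: digits_lt (entry_lt _ _). Qed.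

Definition padj j := pad k v (j %/ k) (j %% k).
Definition memberj j := member k v (j %/ k) (j %% k).

Lemma exemplarsE : exemplars k v = map padj (iota 0 sp) ++ map memberj (iota 0 (m * k)).
Proof. by rewrite /exemplars !allpairs_iota. Qed.

Lemma padjE j : padj j = if covered k v (j %/ k) (j %% k) then [:: sp + j] else [:: j; sp + j].
Proof. by rewrite /padj /pad -divn_eq. Qed.

Lemma nth_pad j : j < sp -> nth [::] (exemplars k v) j = padj j.
Proof.
move=> ltj; rewrite exemplarsE nth_cat size_map size_iota ltj (nth_map 0) ?size_iota //.
by rewrite nth_iota.
Qed.

Lemma nth_member t i : t < m -> i < k ->
  nth [::] (exemplars k v) (sp + (t * k + i)) = member k v t i.
Proof.
move=> ltt lti; rewrite exemplarsE nth_cat size_map size_iota ltnNge leq_addr /= addKn.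
have lt := digits_lt lti ltt; rewrite (nth_map 0) ?size_iota // nth_iota //.
by rewrite /memberj add0n divnMDl // modnMDl divn_small // modn_small // addn0.
Qed.

Lemma index_cases j : j < size (exemplars k v) -> j < sp \/
  exists t i, [/\ t < m, i < k & j = sp + (t * k + i)].
Proof.
rewrite size_exemplars => lt; case: (ltnP j sp) => [|le]; [by left | right].
exists ((j - sp) %/ k), ((j - sp) %% k); rewrite -divn_eq subnKC //; split=> //.
  by rewrite ltn_divLR //; lia.
by rewrite ltn_mod.
Qed.

Lemma mem_pad f j : f \in padj j -> f = sp + j \/ f = j /\ ~~ covered k v (j %/ k) (j %% k).
Proof.
rewrite padjE; case: ifP; rewrite !inE => cov; first by move/eqP; left.
by case/orP=> /eqP; [right|left].
Qed.

Definition red t j := sp + (sp + (t * k.-1 + j)).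

Lemma red_ge t j : sp + sp <= red t j.
Proof. by rewrite /red addnA leq_addr. Qed.

Lemma mem_member f t i : f \in member k v t i <->
  f = blue t i \/ exists2 j, j < k.-1 & f = red t j.
Proof.
rewrite inE; split=> [/orP[/eqP->|/mapP[j]]|[->|[j ltj ->]]]; first by left.
- by rewrite mem_iota => lt ->; right; exists j.
- by rewrite eqxx.
by rewrite map_f ?orbT // mem_iota.
Qed.

Lemma gadget_weight : tap_k_weight k (gadget k v).
Proof.
apply/allP => E; rewrite [tap_S _]exemplarsE mem_cat => /orP[]/mapP[j _ ->].
  by rewrite padjE; case: ifP.
by rewrite /= size_map size_iota k1E.
Qed.

Lemma coveredP f : covered k v (f %/ k) (f %% k) <-> exists t i, [/\ t < m, i < k & f = blue
  t i].
Proof.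
split=> [/hasP[t]|[t [i [ltt lti ->]]]].
  rewrite mem_iota => ltt /eqP E; exists t, (f %% k); rewrite ltn_mod; split=> //.
  by rewrite /blue E -divn_eq.
rewrite /blue divnMDl // modnMDl divn_small // modn_small // addn0.
by apply/hasP; exists t; rewrite ?mem_iota.
Qed.

Lemma feature_cases f : f < tap_u (gadget k v) ->
  [\/ f < sp, exists2 j, j < sp & f = sp + j | exists t j, [/\ t < m, j < k.-1 & f = red t j]].
Proof.
rewrite /= => ltf; case: (ltnP f sp) => [|le1]; first by constructor 1.
case: (ltnP f (sp + sp)) => [lt2|le2]; first by constructor 2; exists (f - sp); lia.
have k10 : 0 < k.-1 by lia.
constructor 3; exists ((f - (sp + sp)) %/ k.-1), ((f - (sp + sp)) %% k.-1).
by rewrite /red -divn_eq ltn_mod ltn_divLR //; split=> //; lia.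
Qed.

Lemma red_lt t j : t < m -> j < k.-1 -> red t j < tap_u (gadget k v).
Proof. by move=> ltt ltj; rewrite /red /= !ltn_add2l; apply: digits_lt. Qed.

Lemma red_inj t j t' j' : j < k.-1 -> j' < k.-1 -> red t j = red t' j' -> t = t' /\ j = j'.
Proof. by move=> lt lt' /addnI/addnI; apply: digits_inj. Qed.

(** Pads differ in their private red features. Exemplars of tuples differ in the first red feature
    of the tuple, which exists because [1 < k], or else in the coordinate read off the blue feature
    modulo k; so even repeated tuples give distinct exemplars. *)
Lemma gadget_valid : tap_valid (gadget k v).
Proof.
have sp0 := span_gt0 v k0.
have spu : sp <= tap_u (gadget k v) by rewrite /= leq_addr.
apply/and5P; split; [| | | |apply/andP; split].
- exact: iota_ltn_sorted.
- by apply/allP => x; rewrite mem_iota => /andP[_ lt]; apply: leq_trans spu.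
- by rewrite /=; case: sp sp0.
- rewrite [tap_S _]exemplarsE cat_uniq; apply/and3P; split.
  + rewrite map_inj_in_uniq ?iota_uniq // => j j' _ _; rewrite !padjE.
    by case: ifP; case: ifP => _ _ [] //; lia.
  + apply/hasPn => E /mapP[j _ ->]; apply/mapP => -[j' ]; rewrite mem_iota => /andP[_ lt].
    rewrite padjE /memberj /member -[in iota 0 k.-1](prednK (n := k.-1)) /=; last lia.
    by case: ifP => _ // [_ /addnI e _]; move: lt; rewrite -e add0n ltnNge leq_addr.
  + rewrite map_inj_in_uniq ?iota_uniq // => j j' _ _ [].
    rewrite -[in iota 0 k.-1](prednK (n := k.-1)) /=; last lia.
    move=> E [E2 _]; have k10 : 0 < k.-1 by lia.
    have [] := @digits_inj k.-1 (j %/ k) (j' %/ k) 0 0 k10 k10; first lia.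
    move=> Et _; have [_ Ei] := digits_inj (ltn_pmod j k0) (ltn_pmod j' k0) E.
    by rewrite (divn_eq j k) (divn_eq j' k) Et Ei.
- apply/allP => E; rewrite [tap_S _]exemplarsE mem_cat => /orP[]/mapP[j].
    rewrite mem_iota add0n => /andP[_ ltj] ->; rewrite padjE.
    have l1 : sp + j < tap_u (gadget k v) by rewrite /= ltn_add2l ltn_addr.
    have l2 : j < sp + j by rewrite -[X in X < _]add0n ltn_add2r.
    move: (tap_u _) spu l1 => u spu l1; case: ifP => _ /=; first by rewrite l1.
    by rewrite l1 l2 (leq_trans ltj spu).
  rewrite mem_iota => /andP[_ ltj] ->; apply/and3P; split=> //.
    have hd t i : i < k -> path ltn (blue t i) [seq red t j' | j' <- iota 0 k.-1].
      move=> lti; have ltb := blue_lt t lti; rewrite path_min_sorted; last first.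
        by apply/allP => _ /mapP[j' _ ->]; apply: leq_trans ltb (leq_addr _ _).
      rewrite sorted_map; apply: sub_sorted (iota_ltn_sorted 0 k.-1) => x y /=.
      by rewrite /red !ltn_add2l.
    by apply: hd; rewrite ltn_pmod.
  apply/allP => x /mem_member[->|[i lti ->]].
    by apply: leq_trans (blue_lt _ _) spu; rewrite ltn_pmod.
  by apply: red_lt => //; rewrite ltn_divLR.
apply/allP => f; rewrite mem_iota => /andP[_ /feature_cases[lt|[j ltj ->]|[t [j [ltt ltj
  ->]]]]].
- have [/coveredP[t [i [ltt lti ->]]]|nc] := boolP (covered k v (f %/ k) (f %% k)).
    apply/hasP; exists (member k v t i); last by apply/mem_member; left.
    by rewrite -(nth_member ltt lti) mem_nth // size_exemplars ltn_add2l digits_lt.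
  apply/hasP; exists (padj f); last by rewrite padjE (negbTE nc) inE eqxx.
  by rewrite -(nth_pad lt) mem_nth // size_exemplars ltn_addr.
- apply/hasP; exists (padj j); last by rewrite padjE; case: ifP; rewrite !inE eqxx ?orbT.
  by rewrite -(nth_pad ltj) mem_nth // size_exemplars ltn_addr.
apply/hasP; exists (member k v t 0); last by apply/mem_member; right; exists j.
by rewrite -(nth_member ltt k0) mem_nth // size_exemplars ltn_add2l digits_lt.
Qed.

Lemma count_exemplars f : count (fun E => f \in E) (exemplars k v) =
  count (fun j => f \in padj j) (iota 0 sp) + count (fun j => f \in memberj j) (iota 0 (m * k)).
Proof. by rewrite exemplarsE count_cat !count_map. Qed.

Lemma count_allpairs (p : nat -> nat -> bool) n :
  count (fun j => p (j %/ k) (j %% k)) (iota 0 (n * k)) =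
  sumn [seq count (p t) (iota 0 k) | t <- iota 0 n].
Proof.
rewrite -sumn_map_bool -(allpairs_iota (fun t i => nat_of_bool (p t i)) n k0).
elim: (iota 0 n) => //= t s IH; rewrite sumn_cat IH; congr (_ + _).
by rewrite sumn_map_bool.
Qed.

Lemma leq_sumn_map (f h : nat -> nat) s : (forall t, t \in s -> f t <= h t) ->
  sumn [seq f t | t <- s] <= sumn [seq h t | t <- s].
Proof.
elim: s => //= t s IH H; rewrite leq_add ?H ?mem_head // IH // => x xs.
by rewrite H // inE xs orbT.
Qed.

Lemma count_none (T : eqType) (p : pred T) s : (forall x, x \in s -> ~~ p x) -> count p s = 0.
Proof. by move/hasPn=> H; apply/eqP; rewrite -leqn0 leqNgt -has_count. Qed.

(** A covered blue feature is left out of its pad, so only the at most k tuples through that element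
    contribute, one exemplar each. An uncovered blue feature and a private red one occur only in one
    pad, and a red feature of a tuple only in the k exemplars of that tuple. *)
Lemma feature_count (f : nat) : f < tap_u (gadget k v) ->
  count (fun E => f \in E) (exemplars k v) <= k.
Proof.
move=> ltf; rewrite count_exemplars.
have [lt|[j ltj fE]|[t [j [ltt ltj fE]]]] := feature_cases ltf; clear ltf.
  have notred t j : f <> red t j by apply/eqP; rewrite neq_ltn (leq_trans lt) ?leq_addr.
  have notshift j : f <> sp + j by apply/eqP; rewrite neq_ltn (leq_trans lt) ?leq_addr.
  have [|nc] := boolP (covered k v (f %/ k) (f %% k)).
    case/coveredP=> t0 [i0 [ltt0 lti0 fE]]; rewrite [X in X + _]count_none => [|j _].
      rewrite add0n (count_allpairs (fun t i => f \in member k v t i)).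
      apply: leq_trans (occurrence ltt0 lti0); rewrite -sumn_map_bool.
      apply: leq_sumn_map => t _.
      have only i : i \in iota 0 k -> f \in member k v t i -> i = i0 /\ c t0 i0 = c t i0.
        rewrite mem_iota => lti /mem_member[|[j _ /notred]//]; rewrite fE => E.
        by have [-> ->] := digits_inj lti0 lti E.
      case: eqP => [_|ne]; first by apply: (@count_le1 _ _ i0); rewrite ?iota_uniq // => i
        /only H /H[].
      by rewrite count_none // => i /only H; apply/negP => /H[_ /ne].
    apply/negP => /mem_pad[/notshift//|[fj]]; rewrite -fj; case/negP; apply/coveredP.
    by exists t0, i0.
  rewrite [X in _ + X]count_none ?addn0 => [|j].
    apply: leq_trans k0; apply: (@count_le1 _ _ f); rewrite ?iota_uniq // => j _.
    by case/mem_pad=> [/notshift|[]].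
  rewrite mem_iota add0n => /andP[_ ltj]; apply: contra nc => /mem_member[fE|[j' _ /notred//]].
  by apply/coveredP; exists (j %/ k), (j %% k); rewrite ltn_mod ltn_divLR.
- rewrite [X in _ + X]count_none ?addn0 => [|j' _].
    apply: leq_trans k0; apply: (@count_le1 _ _ j); rewrite ?iota_uniq // => j'.
    by rewrite mem_iota => lt' /mem_pad[|[]]; lia.
  apply/negP => /mem_member[|[j2 _]]; last by have := red_ge (j' %/ k) j2; lia.
  by have := blue_lt (j' %/ k) (ltn_pmod j' k0); lia.
have -> : count (fun j => f \in padj j) (iota 0 sp) = 0.
  apply: count_none => j'; rewrite mem_iota => lt'.
  by apply/negP => /mem_pad; rewrite fE; have := red_ge t j; lia.
rewrite add0n (count_allpairs (fun t i => f \in member k v t i)).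
apply: leq_trans (_ : sumn [seq (t' == t) * k | t' <- iota 0 m] <= k).
  apply: leq_sumn_map => t' _; case: eqP => [_|ne].
    by rewrite mul1n -[X in _ <= X](size_iota 0) count_size.
  rewrite mul0n count_none // => i; rewrite mem_iota => lti.
  apply/negP => /mem_member[|[j' ltj']]; rewrite fE; last by case/red_inj=> // /esym.
  by have := blue_lt t' lti; have := red_ge t j; lia.
have -> : sumn [seq (t' == t) * k | t' <- iota 0 m] = count_mem t (iota 0 m) * k.
  by elim: (iota 0 m) => //= a s ->; rewrite mulnDl.
by rewrite count_uniq_mem ?iota_uniq // -[X in _ <= X]mul1n leq_mul2r; case: (_ \in _);
  rewrite orbT.
Qed.

Lemma gadget_occurrence : tap_k_occurrence k (gadget k v).
Proof. by apply/allP => f; rewrite mem_iota add0n => /andP[_ /feature_count]. Qed.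

Definition elements t := [seq blue t i | i <- iota 0 k].

Lemma size_undup_cat (T : eqType) (s t : seq T) :
  size (undup (s ++ t)) <= size (undup s) + count [predC s] t.
Proof.
rewrite -size_filter -size_cat; apply: uniq_leq_size; first exact: undup_uniq.
move=> x; rewrite mem_undup !mem_cat mem_undup mem_filter /=.
by case: (x \in s) => //= ->.
Qed.

Lemma appearsI sol j f : j \in sol -> f \in nth [::] (exemplars k v) j ->
  tap_appears (gadget k v) sol f.
Proof. by move=> js fj; apply/hasP; exists j. Qed.

Section Selection.
Variable ans : seq nat.
Local Notation hit := (touched k v ans).

(* A tuple brings k new elements if it is kept and at most k - 1 otherwise. *)
Lemma coverage n :
  size (undup (flatten (map elements [seq t <- iota 0 n | hit t]))) <= size [seq t <- iota 0
    n | hit t &&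
    ~~ has (fun t' => hit t' && clash k v t t') (iota 0 t)] + k.-1 * size [seq t <- iota 0 n
      | hit t].
Proof.
elim: n => // n IH; rewrite -[n.+1]addn1 iotaD !filter_cat add0n /=.
case: ifP => /= hn; last by rewrite !cats0.
set s := [seq t <- iota 0 n | hit t] in IH *.
rewrite map_cat flatten_cat /= cats0 !size_cat /= mulnDr muln1.
apply: leq_trans (size_undup_cat _ _) _.
have [/hasP[t tn /andP[ht /hasP[i lti /eqP E]]]|_] := boolP (has _ _); last first.
  have := count_size [predC flatten (map elements s)] (elements n).
  rewrite size_map size_iota /= => le; apply: leq_trans (leq_add IH le) _.
  by move: (k.-1 * _) (size _) => e X; lia.
suff lt : count [predC flatten (map elements s)] (elements n) <= k.-1.
  by apply: leq_trans (leq_add IH lt) _; rewrite /= addn0 addnA.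
rewrite -ltnS k1E.
rewrite -[X in _ < X](size_iota 0) -(size_map (blue n)) -/(elements n).
rewrite -(count_predC [predC flatten (map elements s)] (elements n)) -[X in X < _]addn0
  ltn_add2l.
rewrite -has_count; apply/hasP; exists (blue n i); first exact: map_f.
rewrite /= negbK; apply/flattenP; exists (elements t); last first.
  by rewrite (_ : blue n i = blue t i) ?/blue ?E //; apply: map_f.
by apply: map_f; rewrite mem_filter ht.
Qed.

(** Clashing is symmetric, and the later of two clashing touched tuples is discarded. *)
Lemma kept_matching t t' : t \in kept k v ans -> t' \in kept k v ans -> t != t' ->
  ~~ clash k v t t'.
Proof.
have sym a b : clash k v a b = clash k v b a by apply: eq_has => i; rewrite eq_sym.
wlog lt : t t' / t' < t => [H|].
  move=> kt kt' ne; case: (ltngtP t t') ne => // ltt _; [rewrite sym|];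
    by apply: H => //; rewrite neq_ltn ltt ?orbT.
rewrite !mem_filter => /andP[/andP[_ /hasPn/(_ t')]] + _ /andP[/andP[h _] _] _.
by rewrite mem_iota lt h /=; apply.
Qed.

Lemma kept_lt t : t \in kept k v ans -> t < m.
Proof. by rewrite mem_filter mem_iota => /andP[_]. Qed.

Lemma kept_uniq : uniq (kept k v ans).
Proof. exact: filter_uniq (iota_uniq _ _). Qed.

(** Let A be the touched tuples and Q the pads whose private red feature appears. At most the
    distinct elements of A and one feature per member of Q are blue; at least |Q| + (k - 1)|A|
    features are red. Q cancels, and [coverage] bounds the elements of A by the kept tuples plus (k
    - 1)|A|. *)
Lemma margin_le_kept : tap_feasible (gadget k v) (behead ans) ->
  (tap_margin (gadget k v) (behead ans) <= Z.of_nat (size (kept k v ans)))%Z.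
Proof.
set sol := behead ans => /andP[usol /allP inS].
rewrite /tap_margin [tap_u _]/= [tap_T _]/=; set u := sp + _.
set app := tap_appears _ _.
set B := count _ _; set R := count _ _.
pose A := [seq t <- iota 0 m | hit t].
pose Q := [seq j <- iota 0 sp | app (sp + j)].
have appP f : app f -> exists2 j, j \in sol & [\/ j < sp /\ f = sp + j, j < sp /\ f = j |
    exists t i, [/\ t < m, i < k, hit t & f \in member k v t i]].
  case/hasP=> j js fj; exists j => //; move: fj; rewrite [tap_S _]/=.
  have [ltj|[t [i [ltt lti jE]]]] := index_cases (inS j js).
    rewrite nth_pad // => /mem_pad[->|[-> _]]; [by constructor 1 | by constructor 2].
  rewrite jE nth_member // => fm; constructor 3; exists t, i; split=> //.
  by apply/hasP; exists j => //; apply/hasP; exists i; rewrite ?mem_iota // jE.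
have leB : B <= size (undup (flatten (map elements A))) + size Q.
  rewrite /B -size_filter -size_cat; apply: uniq_leq_size.
    exact: filter_uniq (iota_uniq _ _).
  move=> f; rewrite mem_filter => /andP[/andP[af]].
  rewrite [f \in iota 0 sp]mem_iota add0n => /= ltf _.
  rewrite mem_cat mem_undup mem_filter mem_iota add0n ltf andbT.
  have [j js [[ltj fE]|[ltj fE]|[t [i [ltt lti ht /mem_member[->|[j' _ fE]]]]]]] := appP f af.
  - by move: ltf; rewrite fE ltnNge leq_addr.
  - apply/orP; right; rewrite fE andbT; apply: appearsI js _.
    by rewrite nth_pad // padjE; case: ifP; rewrite !inE eqxx ?orbT.
  - apply/orP; left; apply/flattenP; exists (elements t); last by apply: map_f; rewrite
    mem_iota.
    by apply: map_f; rewrite mem_filter ht mem_iota.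
  by move: ltf; rewrite fE ltnNge (leq_trans _ (red_ge t j')) ?leq_addr.
have leR : size Q + size A * k.-1 <= R.
  rewrite -(size_map (addn sp)) -(size_iota 0 k.-1) -(size_allpairs red) -size_cat /R
    -size_filter.
  apply: uniq_leq_size.
    rewrite cat_uniq; apply/and3P; split.
    - by rewrite map_inj_uniq ?filter_uniq ?iota_uniq //; apply: addnI.
    - apply/hasPn => _ /allpairsP[[t j] [_ _ ->]] /=; apply/mapP => -[j'].
      by rewrite mem_filter mem_iota => /andP[_ /= lt] E; have := red_ge t j; rewrite E; lia.
    apply: allpairs_uniq; rewrite ?filter_uniq ?iota_uniq // => -[t j] [t' j'] /=.
    move=> /allpairsP[[a b] [_ /=]]; rewrite mem_iota => lb [-> ->].
    move=> /allpairsP[[a' b'] [_ /=]]; rewrite mem_iota => lb' [-> ->].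
    by case/red_inj=> // -> ->.
  move=> f; rewrite mem_cat mem_filter [f \in iota 0 u]mem_iota add0n => /orP[/mapP[j]|].
    rewrite mem_filter mem_iota add0n => /andP[aj /= ltj] ->.
    rewrite aj [sp + j \in _]mem_iota add0n ltnNge leq_addr /u ltn_add2l.
    exact: leq_trans ltj (leq_addr _ _).
  case/allpairsP=> -[t j] [/=]; rewrite mem_filter !mem_iota !add0n => /andP[ht /= ltt] ltj ->.
  rewrite [red t j < u]red_lt // andbT.
  rewrite [red t j < sp]ltnNge (leq_trans _ (red_ge t j)) ?leq_addr // andbT.
  have /hasP[x xs /hasP[i lti /eqP xE]] := ht; apply: appearsI xs _.
  rewrite mem_iota in lti; rewrite xE nth_member //.
  by apply/mem_member; right; exists j.
have := coverage m; rewrite -/A -/(kept k v ans) => D.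
have : B <= R + size (kept k v ans) by rewrite mulnC in leR; lia.
lia.
Qed.

End Selection.

End Gadget.

(** * Margins of matchings and the length of an answer *)

Lemma sum_blocks (F : nat -> nat) n b :
  \sum_(0 <= t < n) \sum_(0 <= i < b) F (t * b + i) = \sum_(0 <= j < n * b) F j.
Proof.
elim: n => [|n IH]; first by rewrite !big_geq.
rewrite big_nat_recr //= IH mulSnr [RHS](big_cat_nat (n := n * b)) ?leq_addr //=.
congr (_ + _); rewrite -{2}[n * b]add0n big_addn addKn.
by apply: eq_bigr => i _; rewrite addnC.
Qed.

Lemma sum_nth_le (s : seq nat) n : \sum_(0 <= j < n) nth 0 s j <= sumn s.
Proof.
elim: s n => [|a s IH] n; first by rewrite big1 // => i _; rewrite nth_nil.
case: n => [|n]; first by rewrite big_geq.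
by rewrite big_nat_recl //= leq_add2l.
Qed.

Lemma sumn_iota n : 2 * sumn (iota 0 n) + n = n * n.
Proof. by elim: n => // n IH; rewrite -[n.+1]addn1 iotaD sumn_cat /=; nia. Qed.

Lemma sumn_filter_le (p : pred nat) s : sumn (filter p s) <= sumn s.
Proof. by elim: s => //= a s IH; case: (p a) => /=; lia. Qed.

Lemma size_enc_seqn s : size (enc_seqn s) = (size s + size s + sumn s).+1.
Proof. by rewrite -[enc_seqn s]/(enc_toks (size s :: s)) size_enc_toks /=; lia. Qed.

Lemma leq_count_lt k (s : seq nat) n : (forall a, count_mem a s <= k) ->
  all (fun x => x < n) s -> size s <= k * n.
Proof.
elim: n s => [|n IH] s ck als; first by case: s als ck.
rewrite -(count_predC (pred1 n) s) mulnS leq_add // -size_filter; apply: IH.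
  move=> a; apply: leq_trans (ck a); rewrite count_filter; apply: sub_count.
  by move=> x /andP[].
apply/allP => x; rewrite mem_filter /= => /andP[ne xs].
by have := allP als x xs; lia.
Qed.

(* After sorting, the j-th entry is at least j / k rounded down. *)
Lemma square_bound k (s : seq nat) : (forall a, count_mem a s <= k) ->
  size s * size s + size s <= k * (2 * size s) + k * (2 * sumn s).
Proof.
move=> ck; rewrite -(perm_sumn (permEl (perm_sort leq s))) -(size_sort leq s).
have {ck} : forall a, count_mem a (sort leq s) <= k.
  by move=> a; rewrite (permP (permEl (perm_sort leq s))).
have : sorted leq (sort leq s) by apply: sort_sorted; exact: leq_total.
elim/last_ind: (sort leq s) => [|r a IH] so ck //.
have ck' b : count_mem b r <= k.
  by apply: leq_trans (ck b); rewrite -cats1 count_cat leq_addr.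
move: so; rewrite (sorted_pairwise leq_trans) pairwise_rcons => /andP[ltr so].
have so' : sorted leq r by rewrite (sorted_pairwise leq_trans).
have H : size (rcons r a) <= k * a.+1.
  apply: leq_count_lt ck _; apply/allP => x; rewrite mem_rcons inE => /orP[/eqP->//|xr].
  by rewrite ltnS; apply: (allP ltr).
have := IH so' ck'; rewrite size_rcons -cats1 sumn_cat /= addn0 in H *.
move: (size r) (sumn r) H => n S H1 H2; nia.
Qed.

Section GadgetBounds.
Variables (k : nat) (v : seq nat).
Hypothesis k2 : 1 < k.

Local Notation m := (rows k v).
Local Notation sp := (span k v).
Local Notation c := (entry k v).

Let k0 : 0 < k. Proof. exact: ltnW. Qed.

(** All k exemplars of every tuple of the matching are selected: disjointness makes the k blue
    features of each tuple new, against its k - 1 red ones. *)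
Lemma matching_margin ts : uniq ts -> (forall t, t \in ts -> t < m) ->
  (forall t t', t \in ts -> t' \in ts -> t != t' -> ~~ clash k v t t') ->
  exists2 sol, tap_feasible (gadget k v) sol &
    (Z.of_nat (size ts) <= tap_margin (gadget k v) sol)%Z.
Proof.
move=> uts ltm apart; pose sol := [seq sp + (t * k + i) | t <- ts, i <- iota 0 k].
exists sol.
  apply/andP; split.
    apply: allpairs_uniq; rewrite ?iota_uniq // => -[t i] [t' i'].
    move=> /allpairsP[[a b] [_ /=]]; rewrite mem_iota => lb [-> ->].
    move=> /allpairsP[[a' b'] [_ /=]]; rewrite mem_iota => lb' [-> ->] /addnI.
    by case/digits_inj=> // -> ->.
  apply/allP => x /allpairsP[[t i] [/= /ltm ltt]]; rewrite mem_iota => lti ->.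
  by rewrite [size _]size_exemplars ltn_add2l digits_lt.
rewrite /tap_margin [tap_u _]/= [tap_T _]/=; set u := sp + _.
set B := count _ _; set R := count _ _.
have leB : size ts * k <= B.
  rewrite -{1}(size_iota 0 k) -(size_allpairs (blue k v)) /B -size_filter.
  apply: uniq_leq_size.
    apply: allpairs_uniq; rewrite ?iota_uniq // => -[t i] [t' i'].
    move=> /allpairsP[[a b] [/= tsa ]]; rewrite mem_iota => lb [-> ->].
    move=> /allpairsP[[a' b'] [/= tsa']]; rewrite mem_iota => lb' [-> ->].
    case/digits_inj=> // E bE; rewrite -bE in E *; congr pair; apply/eqP/negPn/negP => ne.
    have /hasPn/(_ b) := apart _ _ tsa tsa' ne.
    by rewrite mem_iota /= E eqxx => /(_ lb).
  move=> x /allpairsP[[t i] [/= tts]]; rewrite mem_iota => lti ->.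
  have ltb := @blue_lt k v k2 t i lti.
  rewrite mem_filter !mem_iota !add0n ltb (leq_trans ltb) ?leq_addr // !andbT.
  apply: (@appearsI _ _ _ (sp + (t * k + i))); first by apply/allpairsP; exists (t, i);
    rewrite mem_iota.
  by rewrite nth_member ?ltm //; apply/mem_member; left.
have leR : R <= size ts * k.-1.
  rewrite -(size_iota 0 k.-1) -(size_allpairs (red k v)) /R -size_filter.
  apply: uniq_leq_size; first exact: filter_uniq (iota_uniq _ _).
  move=> f; rewrite mem_filter => /andP[/andP[/hasP[x /allpairsP[[t i] [/= tts]]]]].
  rewrite mem_iota => lti -> + + _; rewrite nth_member ?ltm //.
  move=> /mem_member[->|[j ltj ->]]; first by rewrite mem_iota add0n blue_lt.
  by move=> _; apply/allpairsP; exists (t, j); rewrite mem_iota.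
have : size ts * k = size ts * k.-1 + size ts by rewrite -{1}(prednK k0) mulnS addnC.
lia.
Qed.

(** The extra summand [m] is the tuple count, itself a token of the header; the entries lie in the
    blocks after the header, whose length tokens are simply dropped from the sum. *)
Lemma entries_sum : ~~ malformed k v -> k + 2 + m * k.+1 <= size v /\
  m + \sum_(0 <= t < m) \sum_(0 <= i < k) c t i <= sumn v.
Proof.
move=> wf; have mE : m = ntuples k v by rewrite /rows (negbTE wf).
have szv : k + 2 + m * k.+1 <= size v.
  by move: wf => /norP[]; rewrite -leqNgt mE addn2.
split=> //; have -> : sumn v = sumn (take k.+2 v) + sumn (drop k.+2 v).
  by rewrite -sumn_cat cat_take_drop.
apply: leq_add.
  apply: leq_sumn; rewrite mE /ntuples -(nth_take 0 (n0 := k.+2)) // mem_nth //.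
  by rewrite size_takel // (leq_trans _ szv) // addn2 leq_addr.
apply: leq_trans (sum_nth_le _ (m * k.+1)).
rewrite -(sum_blocks (fun n => nth 0 (drop k.+2 v) n)); apply: leq_sum => t _.
rewrite big_nat_recl //; apply: leq_trans (leq_addl _ _).
apply: leq_sum => i _; rewrite nth_drop /entry.
by rewrite (_ : t * k.+1 + (k + 3 + i) = k.+2 + (t * k.+1 + i.+1)) //; lia.
Qed.

(** The kept indices are distinct and below m, so they cost at most m(m - 1)/2 + 2m + 1 bits.
    Summing [square_bound] over the k coordinates gives entries of total at least (m^2 + m)/2 - km,
    and the loss km is made up by the m(k + 1) tokens of the blocks. *)
Lemma size_kept ans : size (enc_seqn (kept k v ans)) <= (size (enc_toks v)).+1.
Proof.
rewrite size_enc_seqn ltnS size_enc_toks.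
have szk : size (kept k v ans) <= m.
  by rewrite size_filter -{2}(size_iota 0 m) count_size.
have smk : sumn (kept k v ans) <= sumn (iota 0 m) := sumn_filter_le _ _.
have sm := sumn_iota m; case wf : (malformed k v).
  (* Without tuples the answer is the one-bit code of the empty list, which can be longer than an
     empty question: the source of the extra bit. *)
  have m0 : m = 0 by rewrite /rows wf.
  by rewrite m0 /= in szk smk; lia.
have [szv smv] := entries_sum (negbT wf).
have sq i : i < k -> m * m + m <= k * (2 * m) + k * (2 * \sum_(0 <= t < m) c t i).
  move=> lti; have := @square_bound k [seq c t i | t <- iota 0 m].
  rewrite size_map size_iota sumnE big_map /index_iota subn0; apply=> a.
  rewrite count_map; have [/hasP[t]|/hasPn no] := boolP (has (fun t => c t i == a) (iota 0 m)).
    rewrite mem_iota => ltt /eqP <-; apply: leq_trans (occurrence ltt lti).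
    by apply: sub_count => t' /= /eqP ->.
  by rewrite count_none.
have : k * (m * m + m) <= k * (k * (2 * m)) + k * (2 * \sum_(0 <= t < m) \sum_(0 <= i < k) c
  t i).
  rewrite exchange_big /=.
  have -> : k * (m * m + m) = \sum_(0 <= i < k) (m * m + m) by rewrite sum_nat_const_nat subn0.
  have -> : k * (k * (2 * m)) = \sum_(0 <= i < k) k * (2 * m) by rewrite sum_nat_const_nat
    subn0.
  rewrite !big_distrr -big_split /=; rewrite big_nat_cond [X in _ <= X]big_nat_cond.
  by apply: leq_sum => i /andP[/andP[_ /sq]].
move: (\sum_(_ <= _ < _) _) smv => X smv.
rewrite -mulnDr leq_mul2l; case: eqP => [|_ /=]; first by lia.
nia.
Qed.

End GadgetBounds.

(** * Matching instances *)

Lemma nth_flatten_const (ss : seq (seq nat)) b t i : all (fun s => size s == b) ss ->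
  t < size ss -> i < b -> nth 0 (flatten ss) (t * b + i) = nth 0 (nth [::] ss t) i.
Proof.
elim: ss t => // s ss IH [|t] /andP[/eqP sb alls] /= lt lti; rewrite nth_cat sb.
  by rewrite mul0n lti.
by rewrite mulSn -addnA ltnNge leq_addr /= addKn IH.
Qed.

Lemma size_flatten_const (ss : seq (seq nat)) b : all (fun s => size s == b) ss ->
  size (flatten ss) = size ss * b.
Proof. by elim: ss => //= s ss IH /andP[/eqP sb /IH]; rewrite size_cat sb mulSn => ->. Qed.

Definition dm_toks (I : dm_inst) : seq nat :=
  (size (dm_sizes I) :: rcons (dm_sizes I) (size (dm_C I))) ++
  flatten [seq size t :: t | t <- dm_C I].

Lemma enc_dmE I : enc_dm I = enc_toks (dm_toks I).
Proof.
have encC s : flatten (map enc_seqn s) = enc_toks (flatten [seq size t :: t | t <- s]).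
  by elim: s => //= t s ->; rewrite -cat_cons enc_toks_cat.
rewrite /dm_toks enc_toks_cat -[_ :: rcons _ _]cat1s -cats1 !enc_toks_cat.
by rewrite /enc_dm /enc_seqseq encC /enc_seqn /enc_toks /= !cats0 -!catA.
Qed.

Section Instance.
Variables (k : nat) (I : dm_inst).
Hypotheses (k2 : 1 < k) (valid : dm_valid k I) (occ : dm_k_occurrence k I).

Local Notation v := (dm_toks I).
Local Notation C := (dm_C I).

Let szk : size (dm_sizes I) = k. Proof. by case/and3P: valid => /eqP. Qed.

Let blocks : all (fun s => size s == k.+1) [seq size t :: t | t <- C].
Proof.
case/and3P: valid => _ _ /allP H; apply/allP => _ /mapP[t tC ->] /=.
by have /andP[/eqP ->] := H t tC.
Qed.

Lemma dm_entry t i : t < size C -> i < k -> entry k v t i = nth 0 (nth [::] C t) i.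
Proof.
move=> ltt lti; rewrite /entry /dm_toks nth_cat /= size_rcons szk ltnNge.
rewrite (_ : k.+1 < _); last by lia.
rewrite (_ : t * k.+1 + (k + 3 + i) - k.+2 = t * k.+1 + i.+1); last by lia.
by rewrite (@nth_flatten_const _ k.+1) ?size_map // (nth_map [::]).
Qed.

Lemma dm_ntuples : ntuples k v = size C.
Proof.
rewrite /ntuples /dm_toks nth_cat /= size_rcons szk ltnSn.
by rewrite nth_rcons szk ltnn eqxx.
Qed.

(** A genuine instance passes the test [malformed], so its gadget contains every tuple. *)
Lemma dm_rows : rows k v = size C.
Proof.
rewrite /rows ifF ?dm_ntuples //; apply/negbTE; rewrite negb_or dm_ntuples.
apply/andP; split.
  by rewrite -leqNgt /dm_toks size_cat (size_flatten_const blocks) size_map /= size_rcons szk.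
apply/hasPn => i; rewrite mem_iota => /= lti; apply/hasPn => t; rewrite mem_iota => /= ltt.
case/and3P: valid => _ _ /allP H; have tC : nth [::] C t \in C by apply: mem_nth.
have /andP[_ /allP/(_ i)] := H _ tC; rewrite mem_iota => /(_ lti) lta.
move/allP/(_ i): occ; rewrite mem_iota szk => /(_ lti)/allP/(_ (nth 0 (nth [::] C t) i)).
rewrite mem_iota => /(_ lta); rewrite -leqNgt; apply: leq_trans.
rewrite -{3}(mkseq_nth [::] C) count_map; apply: eq_leq; apply: eq_in_count => t'.
by rewrite mem_iota => /= ltt'; rewrite !dm_entry // eq_sym.
Qed.

Lemma dm_clash t t' : t < size C -> t' < size C ->
  ~~ clash k v t t' = all (fun i => nth 0 (nth [::] C t) i != nth 0 (nth [::] C t') i)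
    (iota 0 (size (dm_sizes I))).
Proof.
move=> ltt ltt'; rewrite -all_predC szk; apply: eq_in_all => i.
by rewrite mem_iota => lti; rewrite /= !dm_entry.
Qed.

Lemma kept_feasible ans : dm_feasible I (kept k v ans).
Proof.
have ltC t : t \in kept k v ans -> t < size C by move/kept_lt; rewrite dm_rows.
apply/and3P; split; [exact: kept_uniq | exact/allP |].
apply/allP => t tk; apply/allP => t' t'k; case: eqVneq => //= ne.
by rewrite -dm_clash ?ltC // (kept_matching tk t'k).
Qed.

(** The TAP oracle guarantees its ratio against the optimum of the gadget, so the two optima must
    coincide. [kept] turns any selection into a matching at least as large as its margin;
    [matching_margin] gives the converse. *)
Lemma gadget_opt n : dm_is_opt I n -> tap_is_opt (gadget k v) (Z.of_nat n).
Proof.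
move=> [[ts [/and3P[uts /allP ltC /allP apart] szts]] maxn].
have upper sol : tap_feasible (gadget k v) sol -> (tap_margin (gadget k v) sol <= Z.of_nat n)%Z.
  (* The leading 0 stands in for the length token, which [behead] removes. *)
  move=> /(margin_le_kept k2 (ans := 0 :: sol)) /= le.
  have := maxn _ (kept_feasible (0 :: sol)); lia.
split=> //; have [||sol fsol le] := @matching_margin k v k2 ts uts.
- by move=> t /ltC; rewrite dm_rows.
- move=> t t' tt tt' ne; rewrite dm_clash ?ltC //.
  by have /allP/(_ _ tt') := apart _ tt; rewrite (negbTE ne).
by exists sol; split=> //; have := upper sol fsol; rewrite szts in le; lia.
Qed.

End Instance.

(** * The reduction *)

Section Reduction.
Variables (k : nat) (alpha : R).
Hypothesis k2 : 1 < k.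

Let k0 : 0 < k. Proof. exact: ltnW. Qed.

Lemma questionE w : question (gadgetT k) w = enc_tap (gadget k (toks w)).
Proof. by rewrite /question eval_gadgetT. Qed.

Lemma answerE g w : answer (gadgetT k) (replyT k) g w =
  enc_seqn (kept k (toks w) (toks (g (enc_tap (gadget k (toks w)))))).
Proof. by rewrite /answer eval_replyT // questionE. Qed.

(** The gadget of every word is valid, so the oracle must answer with distinct indices below the
    number n of exemplars, in at most n^2 + 2n + 1 bits; and n is written in unary in the
    question. *)
Lemma reply_short : exists c, forall g w, tap_kk_approx_ok k alpha g ->
  size (g (question (gadgetT k) w)) <= pbound c (size w).
Proof.
have [c Hc] := eval_bound (gadgetT k).
have [e He] : poly_bounded (fun x => pbound c x * pbound c x + 2 * pbound c x + 1) by
  poly_bounded_tac.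
exists e => g w og; apply: leq_trans (He (size w)).
have szq : size (exemplars k (toks w)) <= pbound c (size w).
  have Hq : size (question (gadgetT k) w) <= pbound c (size w).
    apply: Hc => u; rewrite /env0 /upd; case: ifP => // _; exact: size_enc_toks_le.
  apply: leq_trans Hq; rewrite questionE /enc_tap /enc_seqseq /enc_nat !size_cat !size_nseq.
  by rewrite [tap_S _]/=; lia.
rewrite questionE.
have [sol [-> [/andP[usol /allP ltS] _]]] :=
  og _ (gadget_valid (toks w) k2) (gadget_occurrence (toks w) k2) (gadget_weight (toks w) k2).
set n := size (exemplars k (toks w)) in szq.
have szs : size sol <= n.
  rewrite -(size_iota 0 n); apply: uniq_leq_size => // j /ltS.
  by rewrite mem_iota.
have sms : sumn sol <= size sol * n.
  elim: sol ltS {usol szs} => //= j sol IH H; rewrite mulSn leq_add ?IH //.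
    by apply: ltnW; apply: H; rewrite mem_head.
  by move=> x xs; apply: H; rewrite inE xs orbT.
rewrite size_enc_seqn; move: (pbound c (size w)) szq szs sms => Z; nia.
Qed.

Lemma answer_short g w : size (answer (gadgetT k) (replyT k) g w) <= (size w).+1.
Proof.
rewrite answerE; apply: leq_trans (size_kept (toks w) k2 _) _.
by rewrite ltnS size_enc_toks_le.
Qed.

(** The ratio is passed on unchanged: alpha times the common optimum is at most the margin of the
    reply, which is at most the number of kept tuples. *)
Lemma answer_ok g : tap_kk_approx_ok k alpha g ->
  dm_approx_ok k alpha (answer (gadgetT k) (replyT k) g).
Proof.
move=> og I valid occ; rewrite answerE enc_dmE enc_toksK; set v := dm_toks I.
have [sol [-> [fsol ratio]]] :=
  og _ (gadget_valid v k2) (gadget_occurrence v k2) (gadget_weight v k2).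
have -> : toks (enc_seqn sol) = size sol :: sol := enc_toksK (size sol :: sol).
exists (kept k v (size sol :: sol)); split=> //; split; first exact: kept_feasible.
move=> n /(gadget_opt k2 valid occ)/ratio le; rewrite !INR_IZR_INZ.
apply: Rle_trans le _; apply: IZR_le.
exact: (margin_le_kept k2 (ans := size sol :: sol)).
Qed.

End Reduction.

Theorem theorem17 (k : nat) (alpha : R) :
  2 <= k -> Rlt alpha R1 -> MaxkDMk_hard k alpha -> TAP_kk_hard k alpha.
Proof.
move=> k2 _; apply: NPhard_transfer (reply_short alpha k2) _ _.
  by move=> g w _; apply: answer_short.
by move=> g; apply: answer_ok.
Qed.
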